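(* The following hold as $n\to\infty$, for any integers $k\ge0$ and $l\ge0$. (i) $$ n^{-(4k+3l)/2}\,\mathbb E\bigl(X_{123}(T_n)^kY(T_n)^l\bigr)\to\frac{k!\,l!\,\sqrt\pi}{2^{4k+3l-2}\,\Gamma((4k+3l-1)/2)}\,\alpha_{k,l} $$ for some numbers $\alpha_{k,l}$ satisfying $\alpha_{0,0}=-1/2$, $\alpha_{1,0}=\alpha_{0,1}=1$ and the recursion relation (for $k+l\ge1$) $$ \alpha_{k,l}=(l+1)\alpha_{k-1,l+1}+2(4k+3l-4)\alpha_{k,l-1}+\sum_{\substack{0\le i\le k,\ 0\le j\le l\\ 0<i+j<k+l}}\alpha_{i,j}\,\alpha_{k-i,l-j}. $$ (ii) $$ n^{-(5k+3l)/2}\,\mathbb E\bigl(X_{213}(T_n)^kY(T_n)^l\bigr)\to\frac{k!\,l!\,\sqrt\pi}{2^{5k+3l-2}\,\Gamma((5k+3l-1)/2)}\,\beta_{k,l} $$ for some numbers $\beta_{k,l}$ satisfying $\beta_{0,0}=-1/2$, $\beta_{1,0}=\beta_{0,1}=1$ and the recursion relation (for $k+l\ge1$) $$ \beta_{k,l}=2(5k+3l-6)(5k+3l-4)\beta_{k-1,l}+2(5k+3l-4)\beta_{k,l-1}+\sum_{\substack{0\le i\le k,\ 0\le j\le l\\ 0<i+j<k+l}}\beta_{i,j}\,\beta_{k-i,l-j}. $$ (iii) $$ n^{-(5k+3l)/2}\,\mathbb E\bigl(X_{231}(T_n)^kY(T_n)^l\bigr)=n^{-(5k+3l)/2}\,\mathbb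 E\bigl(X_{312}(T_n)^kY(T_n)^l\bigr)\to\frac{k!\,l!\,\sqrt\pi}{2^{5k+3l-2}\,\Gamma((5k+3l-1)/2)}\,\gamma_{k,l} $$ for some numbers $\gamma_{k,l}$ satisfying $\gamma_{0,0}=-1/2$, $\gamma_{1,0}=\gamma_{0,1}=1$ and the recursion relation (for $k+l\ge1$) $$ \gamma_{k,l}=2(5k+3l-4)\gamma_{k,l-1}+\sum_{(i,j,m)\ne(0,0,0),(k,l,0)}2^{2m}\,\frac{\Gamma((5i+3j-1)/2+m)}{\Gamma((5i+3j-1)/2)}\binom{l-j+m}{m}\gamma_{i,j}\,\gamma_{k-i-m,\,l-j+m}, $$ where the sum is over integers $i,j,m\ge0$ with $i+m\le k$ and $j\le l$, excluding the two indicated triples. In all three recursions, $\alpha,\beta,\gamma$ with a negative index are interpreted as $0$.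
   Context: $\mathfrak S_n$ is the set of permutations $\pi=\pi_1\cdots\pi_n$ of $[n]$. For $\sigma\in\mathfrak S_k$ and $\pi\in\mathfrak S_n$, $n_\sigma(\pi)$ is the number of subsequences $\pi_{i_1}\cdots\pi_{i_k}$, $1\le i_1<\dots<i_k\le n$, having the same relative order as $\sigma$. $\mathfrak S_n(132)=\{\pi\in\mathfrak S_n:n_{132}(\pi)=0\}$. A binary tree consists of a root and a left and a right subtree, each of which is either empty or itself a binary tree; $\mathcal B_n$ is the set of binary trees with $n$ vertices. For $\pi\in\mathfrak S_n(132)$, $n\ge1$, with $\pi_\ell=n$, let $\pi_L=\pi_1\cdots\pi_{\ell-1}$ and $\pi_R=\pi_{\ell+1}\cdots\pi_n$, regarded as (possibly empty, 132-avoiding) permutations in $\mathfrak S_{\ell-1}$ and $\mathfrak S_{n-\ell}$ by replacing the entries with their ranks. Define $T(\pi)\in\mathcal B_n$ recursively as the binary tree with left subtree $T(\pi_L)$ and right subtree $T(\pi_R)$, where $T(\emptyset)$ is the empty tree. This is a bijection $\mathfrak S_n(132)\to\mathcal B_n$; let $\pi_T$ be the permutation corresponding to a binary tree $T$, and let $X_\sigma(T)=n_\sigma(\pi_T)$ and $Y(T)=X_{12}(T)$. $T_n$ is a uniformly random element of $\mathcal B_n$, so that $X_\sigma(T_n)$ has the distribution of $n_\sigma$ of a uniformly random element of $\mathfrak S_n(132)$ (jointly in $\sigma$). $\Gamma$ is the Gamma function (e.g. $\Gamma(-1/2)=-2\sqrt\pi$). *)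

(* Defs.v *)
From HB Require Import structures.
From mathcomp Require Import all_boot all_order all_fingroup all_algebra.
From mathcomp Require Import all_classical all_reals all_analysis.

Set Implicit Arguments.
Unset Strict Implicit.
Unset Printing Implicit Defensive.

Import Order.TTheory GRing.Theory Num.Theory.
Import numFieldNormedType.Exports.

Local Open Scope ring_scope.

(* Positions and values are 0-based in 'S_n; this is the 1-based one-line word
   pi_1 ... pi_n. *)
Definition oneline (n : nat) (p : 'S_n) : seq nat :=
  [seq (val (p i)).+1 | i <- enum 'I_n].

(* Subsequences are counted by their strictly increasing choices of positions
   f 0 < ... < f (k-1). *)
Definition occ (k n : nat) (s : 'S_k) (p : 'S_n) : nat :=
  #|[pred f : {ffun 'I_k -> 'I_n} |
      [forall a : 'I_k, forall b : 'I_k, (a < b)%N ==> (f a < f b)%N] &&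
      [forall a : 'I_k, forall b : 'I_k,
         (s a < s b)%N == (p (f a) < p (f b))%N]]|.

Definition pat12 : 'S_2 := 1%g.
Definition pat123 : 'S_3 := 1%g.
Definition pat132 : 'S_3 := tperm (inord 1) (inord 2).
Definition pat213 : 'S_3 := tperm (inord 0) (inord 1).
Definition pat231 : 'S_3 :=
  (tperm (inord 0) (inord 1) * tperm (inord 0) (inord 2))%g.
Definition pat312 : 'S_3 :=
  (tperm (inord 0) (inord 2) * tperm (inord 0) (inord 1))%g.

Lemma oneline12 : oneline pat12 = [:: 1; 2]%N.
Proof. by rewrite /oneline !enum_ordSl enum_ord0 /= !perm1. Qed.

Lemma oneline123 : oneline pat123 = [:: 1; 2; 3]%N.
Proof. by rewrite /oneline !enum_ordSl enum_ord0 /= !perm1. Qed.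

Lemma oneline132 : oneline pat132 = [:: 1; 3; 2]%N.
Proof.
by rewrite /oneline !enum_ordSl enum_ord0 /= !permE /= -!val_eqE /= !inordK.
Qed.

Lemma oneline213 : oneline pat213 = [:: 2; 1; 3]%N.
Proof.
by rewrite /oneline !enum_ordSl enum_ord0 /= !permE /= -!val_eqE /= !inordK.
Qed.

Lemma oneline231 : oneline pat231 = [:: 2; 3; 1]%N.
Proof.
rewrite /oneline !enum_ordSl enum_ord0 /= !permM !permE /= -!val_eqE /=.
by rewrite !inordK //= -!val_eqE /= !inordK.
Qed.

Lemma oneline312 : oneline pat312 = [:: 3; 1; 2]%N.
Proof.
rewrite /oneline !enum_ordSl enum_ord0 /= !permM !permE /= -!val_eqE /=.
by rewrite !inordK //= -!val_eqE /= !inordK.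
Qed.

Definition avoids132 (n : nat) : pred 'S_n :=
  [pred p : 'S_n | occ pat132 p == 0%N].

Inductive bintree : Type := Empty | Node (left right : bintree).

Fixpoint nodes (t : bintree) : nat :=
  if t is Node l r then (nodes l + nodes r).+1 else 0%N.

Fixpoint bintree_code (t : bintree) : GenTree.tree void :=
  if t is Node l r then GenTree.Node 1 [:: bintree_code l; bintree_code r]
  else GenTree.Node 0 [::].

Fixpoint bintree_decode (g : GenTree.tree void) : option bintree :=
  match g with
  | GenTree.Node 0 [::] => Some Empty
  | GenTree.Node 1 [:: gl; gr] =>
      if (bintree_decode gl, bintree_decode gr) is (Some l, Some r)
      then Some (Node l r) else None
  | _ => None
  end.

Lemma bintree_codeK : pcancel bintree_code bintree_decode.
Proof. by elim=> //= l -> r ->. Qed.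

HB.instance Definition _ := Countable.copy bintree (pcan_type bintree_codeK).

Fixpoint bintrees_height (h : nat) : seq bintree :=
  if h is h'.+1 then
    Empty :: [seq Node l r | l <- bintrees_height h', r <- bintrees_height h']
  else [:: Empty].

Lemma bintrees_height_uniq h : uniq (bintrees_height h).
Proof.
elim: h => //= h IHh; apply/andP; split; first by apply/allpairsP => -[[]] /= ? ? [].
by apply: allpairs_uniq => // -[l r] [l' r'] _ _ /= [-> ->].
Qed.

Lemma mem_bintrees_height h t : (nodes t <= h)%N -> t \in bintrees_height h.
Proof.
elim: h t => [|h IHh] [|l r] //= ltlr; rewrite inE /=.
rewrite ltnS in ltlr.
by apply: allpairs_f; apply: IHh; apply: leq_trans ltlr; rewrite (leq_addr, leq_addl).
Qed.

Definition btree (n : nat) := {t : bintree | nodes t == n}.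

Definition btree_enum (n : nat) : seq (btree n) :=
  pmap insub (bintrees_height n).

Lemma btree_enumP n : Finite.axiom (btree_enum n).
Proof.
apply: Finite.uniq_enumP => [|t].
  exact: pmap_sub_uniq (bintrees_height_uniq n).
by rewrite mem_pmap_sub /= mem_bintrees_height // (eqP (valP t)).
Qed.

HB.instance Definition _ (n : nat) := Countable.on (btree n).
HB.instance Definition _ (n : nat) :=
  fintype.isFinite.Build (btree n) (@btree_enumP n).

Definition ranks (w : seq nat) : seq nat :=
  [seq count (fun y => (y <= x)%N) w | x <- w].

(* The one-line word w of a permutation of 1, ..., size w is cut at its largest
   letter size w.  The fuel m only ensures termination: m = size w suffices,
   since both pieces are shorter than w. *)
Fixpoint word_tree (m : nat) (w : seq nat) : bintree :=
  if m is m'.+1 then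
    if nilp w then Empty else
    let l := index (size w) w in
    Node (word_tree m' (ranks (take l w))) (word_tree m' (ranks (drop l.+1 w)))
  else Empty.

Definition tree_of_perm (n : nat) (p : 'S_n) : bintree :=
  word_tree n (oneline p).

(* The inverse of tree_of_perm on 132-avoiding permutations.  Since tree_of_perm
   is a bijection from these onto btree n, there is exactly one candidate and
   the default value 1 is never used. *)
Definition perm_of_tree (n : nat) (t : btree n) : 'S_n :=
  odflt 1%g [pick p in @avoids132 n | tree_of_perm p == val t].

Definition X (k n : nat) (s : 'S_k) (t : btree n) : nat :=
  occ s (perm_of_tree t).

Definition Y (n : nat) (t : btree n) : nat := X pat12 t.

(* Expectation of f T_n for T_n uniformly distributed on btree n. *)
Definition expect (R : realType) (n : nat) (f : btree n -> R) : R :=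
  (\sum_(t : btree n) f t) / #|{: btree n}|%:R.

Definition Gamma_integral (R : realType) (x : R) : R :=
  (\int[lebesgue_measure]_(t in `]0, +oo[%classic) (t `^ (x - 1) * expR (- t)))%R.

(* Euler's integral for x > 0, extended to x <= 0 through
   Gamma x = Gamma (x + n) / (x (x + 1) ... (x + n - 1)) with n minimal such that
   x + n > 0; the value at the poles 0, -1, -2, ... is 0 by convention. *)
Definition Gamma (R : realType) (x : R) : R :=
  if 0 < x then Gamma_integral x
  else let n := (Num.truncn (- x)).+1 in
       Gamma_integral (x + n%:R) / \prod_(i < n) (x + i%:R).

(* Main.v *)
Require Import Defs.
From mathcomp Require Import all_boot all_order all_fingroup all_algebra.
From mathcomp Require Import all_classical all_reals all_analysis.
From mathcomp Require Import measurable_realfun.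
From mathcomp Require Import ring lra zify.
Import Order.TTheory GRing.Theory Num.Theory.
Import numFieldNormedType.Exports.
Local Open Scope ring_scope.
Local Open Scope classical_set_scope.
Set Implicit Arguments.
Unset Strict Implicit.
Unset Printing Implicit Defensive.

(** For the binary tree with left and right subtrees [L] and [R], cutting a
    132-avoiding permutation at its largest letter gives
    [X (Node L R) = X L + X R + H L * K R], where [H * K] is [Y L] for 123,
    [C(|L|, 2) - Y L] for 213 and [(Y L + |L|) |R|] for 231.  Expanding the
    divided powers [X^k / k! Y^l / l!], their generating functions by number of
    leaves satisfy quadratic equations, and by induction on the weight
    [d k + 3 l] ([d = 4] or [5]) they are Laurent polynomials in
    [s = sqrt (1 - 4 x)], of order [- (d k + 3 l - 1)], whose leading coefficients
    satisfy the stated recursion: the terms in which one subtree carries the whole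
    monomial combine with the left-hand side into a factor [s], as
    [1 - 2 C(x) = s] for the Catalan series [C].  The coefficient of [x^n] in
    [s^-m] is [4^n] times a rising factorial of [m / 2] over [n!], so the limits
    reduce to the asymptotics of these ratios at half-integers.  Finally 231 and 312
    are exchanged, and [Y] is preserved, by the involution on trees which
    corresponds to the inversion of permutations. *)

(** * Gamma at half-integers *)

(** No singularity analysis is needed: each series is a finite combination of powers of [s], so
    passing to coefficients is exact and termwise. The weights come from [x d/dx], which raises the
    order in [s^-1] by 2: the size has weight 2, and the Catalan series [(1 - s) / 2], of order -1,
    explains the shift in [d k + 3 l - 1]. The delicate point is the constant 1/2 of the Catalan
    series. It dominates the power of [s] beside it, so it is carried separately throughout. A
    splitting of a monomial that loses one order can regain it when the right subtree carries only
    this constant; this is the origin of the terms outside the sums in the recursions. The numbers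
    in the statement are [2 ^ (d k + 3 l)] times the leading coefficients, which clears the halves.
    The factor [4 sqrt pi] comes from dividing by the Catalan number, a coefficient of [- s / 2],
    with [Gamma (- 1/2) = - 2 sqrt pi]. As [Gamma] is given by an integral, its functional equation
    and growth at half-integers are derived from the moments of [exp (- u^2)] on the half-line. *)

Section GaussMoments.
Context {R : realType}.
Notation mu := (@lebesgue_measure R).

Definition gmom_fun (m : nat) (u : R) : R := u ^+ m * gauss_fun u.

Definition gmom (m : nat) : \bar R :=
  (\int[mu]_(u in `[0%R, +oo[) (gmom_fun m u)%:E)%E.

Lemma gmom_fun_ge0 m u : 0 <= u -> 0 <= gmom_fun m u.
Proof. by move=> u0; rewrite mulr_ge0 ?gauss_fun_ge0 // exprn_ge0. Qed.

Lemma continuous_gmom_fun m : continuous (gmom_fun m).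
Proof.
by move=> u; apply: cvgM; [exact: exprn_continuous|exact: continuous_gauss_fun].
Qed.

Lemma is_derive_gauss_fun (u : R) :
  is_derive u 1 (gauss_fun : R -> R) (- (2 * u) * gauss_fun u).
Proof.
have h : is_derive u 1 (fun x : R => - x ^+ 2) (- (2 * u)).
  have h := is_deriveN (is_deriveX 2 (is_derive_id u (1 : R))).
  apply: (is_derive_eq (f := fun x : R => - x ^+ 2) h).
  by rewrite expr1 /GRing.scale /= mulr1.
have := @is_derive1_comp R expR _ u _ _ (is_derive_expR _) h.
by rewrite mulrC.
Qed.

(** Integrated over the half-line, this identity links the moments [m] and [m.+2]. *)
Lemma is_derive_gmom_fun m (u : R) :
  is_derive u 1 (gmom_fun m.+1)
    (m.+1%:R * gmom_fun m u - 2 * gmom_fun m.+2 u).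
Proof.
have h1 : is_derive u 1 (fun x : R => x ^+ m.+1) (m.+1%:R * u ^+ m).
  have h := is_deriveX m.+1 (is_derive_id u (1 : R)).
  rewrite exprfctE in h; apply: is_derive_eq h _.
  by rewrite /GRing.scale /= mulr1.
have h := is_deriveM h1 (is_derive_gauss_fun u).
rewrite /gmom_fun; apply: is_derive_eq.
by rewrite /GRing.scale /= !exprS; ring.
Qed.

Lemma gmom_fun_cvg0 m : gmom_fun m n%:R @[n --> \oo] --> (0 : R).
Proof.
(* For [1 <= u], [u^(m+1) <= (u^2)^(m+1) <= (m+1)! exp (u^2)], by a single term of the exponential
   series. *)
have bnd u : 1 <= u -> gmom_fun m u <= m.+1`!%:R * u^-1.
  move=> u1; have u0 : 0 < u by apply: lt_le_trans u1.
  rewrite /gmom_fun /gauss_fun expRN ler_pdivrMr ?expR_gt0 //.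
  rewrite -mulrA [u^-1 * _]mulrC mulrA ler_pdivlMr // -exprSr.
  have h : u ^+ m.+1 <= (u ^+ 2) ^+ m.+1.
    by rewrite -exprM mul2n -addnn ler_weXn2l // leq_addr.
  apply: le_trans h _.
  have := expR_ge1Dxn m (sqr_ge0 u).
  rewrite -lerBrDl ler_pdivrMr ?ltr0n ?fact_gt0 // => h.
  apply: le_trans h _.
  rewrite mulrC ler_pM2l ?ltr0n ?fact_gt0 //; lra.
apply: (@squeeze_cvgr _ _ _ _ (cst 0) (fun n : nat => m.+1`!%:R * n%:R^-1)).
- near=> n; rewrite gmom_fun_ge0 //= bnd // ler1n.
  by near: n; exact: nbhs_infty_gt.
- exact: cvg_cst.
- rewrite -[X in _ --> X](mulr0 m.+1`!%:R).
  apply: cvgM; first exact: cvg_cst.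
  apply/gtr0_cvgV0; last exact: cvgr_idn.
  by near=> n; rewrite ltr0n; near: n; exact: nbhs_infty_gt.
Unshelve. all: by end_near. Qed.

Lemma cvg_gmom m :
  (\int[mu]_(u in `[0%R, n%:R]) (gmom_fun m u)%:E)%E @[n --> \oo] --> gmom m.
Proof.
have -> : gmom m = (\int[mu]_(u in \bigcup_n `[0%R, n%:R]) (gmom_fun m u)%:E)%E.
  rewrite /gmom; congr (integral _ _ _); apply/seteqP; split => u /=.
    rewrite in_itv /= andbT => u0.
    exists (Num.truncn u).+1 => //=.
    by rewrite in_itv /= u0 ltW // truncnS_gt.
  by case=> n _ /=; rewrite !in_itv /= andbT => /andP[].
apply: ge0_nondecreasing_set_cvg_integral => //.
- move=> a b ab; rewrite subsetEset; apply: subset_itvl.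
  by rewrite bnd_simp ler_nat.
- move=> i; apply/measurable_EFinP/measurable_funTS.
  by apply: continuous_measurable_fun; exact: continuous_gmom_fun.
- by move=> i x /=; rewrite in_itv /= => /andP[x0 _]; rewrite lee_fin gmom_fun_ge0.
Qed.

Lemma gmom_fun_integrable m (a : R) :
  mu.-integrable `[0, a] (EFin \o gmom_fun m).
Proof.
apply: continuous_compact_integrable; first exact: segment_compact.
by apply: continuous_subspaceT; exact: continuous_gmom_fun.
Qed.

(** The fundamental theorem of calculus for [u^(m+1) exp (- u^2)] on [[0, n]], whose boundary term
    tends to 0. Finiteness of the moment [m] lets the limit pass through the sum; [gmom_fin]
    supplies it by a two-step induction. *)
Lemma gmomSS m : gmom m \is a fin_num ->
  gmom m.+2 = ((m.+1%:R / 2)%:E * gmom m)%E.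
Proof.
move=> gm.
pose h u := m.+1%:R * gmom_fun m u - 2 * gmom_fun m.+2 u.
have E n : (0 < n)%N ->
  (\int[mu]_(u in `[0%R, n%:R]) (gmom_fun m.+2 u)%:E =
   (m.+1%:R / 2)%:E * \int[mu]_(u in `[0%R, n%:R]) (gmom_fun m u)%:E
   + (- (gmom_fun m.+1 n%:R / 2))%:E)%E.
  move=> n0.
  have F : (\int[mu]_(u in `[0%R, n%:R]) (h u)%:E =
     (gmom_fun m.+1 n%:R)%:E - (gmom_fun m.+1 0)%:E)%E.
    apply: (@continuous_FTC2 R h (gmom_fun m.+1)).
    - by rewrite ltr0n.
    - apply: continuous_subspaceT => u.
      by apply: cvgB; apply: cvgM; (try exact: cvg_cst);
        exact: continuous_gmom_fun.
    - split.
      + by move=> x _; have [] := is_derive_gmom_fun m x.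
      + by apply: cvg_at_right_filter; exact: continuous_gmom_fun.
      + by apply: cvg_at_left_filter; exact: continuous_gmom_fun.
    - move=> x _; rewrite derive1E; have h' := is_derive_gmom_fun m x.
      by rewrite (@derive_val _ _ _ _ _ _ _ h').
  have F0 : gmom_fun m.+1 0 = 0 by rewrite /gmom_fun exprS !mul0r.
  rewrite F0 oppe0 adde0 in F.
  have : (\int[mu]_(u in `[0%R, n%:R]) (h u)%:E =
     m.+1%:R%:E * \int[mu]_(u in `[0%R, n%:R]) (gmom_fun m u)%:E
     - 2%:E * \int[mu]_(u in `[0%R, n%:R]) (gmom_fun m.+2 u)%:E)%E.
    rewrite -!integralZl //; try exact: gmom_fun_integrable.
    by rewrite -integralB //; apply: integrableZl => //; exact: gmom_fun_integrable.
  rewrite F.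
  have /fineK <- : (\int[mu]_(u in `[0%R, n%:R]) (gmom_fun m u)%:E)%E \is a fin_num.
    by apply: integrable_fin_num => //; exact: gmom_fun_integrable.
  have /fineK <- : (\int[mu]_(u in `[0%R, n%:R]) (gmom_fun m.+2 u)%:E)%E \is a fin_num.
    by apply: integrable_fin_num => //; exact: gmom_fun_integrable.
  rewrite /comp -!EFinM -EFinB -EFinD => -[->]; congr (_%:E); by field.
have c1 := @cvg_gmom m.+2.
have c2 : ((m.+1%:R / 2)%:E * \int[mu]_(u in `[0%R, n%:R]) (gmom_fun m u)%:E
   + (- (gmom_fun m.+1 n%:R / 2))%:E)%E @[n --> \oo] -->
   ((m.+1%:R / 2)%:E * gmom m + (- (0 / 2))%:E)%E.
  apply: cvgeD.
  - by rewrite fin_num_adde_defl.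
  - by apply: cvgeZl => //; exact: cvg_gmom.
  - apply: cvg_EFin; first exact: nearW.
    apply: cvgN; apply: cvgM; last exact: cvg_cst.
    exact: gmom_fun_cvg0.
rewrite mul0r oppr0 adde0 in c2.
have c3 : (\int[mu]_(u in `[0%R, n%:R]) (gmom_fun m.+2 u)%:E)%E @[n --> \oo] -->
   ((m.+1%:R / 2)%:E * gmom m)%E.
  apply: cvg_trans c2; apply: near_eq_cvg; near=> n; rewrite -E //.
  by near: n; exact: nbhs_infty_gt.
exact: (cvg_unique _ c1 c3).
Unshelve. all: by end_near. Qed.

Lemma gmom0 : gmom 0 = (Num.sqrt pi / 2)%:E.
Proof.
rewrite -integral0y_gauss; apply: eq_integral => u _.
by rewrite /gmom_fun expr0 mul1r.
Qed.

Lemma gmom1 : gmom 1 = (2^-1)%:E.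
Proof.
have E n : (0 < n)%N ->
  (\int[mu]_(u in `[0%R, n%:R]) (gmom_fun 1 u)%:E =
   (2^-1 - gmom_fun 0 n%:R / 2)%:E)%E.
  move=> n0.
  have d (x : R) : is_derive x 1 (fun u : R => - (gmom_fun 0 u / 2)) (gmom_fun 1 x).
    have h := is_derive_gauss_fun x.
    rewrite /gmom_fun; under eq_fun do rewrite expr0 mul1r.
    by apply: is_derive_eq; rewrite /GRing.scale /=; field.
  rewrite (@continuous_FTC2 R (gmom_fun 1) (fun u => - (gmom_fun 0 u / 2))).
  - rewrite -EFinB; congr (_%:E).
    by rewrite opprK addrC /gmom_fun !expr0 /gauss_fun expr0n /= oppr0 expR0; field.
  - by rewrite ltr0n.
  - apply: continuous_subspaceT => u; exact: continuous_gmom_fun.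
  - have c : continuous (fun u => - (gmom_fun 0 u / 2)).
      move=> x; apply: cvgN; apply: cvgM; last exact: cvg_cst.
      exact: continuous_gmom_fun.
    split.
    + by move=> x _; have [] := d x.
    + by apply: cvg_at_right_filter; exact: c.
    + by apply: cvg_at_left_filter; exact: c.
  - by move=> x _; rewrite derive1E; have h' := d x; rewrite derive_val.
have c1 := @cvg_gmom 1.
have c2 : (2^-1 - gmom_fun 0 n%:R / 2)%:E @[n --> \oo] --> (2^-1 - 0 / 2 : R)%:E.
  apply: cvg_EFin; first exact: nearW.
  apply: cvgB; first exact: cvg_cst.
  by apply: cvgM; [exact: gmom_fun_cvg0|exact: cvg_cst].
rewrite mul0r subr0 in c2.
apply: (cvg_unique _ c1); first exact: ereal_hausdorff.
apply: cvg_trans c2; apply: near_eq_cvg; near=> n; rewrite -E //.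
by near: n; exact: nbhs_infty_gt.
Unshelve. all: by end_near. Qed.

Lemma gmom_fin m : gmom m \is a fin_num.
Proof.
elim/ltn_ind: m => -[|[|m]] IH; rewrite ?gmom0 ?gmom1 //.
by rewrite gmomSS ?IH // fin_numM ?IH.
Qed.

(** Integrates [c^-1 (c - u)^2 u^m exp (- u^2) >= 0]. This is log-convexity of the moments in linear
    form, with [c] left free for a later optimal choice. *)
Lemma gmom_convex m (c : R) : 0 < c ->
  2 * fine (gmom m.+1) <= c * fine (gmom m) + c^-1 * fine (gmom m.+2).
Proof.
move=> c0; rewrite -lee_fin EFinD !EFinM !fineK ?gmom_fin //.
have mf k : measurable_fun (`[0%R, +oo[ : set R) (fun u : R => (gmom_fun k u)%:E).
  apply/measurable_EFinP/measurable_funTS.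
  by apply: continuous_measurable_fun; exact: continuous_gmom_fun.
have ge0 k (u : R) : (`[0%R, +oo[ : set R) u -> (0 <= (gmom_fun k u)%:E)%E.
  by rewrite /= in_itv /= andbT => u0; rewrite lee_fin gmom_fun_ge0.
have c0' : (0 <= c^-1%:E)%E by rewrite lee_fin invr_ge0 ltW.
rewrite -!ge0_integralZl //; try exact: mf; try exact: ge0; try by rewrite lee_fin ltW.
rewrite -ge0_integralD //; first last.
- by apply: emeasurable_funM => //; exact: mf.
- by move=> x /ge0 h; rewrite mule_ge0.
- by apply: emeasurable_funM => //; exact: mf.
- by move=> x /ge0 h; rewrite mule_ge0 // lee_fin ltW.
apply: ge0_le_integral => //.
- by move=> x /ge0 h; rewrite mule_ge0 // lee_fin.
- by apply: emeasurable_funM => //; exact: mf.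
- by apply: emeasurable_funD; apply: emeasurable_funM => //; exact: mf.
- move=> u /=; rewrite in_itv /= andbT => u0.
  rewrite -!EFinM -EFinD lee_fin /gmom_fun !exprS.
  have g0 : 0 <= u ^+ m * gauss_fun u by rewrite gmom_fun_ge0.
  rewrite -subr_ge0.
  have -> : c * (u ^+ m * gauss_fun u) + c^-1 * (u * (u * u ^+ m) * gauss_fun u)
     - 2 * (u * u ^+ m * gauss_fun u) =
     c^-1 * (c - u) ^+ 2 * (u ^+ m * gauss_fun u).
    by field; lra.
  by rewrite mulr_ge0 // mulr_ge0 ?sqr_ge0 // invr_ge0 ltW.
Qed.

End GaussMoments.

(** * The Gamma integral as a Gaussian moment *)

Section GammaHalf.
Context {R : realType}.
Notation mu := (@lebesgue_measure R).

(** The exhaustion is parametrised by [f] so that the choices of squaring and of the identity give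
    compact intervals that correspond under [t = u^2]. *)
Lemma itv_oy_bigcup (f : R -> R) : (forall x : R, 0 < x -> exists2 r : R, 0 < r & x = f r) ->
  (forall r, 0 < r -> 0 < f r) -> {in Num.pos &, {homo f : x y / x <= y}} ->
  (`]0%R, +oo[ : set R) = \bigcup_n `[f n.+1%:R^-1, f n.+1%:R].
Proof.
move=> fsurj f0 fle; apply/seteqP; split => x /=.
  rewrite in_itv /= andbT => /fsurj[r r0 ->].
  exists (maxn (Num.truncn r) (Num.truncn r^-1)) => //=.
  have rp : r \in Num.pos by [].
  rewrite in_itv /=; apply/andP; split; apply: fle => //; rewrite ?posrE ?ltr0n ?invr_gt0 ?ltr0n //.
    rewrite -[leRHS]invrK lef_pV2 ?posrE ?invr_gt0 ?ltr0n //.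
    by apply: le_trans (ltW (truncnS_gt r^-1)) _; rewrite ler_nat ltnS leq_maxr.
  by apply: le_trans (ltW (truncnS_gt r)) _; rewrite ler_nat ltnS leq_maxl.
case=> n _ /=; rewrite !in_itv /= andbT => /andP[h _].
by apply: lt_le_trans h; apply: f0; rewrite invr_gt0 ltr0n.
Qed.

Lemma cvg_integral_oy (g : R -> R) (f : R -> R) :
  (forall x : R, 0 < x -> exists2 r : R, 0 < r & x = f r) ->
  (forall r, 0 < r -> 0 < f r) -> {in Num.pos &, {homo f : x y / x <= y}} ->
  measurable_fun (`]0%R, +oo[ : set R) g -> (forall x, 0 < x -> 0 <= g x) ->
  (\int[mu]_(u in `[f (n.+1%:R^-1)%R, f n.+1%:R]) (g u)%:E)%E @[n --> \oo] -->
   (\int[mu]_(u in `]0%R, +oo[) (g u)%:E)%E.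
Proof.
move=> fsurj f0 fle mg g0.
rewrite (itv_oy_bigcup fsurj f0 fle).
have pos n : 0 < (n.+1%:R : R)^-1 by rewrite invr_gt0 ltr0n.
have fpos n (x : R) : f n.+1%:R^-1 <= x -> 0 < x.
  by apply: lt_le_trans; apply: f0.
apply: ge0_nondecreasing_set_cvg_integral => //.
- move=> a b ab; rewrite subsetEset; apply: subset_itv; rewrite bnd_simp; apply: fle;
    rewrite ?posrE ?ltr0n ?pos // ?ler_nat // lef_pV2 ?posrE ?ltr0n // ler_nat //.
- move=> i; apply/measurable_EFinP; apply: measurable_funS mg => //.
  by move=> x /=; rewrite !in_itv /= andbT => /andP[/fpos].
- by move=> i x /=; rewrite in_itv /= => /andP[/fpos x0 _]; rewrite lee_fin g0.
Qed.

Lemma continuous_gamma_fun (x t : R) : 0 < t ->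
  {for t, continuous (fun t : R => t `^ (x - 1) * expR (- t))}.
Proof.
move=> t0; apply: cvgM.
  have : {for t, continuous (fun t : R => t `^ (x - 1))}; last by [].
  apply/differentiable_continuous/derivable1_diffP.
  by apply: derivable_powR; rewrite in_itv /= t0.
by apply: (continuous_comp (f := fun t : R => - t) (g := expR));
  [apply: cvgN | exact: continuous_expR].
Qed.

(* The substitution [t = u ^+ 2]. *)
Lemma Gamma_integral_gmom m :
  Gamma_integral (m.+1%:R / 2) = 2 * fine (gmom m) :> R.
Proof.
pose G (t : R) := t `^ (m.+1%:R / 2 - 1) * expR (- t).
rewrite /Gamma_integral /Rintegral -[RHS]/(fine 2%:E * fine (gmom m)).
rewrite -fineM ?gmom_fin //; congr fine.
have Gc (t : R) : 0 < t -> {for t, continuous G} by exact: continuous_gamma_fun.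
have c1 : (\int[mu]_(u in `[(n.+1%:R^-1 ^+ 2)%R, (n.+1%:R ^+ 2)%R]) (G u)%:E)%E @[n --> \oo] -->
   (\int[mu]_(u in `]0%R, +oo[) (G u)%:E)%E.
  apply: (@cvg_integral_oy G (fun x => x ^+ 2)).
  - by move=> x x0; exists (Num.sqrt x); rewrite ?sqrtr_gt0 // sqr_sqrtr // ltW.
  - by move=> r r0; rewrite exprn_gt0.
  - by move=> x y; rewrite !posrE => x0 y0 xy; rewrite lerXn2r // nnegrE ltW.
  - apply: open_continuous_measurable_fun => //.
    by move=> x; rewrite inE /= in_itv /= andbT => /Gc.
  - by move=> x x0; rewrite mulr_ge0 ?powR_ge0 ?expR_ge0.
have c2 : (\int[mu]_(u in `[(n.+1%:R^-1)%R, n.+1%:R]) (2 * gmom_fun m u)%:E)%E @[n --> \oo] -->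
   (\int[mu]_(u in `]0%R, +oo[) (2 * gmom_fun m u)%:E)%E.
  apply: (@cvg_integral_oy (fun u => 2 * gmom_fun m u) id) => //.
  - by move=> x x0; exists x.
  - apply: measurable_funTS; apply: continuous_measurable_fun => x.
    by apply: cvgM; [exact: cvg_cst|exact: continuous_gmom_fun].
  - by move=> x x0; rewrite mulr_ge0 // gmom_fun_ge0 // ltW.
have d (x : R) : is_derive x 1 (fun x : R => x ^+ 2) (2 * x).
  have h := is_deriveX 2 (is_derive_id x (1 : R)).
  by rewrite exprfctE in h; apply: is_derive_eq h _; rewrite expr1 /GRing.scale /= mulr1.
have d' : (fun x : R => x ^+ 2)^`() = (fun x => 2 * x).
  by apply/funext => x; rewrite derive1E; have h := d x; rewrite derive_val.
(* The substitution is made on compact intervals away from 0, since for [m = 0] the integrand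
   [t^(-1/2) exp (- t)] is unbounded near 0. *)
have sq (n : nat) : (\int[mu]_(u in `[(n.+1%:R^-1 ^+ 2)%R, (n.+1%:R ^+ 2)%R]) (G u)%:E =
   \int[mu]_(u in `[(n.+1%:R^-1)%R, n.+1%:R]) (2 * gmom_fun m u)%:E)%E.
  have p0 : 0 < (n.+1%:R : R)^-1 by rewrite invr_gt0 ltr0n.
  have le1 : (n.+1%:R : R)^-1 <= n.+1%:R.
    by apply: (@le_trans _ _ 1); rewrite ?invf_le1 ?ltr0n // ler1n.
  have c2x : continuous (fun x : R => 2 * x).
    by move=> x; apply: cvgM; [exact: cvg_cst|exact: cvg_id].
  rewrite (@integration_by_substitution_increasing R (fun x => x ^+ 2) G) //.
  - apply: eq_integral => u; rewrite inE /= in_itv /= => /andP[un _].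
    have u0 : 0 < u by exact: lt_le_trans un.
    rewrite d' /G /gmom_fun /gauss_fun !fctE /=; congr (_%:E).
    rewrite -powR_mulrn ?ltW // -powRrM.
    have -> : 2 * (m.+1%:R / 2 - 1) = m%:R - 1 :> R by rewrite -natr1; field.
    have -> : u ^+ m = u `^ (m%:R - 1) * u.
      rewrite -{3}(powRr1 (ltW u0)) -powRD ?subrK ?powR_mulrn ?ltW //.
      by apply/implyP => _; rewrite gt_eqF.
    by rewrite powR_mulrn ?ltW //; ring.
  - move=> x y; rewrite !in_itv /= => /andP[x0 _] /andP[y0 _] xy.
    by rewrite ltrXn2r // ltW // (lt_le_trans p0).
  - by rewrite d' => x _; exact: c2x.
  - by rewrite d'; apply/cvg_ex; eexists; apply: cvg_at_right_filter; exact: c2x.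
  - by rewrite d'; apply/cvg_ex; eexists; apply: cvg_at_left_filter; exact: c2x.
  - split.
    + by move=> x _; have [] := d x.
    + by apply: cvg_at_right_filter; exact: exprn_continuous.
    + by apply: cvg_at_left_filter; exact: exprn_continuous.
  - apply: continuous_in_subspaceT => x; rewrite inE /= in_itv /= => /andP[x0 _].
    by apply: Gc; apply: lt_le_trans x0; rewrite exprn_gt0.
move: c1; rewrite (eq_cvg _ _ sq) => c1.
rewrite -[LHS](cvg_unique _ c2 c1) //.
have mg : measurable_fun (`]0%R, +oo[ : set R) (fun u : R => (gmom_fun m u)%:E).
  apply/measurable_EFinP/measurable_funTS.
  by apply: continuous_measurable_fun; exact: continuous_gmom_fun.
rewrite /gmom -integral_itv_obnd_cbnd // -ge0_integralZl //.
by move=> x /=; rewrite in_itv /= andbT => x0; rewrite lee_fin gmom_fun_ge0 // ltW.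
Qed.

Lemma Gamma_pos_half m : Gamma (m.+1%:R / 2) = 2 * fine (gmom m) :> R.
Proof. by rewrite /Gamma divr_gt0 ?ltr0n // Gamma_integral_gmom. Qed.

Lemma Gamma_half : Gamma (2^-1) = Num.sqrt pi :> R.
Proof.
have := Gamma_pos_half 0; rewrite mul1r => ->.
by rewrite gmom0 /=; field.
Qed.

Lemma Gamma1 : Gamma 1 = 1 :> R.
Proof.
have := Gamma_pos_half 1; rewrite divff // => ->.
by rewrite gmom1 /=; field.
Qed.

Lemma Gamma_halfS m : Gamma (m.+1%:R / 2 + 1) = m.+1%:R / 2 * Gamma (m.+1%:R / 2) :> R.
Proof.
have -> : m.+1%:R / 2 + 1 = m.+3%:R / 2 :> R.
  by rewrite -[m.+3]addn2 natrD; field.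
by rewrite !Gamma_pos_half gmomSS ?gmom_fin // fineM ?gmom_fin //=; ring.
Qed.

Lemma Gamma_neghalf : Gamma (- 2^-1) = - 2 * Num.sqrt pi :> R.
Proof.
(* A single shift suffices: the definition unfolds to [Gamma (1/2) / (- 1/2)]. *)
have t0 : Num.truncn (2^-1 : R) = 0%N.
  by apply: truncn_def; rewrite invr_ge0 ler0n /= invf_lt1 ?ltr1n.
rewrite /Gamma oppr_gt0 ltNge invr_ge0 ler0n /= opprK t0 big_ord_recl big_ord0 /=.
have -> : - 2^-1 + 1 = 1 / 2 :> R by field.
by rewrite (Gamma_integral_gmom 0) gmom0 /= addr0; field.
Qed.

Lemma Gamma_half_convex m (c : R) : 0 < c ->
  2 * Gamma (m.+2%:R / 2) <= c * Gamma (m.+1%:R / 2) + c^-1 * Gamma (m.+3%:R / 2) :> R.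
Proof.
move=> c0; rewrite !Gamma_pos_half; have := gmom_convex m c0.
by nra.
Qed.

Lemma Gamma_half_gt0 m : 0 < Gamma (m.+1%:R / 2) :> R.
Proof.
elim/ltn_ind: m => -[|[|m]] IH.
- by rewrite mul1r Gamma_half sqrtr_gt0 pi_gt0.
- by rewrite divff // Gamma1.
- have -> : m.+3%:R / 2 = m.+1%:R / 2 + 1 :> R.
    by rewrite -[m.+3]addn2 natrD; field.
  by rewrite Gamma_halfS mulr_gt0 // ?IH // divr_gt0 // ltr0n.
Qed.

End GammaHalf.

(** * Coefficients of powers of sqrt (1 - 4 x) *)

Section RisingCoefficients.
Context {R : realType}.

(* [rf a n = a (a + 1) ... (a + n - 1) / n!], the coefficient of [x ^+ n] in
   [(1 - x) `^ (- a)]. *)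
Definition rf (a : R) (n : nat) : R := \prod_(i < n) ((a + i%:R) / i.+1%:R).

Lemma rf0 a : rf a 0 = 1. Proof. by rewrite /rf big_ord0. Qed.

Lemma rfS a n : rf a n.+1 = rf a n * ((a + n%:R) / n.+1%:R).
Proof. by rewrite /rf big_ord_recr. Qed.

Lemma rfSn a n : n.+1%:R * rf a n.+1 = (a + n%:R) * rf a n.
Proof.
have n0 : n.+1%:R != 0 :> R by rewrite pnatr_eq0.
by rewrite rfS; field.
Qed.

Lemma rf_shift a n : rf (a + 1) n * a = rf a n * (a + n%:R).
Proof.
elim: n => [|n IH]; first by rewrite !rf0 addr0.
have n0 : n.+1%:R != 0 :> R by rewrite pnatr_eq0.
rewrite !rfS mulrAC IH -[in RHS]natr1.
by rewrite -natr1 in n0 *; field.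
Qed.

(** The index is [n.+1] because the trees with [n] vertices sit at the exponent [n + 1], their
    number of leaves. *)
Definition rf_lim (a l : R) := rf a n.+1 * n%:R `^ (1 - a) @[n --> \oo] --> l.

Lemma cvg_addn_div (c : R) : (c + n%:R) / n%:R @[n --> \oo] --> (1 : R).
Proof.
have h : c * n%:R^-1 + 1 @[n --> \oo] --> (c * 0 + 1 : R).
  apply: cvgD; last exact: cvg_cst.
  apply: cvgM; first exact: cvg_cst.
  apply/gtr0_cvgV0; last exact: cvgr_idn.
  by near=> n; rewrite ltr0n; near: n; exact: nbhs_infty_gt.
rewrite mulr0 add0r in h.
apply: cvg_trans h; apply: near_eq_cvg; near=> n.
have n0 : n%:R != 0 :> R by rewrite pnatr_eq0 -lt0n; near: n; exact: nbhs_infty_gt.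
by rewrite mulrDl divff.
Unshelve. all: by end_near. Qed.

Lemma rf_limS a l : a != 0 -> rf_lim a l -> rf_lim (a + 1) (l / a).
Proof.
move=> a0 h.
have h2 : rf a n.+1 * n%:R `^ (1 - a) * ((a + 1 + n%:R) / n%:R) * a^-1 @[n --> \oo]
    --> l * 1 * a^-1.
  apply: cvgM; last exact: cvg_cst.
  by apply: cvgM => //; exact: cvg_addn_div.
rewrite mulr1 in h2.
apply: cvg_trans h2; apply: near_eq_cvg; near=> n.
have n0 : n%:R != 0 :> R by rewrite pnatr_eq0 -lt0n; near: n; exact: nbhs_infty_gt.
have -> : rf (a + 1) n.+1 = rf a n.+1 * (a + n.+1%:R) / a.
  by rewrite -rf_shift mulfK.
have -> : n%:R `^ (1 - (a + 1)) = n%:R `^ (1 - a) / n%:R :> R.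
  have -> : 1 - (a + 1) = (1 - a) - 1 by ring.
  by rewrite powRB ?powRr1 // n0 implybT.
by rewrite -natr1; field; rewrite n0 a0.
Unshelve. all: by end_near. Qed.

(** The downward shift reaches nonpositive parameters; at [a = 0] it gives the limit 0. *)
Lemma rf_lim_pred a l : rf_lim (a + 1) l -> rf_lim a (l * a).
Proof.
move=> h.
have h2 : rf (a + 1) n.+1 * n%:R `^ (1 - (a + 1)) * a * ((a + 1 + n%:R) / n%:R)^-1
     @[n --> \oo] --> l * a * 1^-1.
  apply: cvgM; first by apply: cvgM => //; exact: cvg_cst.
  by apply: cvgV; rewrite ?oner_neq0 //; exact: cvg_addn_div.
rewrite invr1 mulr1 in h2.
apply: cvg_trans h2; apply: near_eq_cvg; near=> n.
have n0 : n%:R != 0 :> R by rewrite pnatr_eq0 -lt0n; near: n; exact: nbhs_infty_gt.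
have an0 : a + 1 + n%:R != 0.
  rewrite gt_eqF // -ltrBlDl sub0r; near: n; exact: nbhs_infty_gtr.
have -> : n%:R `^ (1 - (a + 1)) = n%:R `^ (1 - a) / n%:R :> R.
  have -> : 1 - (a + 1) = (1 - a) - 1 by ring.
  by rewrite powRB ?powRr1 // n0 implybT.
have := rf_shift a n.+1; rewrite -natr1 => e.
transitivity (rf (a + 1) n.+1 * a * (n%:R `^ (1 - a) / (a + 1 + n%:R))).
  by field; rewrite n0 an0.
by rewrite e; field.
Unshelve. all: by end_near. Qed.

Lemma rf_lim_lower a a' l : a < a' -> rf_lim a l ->
  rf a n.+1 * n%:R `^ (1 - a') @[n --> \oo] --> (0 : R).
Proof.
move=> aa' h.
have h2 : rf a n.+1 * n%:R `^ (1 - a) * (n%:R^-1) `^ (a' - a) @[n --> \oo] --> l * 0.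
  apply: cvgM => //.
  have s0 : 0 < a' - a by rewrite subr_gt0.
  rewrite -(cvg_shiftS (fun n => n%:R^-1 `^ (a' - a))) /=.
  have := powR_cvg0 s0 => /cvg_at_rightP; apply; split.
    by move=> n; rewrite invr_gt0 ltr0n.
  exact: cvg_harmonic.
rewrite mulr0 in h2.
apply: cvg_trans h2; apply: near_eq_cvg; near=> n.
have n0 : n%:R != 0 :> R by rewrite pnatr_eq0 -lt0n; near: n; exact: nbhs_infty_gt.
rewrite -mulrA -powR_inv1 // -powRrM -powRD; last by rewrite n0 implybT.
by congr (_ * _ `^ _); ring.
Unshelve. all: by end_near. Qed.

Lemma Gamma_rf_half n : Gamma (n.*2.+1%:R / 2) = Num.sqrt pi * rf 2^-1 n * n`!%:R :> R.
Proof.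
elim: n => [|n IH]; first by rewrite mul1r Gamma_half rf0 !mulr1.
have -> : n.+1.*2.+1%:R / 2 = n.*2.+1%:R / 2 + 1 :> R.
  by rewrite doubleS -[n.*2.+3]addn2 natrD; field.
rewrite Gamma_halfS IH factS natrM.
have -> : n.*2.+1%:R / 2 = 2^-1 + n%:R :> R.
  by rewrite -natr1 -mul2n natrM; field.
have n0 : n.+1%:R != 0 :> R by rewrite pnatr_eq0.
by rewrite rfS; field.
Qed.

Lemma Gamma_fact n : Gamma (n.+1.*2%:R / 2) = n`!%:R :> R.
Proof.
elim: n => [|n IH]; first by rewrite divff // Gamma1.
have -> : n.+2.*2%:R / 2 = n.*2.+2%:R / 2 + 1 :> R.
  by rewrite !doubleS -[n.*2.+4]addn2 natrD; field.
rewrite Gamma_halfS -doubleS IH factS natrM.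
by rewrite -mul2n natrM; field.
Qed.

(** [Gamma_half_convex] at the optimal [c], for which the functional equation makes the two terms on
    its right equal. *)
Lemma Gamma_half_ratio m :
  Gamma (m.+2%:R / 2) <= Num.sqrt (m.+1%:R / 2) * Gamma (m.+1%:R / 2) :> R.
Proof.
set c := Num.sqrt _.
have c0 : 0 < c by rewrite sqrtr_gt0 divr_gt0 ?ltr0n.
have := Gamma_half_convex m c0.
have -> : m.+3%:R / 2 = m.+1%:R / 2 + 1 :> R.
  by rewrite -[m.+3]addn2 natrD; field.
rewrite Gamma_halfS; have -> : c^-1 * (m.+1%:R / 2 * Gamma (m.+1%:R / 2)) = c * Gamma (m.+1%:R / 2).
  have e : m.+1%:R / 2 = c ^+ 2 by rewrite sqr_sqrtr // divr_ge0.
  by rewrite {1}e; field; rewrite gt_eqF.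
by lra.
Qed.

(** Wallis' product: [Gamma_half_ratio] at odd and at even arguments bounds the ratio of
    [Gamma (n + 1/2)] to [n!] from above and from below. *)
Lemma wallis : rf_lim 2^-1 (Num.sqrt pi)^-1.
Proof.
have sp0 : 0 < Num.sqrt pi :> R by rewrite sqrtr_gt0 pi_gt0.
have E (n : nat) : n%:R `^ (1 - 2^-1) = Num.sqrt n%:R :> R.
  by rewrite -powR12_sqrt //; congr (_ `^ _); field.
set sp := Num.sqrt pi in sp0 *.
have ub (n : nat) : rf 2^-1 n.+1 * Num.sqrt n.+1%:R <= sp^-1 :> R.
  have := Gamma_half_ratio n.*2.+1.
  rewrite -[n.*2.+3]/(n.+1.*2.+1) Gamma_rf_half -[n.*2.+2]/(n.+1.*2) Gamma_fact.
  have -> : n.+1.*2%:R / 2 = n.+1%:R :> R by rewrite -mul2n natrM; field.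
  have := sqr_sqrtr (ler0n R n.+1).
  have : 0 < Num.sqrt n.+1%:R :> R by rewrite sqrtr_gt0 ltr0n.
  have f0 : 0 < n`!%:R :> R by rewrite ltr0n fact_gt0.
  rewrite -/sp factS natrM; set q := Num.sqrt n.+1%:R => q0 <-.
  rewrite [sp * _ * _]mulrA ler_pM2r // => h.
  rewrite -[sp^-1]mul1r ler_pdivlMr // -(ler_pM2r q0) mul1r.
  apply: le_trans h; rewrite le_eqVlt; apply/orP; left; apply/eqP.
  by ring.
have lb (n : nat) : 1 <= Num.sqrt (n%:R + 2^-1) * (sp * rf 2^-1 n).
  have := Gamma_half_ratio n.*2.
  rewrite -[_.*2.+2]doubleS Gamma_rf_half Gamma_fact.
  have -> : n.*2.+1%:R / 2 = n%:R + 2^-1 :> R by rewrite -natr1 -mul2n natrM; field.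
  have f0 : 0 < n`!%:R :> R by rewrite ltr0n fact_gt0.
  by rewrite -/sp !mulrA -{1}[n`!%:R]mul1r ler_pM2r.
(* The natural lower bound has the factor [sqrt (n / (n + 3/2))]; weakening it to [n / (n + 3/2)]
   avoids the limit of a square root. *)
apply: (@squeeze_cvgr _ _ _ _ (fun n : nat => ((3 / 2 + n%:R) / n%:R)^-1 / sp) (cst sp^-1)).
- near=> n; rewrite E; apply/andP; split; last first.
    apply: le_trans (ub n); apply: ler_wpM2l.
      by apply: prodr_ge0 => i _; rewrite divr_ge0 // addr_ge0 // invr_ge0.
    by rewrite ler_wsqrtr // ler_nat.
  have n0 : 0 < n%:R :> R by rewrite ltr0n; near: n; exact: nbhs_infty_gt.
  have := lb n.+1; rewrite -natr1.
  have -> : n%:R + 1 + 2^-1 = 3 / 2 + n%:R :> R by field.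
  have t1 : 0 <= 3 / 2 + n%:R :> R by lra.
  have := sqr_sqrtr t1; have : 0 < Num.sqrt (3 / 2 + n%:R) :> R by rewrite sqrtr_gt0; lra.
  have : Num.sqrt n%:R <= Num.sqrt (3 / 2 + n%:R) :> R by rewrite ler_wsqrtr //; lra.
  have := sqr_sqrtr (ltW n0); have : 0 < Num.sqrt n%:R :> R by rewrite sqrtr_gt0.
  move: (Num.sqrt (3 / 2 + n%:R)) => t; move: (Num.sqrt n%:R) => p.
  move=> p0 <- pt t0 <-; move: (rf _ _) => r h.
  have -> : (t ^+ 2 / p ^+ 2)^-1 / sp = (p ^+ 2 / t) / (t * sp).
    by field; rewrite !gt_eqF.
  rewrite ler_pdivrMr ?mulr_gt0 // ler_pdivrMr //.
  have h' : p <= r * p * (t * sp).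
    by rewrite -[leLHS]mul1r (_ : r * p * _ = t * (sp * r) * p); [rewrite ler_pM2r|ring].
  by rewrite expr2; apply: ler_pM => //; exact: ltW.
- have h := cvgV (oner_neq0 R) (cvg_addn_div (3 / 2)).
  by have := cvgM (h _) (cvg_cst sp^-1); rewrite invr1 mul1r; apply.
- exact: cvg_cst.
Unshelve. all: by end_near. Qed.

Lemma rf_lim_Gamma m : rf_lim (m.+1%:R / 2) (Gamma (m.+1%:R / 2))^-1.
Proof.
elim/ltn_ind: m => -[|[|m]] IH.
- by rewrite mul1r Gamma_half; exact: wallis.
- rewrite divff // Gamma1 invr1 /rf_lim.
  have -> : (fun n => rf 1 n.+1 * n%:R `^ (1 - 1)) = cst (1 : R).
    apply/funext => n; rewrite subrr powRr0 mulr1 /rf big1 // => i _.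
    by rewrite nat1r divff // pnatr_eq0.
  exact: cvg_cst.
- have -> : m.+3%:R / 2 = m.+1%:R / 2 + 1 :> R.
    by rewrite -[m.+3]addn2 natrD; field.
  rewrite Gamma_halfS invfM [X in rf_lim _ X]mulrC; apply: rf_limS; last exact: IH.
  by rewrite mulf_neq0 // pnatr_eq0.
Qed.

Lemma rf_lim_neghalf : rf_lim (- 2^-1) (Gamma (- 2^-1))^-1.
Proof.
have -> : (Gamma (- 2^-1 : R))^-1 = (Num.sqrt pi)^-1 * - 2^-1.
  rewrite Gamma_neghalf; field.
  by rewrite gt_eqF // sqrtr_gt0 pi_gt0.
apply: rf_lim_pred; have -> : - 2^-1 + 1 = 2^-1 :> R by field.
exact: wallis.
Qed.

(** For the lower-order powers of [s] the value of the limit is irrelevant: its existence lets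
    [rf_lim_lower] send their contribution to 0. Nonpositive [z] is reached from positive ones by
    [rf_lim_pred]. *)
Lemma rf_lim_half_ex (z : int) : exists l, rf_lim (z%:~R / 2) l.
Proof.
have [m zm] : exists m : nat, (- m%:Z <= z).
  by exists `|z|%N; lia.
elim: m z zm => [|m IH] z zm.
  case: z zm => [[|z]|z] zm; last by lia.
    exists ((Gamma (2%:R / 2))^-1 * 0); rewrite mul0r.
    by apply: rf_lim_pred; rewrite add0r -[X in rf_lim X](@divff _ 2) //; exact: (@rf_lim_Gamma 1).
  by exists (Gamma (z.+1%:R / 2))^-1; exact: rf_lim_Gamma.
have [|l hl] := IH (z + 2); first by lia.
exists (l * (z%:~R / 2)); apply: rf_lim_pred.
have -> // : z%:~R / 2 + 1 = (z + 2)%:~R / 2 :> R.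
by rewrite intrD; field.
Qed.

End RisingCoefficients.

(** * Cauchy products and Laurent polynomials in [s] *)

Section Convolution.
Context {R : realType}.
Implicit Types (f g : nat -> R) (M c e : R).

Definition conv f g (n : nat) : R := \sum_(i < n.+1) f i * g (n - i)%N.

Lemma eq_conv f f' g g' : f =1 f' -> g =1 g' -> conv f g =1 conv f' g'.
Proof. by move=> ff gg n; apply: eq_bigr => i _; rewrite ff gg. Qed.

Lemma convC f g : conv f g =1 conv g f.
Proof.
move=> n; rewrite /conv (reindex_inj rev_ord_inj) /=; apply: eq_bigr => i _.
by rewrite subSS subKn 1?mulrC // -ltnS.
Qed.

Lemma convDl f g h : conv (fun n => f n + g n) h =1 (fun n => conv f h n + conv g h n).
Proof. by move=> n; rewrite -big_split /=; apply: eq_bigr => i _; rewrite mulrDl. Qed.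

Lemma convZl c f h : conv (fun n => c * f n) h =1 (fun n => c * conv f h n).
Proof. by move=> n; rewrite /conv big_distrr /=; apply: eq_bigr => i _; rewrite mulrA. Qed.

Lemma convDr f g h : conv h (fun n => f n + g n) =1 (fun n => conv h f n + conv h g n).
Proof. by move=> n; rewrite -big_split /=; apply: eq_bigr => i _; rewrite mulrDr. Qed.

Lemma convZr c f h : conv h (fun n => c * f n) =1 (fun n => c * conv h f n).
Proof. by move=> n; rewrite /conv big_distrr /=; apply: eq_bigr => i _; rewrite mulrCA. Qed.

(** Cancellation of a power series with nonzero constant term; division by [s] rests on it. *)
Lemma conv_inj f g h : h 0%N != 0 -> conv h f =1 conv h g -> f =1 g.
Proof.
move=> h0 e n; elim/ltn_ind: n => n IH.
have := e n; rewrite /conv !big_ord_recl /= subn0.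
under [X in _ + X = _]eq_bigr => i _.
  rewrite IH; last by have := ltn_ord i; rewrite /bump /=; lia.
  over.
by move=> /addIr /(mulfI h0).
Qed.

(** Vandermonde's identity, [(1 - x)^(-a) (1 - x)^(-b)]. The factor [n + 1] is split as
    [i + (n + 1 - i)], a Leibniz rule; [rfSn] on each part then yields
    [(a + i) + (b + n - i) = a + b + n]. *)
Lemma conv_rf (a b : R) : conv (rf a) (rf b) =1 rf (a + b).
Proof.
elim=> [|n IH]; first by rewrite /conv big_ord1 !rf0 mulr1.
have n0 : n.+1%:R != 0 :> R by rewrite pnatr_eq0.
apply: (mulfI n0); rewrite rfSn -IH /conv.
rewrite big_distrr /= [RHS]big_distrr /=.
have -> : \sum_(i < n.+2) n.+1%:R * (rf a i * rf b (n.+1 - i)) =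
  \sum_(i < n.+2) i%:R * rf a i * rf b (n.+1 - i) +
  \sum_(i < n.+2) rf a i * ((n.+1 - i)%:R * rf b (n.+1 - i)).
  rewrite -big_split /=; apply: eq_bigr => i _.
  by rewrite natrB -1?ltnS //; ring.
rewrite big_ord_recl /= !mul0r add0r [X in _ + X]big_ord_recr /= subnn mul0r mulr0 addr0.
rewrite -big_split /=; apply: eq_bigr => i _.
have le_in : (i <= n)%N by rewrite -ltnS.
rewrite /bump /= add1n subSS subSn // !rfSn natrB //; ring.
Qed.

(* [bs M n] is the coefficient of [x ^+ n] in [s ^- M], [s = sqrt (1 - 4 x)]. *)
Definition bs M (n : nat) : R := 4 ^+ n * rf (M / 2) n.

Lemma bsE M M' n : M = M' -> bs M n = bs M' n.
Proof. by move=> ->. Qed.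

Lemma conv_bs M M' : conv (bs M) (bs M') =1 bs (M + M').
Proof.
move=> n; rewrite /bs mulrDl -conv_rf /conv big_distrr /=; apply: eq_bigr => i _.
rewrite mulrACA -exprD subnKC //; by rewrite -ltnS.
Qed.

(** Here [x d/dx] turns [s^-M] into [2 M x s^(-M-2)], and [4 x = 1 - s^2]. *)
Lemma bs_deriv M n : n%:R * bs M n = M / 2 * bs (M + 2) n - M / 2 * bs M n.
Proof.
rewrite /bs; have := rf_shift (M / 2) n.
have -> : (M + 2) / 2 = M / 2 + 1 by field.
move=> e; transitivity (4 ^+ n * (rf (M / 2) n * (M / 2 + n%:R) - M / 2 * rf (M / 2) n)).
  by ring.
by rewrite -e; ring.
Qed.

Lemma bs0 n : bs 0 n = (n == 0%N)%:R.
Proof.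
rewrite /bs mul0r; case: n => [|n]; first by rewrite rf0 mulr1.
by rewrite /rf big_ord_recl /= addr0 !mul0r mulr0.
Qed.

Lemma bsN1_0 : bs (-1) 0 != 0.
Proof. by rewrite /bs rf0 expr0 mulr1 oner_neq0. Qed.

(* The Laurent polynomials in [s] of order at least [- M]. *)
Definition span M f :=
  exists s : seq (R * nat), forall n, f n = \sum_(x <- s) x.1 * bs (M - x.2%:R) n.

Lemma eq_span M f g : f =1 g -> span M f -> span M g.
Proof. by move=> fg [s fs]; exists s => n; rewrite -fg. Qed.

Lemma span_bs M k c : span M (fun n => c * bs (M - k%:R) n).
Proof. by exists [:: (c, k)] => n; rewrite big_seq1. Qed.

Lemma span0 M : span M (fun=> 0).
Proof. by exists [::] => n; rewrite big_nil. Qed.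

Lemma spanD M f g : span M f -> span M g -> span M (fun n => f n + g n).
Proof. by move=> [s fs] [t gt]; exists (s ++ t) => n; rewrite big_cat fs gt. Qed.

Lemma spanZ M c f : span M f -> span M (fun n => c * f n).
Proof.
move=> [s fs]; exists [seq (c * x.1, x.2) | x <- s] => n.
by rewrite fs big_map big_distrr /=; apply: eq_bigr => x _; rewrite mulrA.
Qed.

Lemma span_sum M (I : Type) (r : seq I) (P : pred I) (F : I -> nat -> R) :
  (forall i, P i -> span M (F i)) -> span M (fun n => \sum_(i <- r | P i) F i n).
Proof.
move=> H; elim: r => [|i r IH].
  by apply: eq_span (span0 M) => n; rewrite big_nil.
case Pi: (P i); last by apply: eq_span IH => n; rewrite big_cons Pi.
by apply: eq_span (spanD (H i Pi) IH) => n; rewrite big_cons Pi.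
Qed.

Lemma span_up M M' k f : M' = M + k%:R -> span M f -> span M' f.
Proof.
move=> -> [s fs]; exists [seq (x.1, (k + x.2)%N) | x <- s] => n.
rewrite fs big_map; apply: eq_bigr => x _ /=; congr (_ * _).
by apply: bsE; rewrite natrD; ring.
Qed.

Lemma span_conv M M' f g : span M f -> span M' g -> span (M + M') (conv f g).
Proof.
move=> [s fs] [t gt].
exists [seq (x.1 * y.1, (x.2 + y.2)%N) | x <- s, y <- t] => n.
rewrite big_allpairs_dep /= (eq_conv fs gt).
have -> : \sum_(x <- s) \sum_(y <- t) x.1 * y.1 * bs (M + M' - (x.2 + y.2)%:R) n =
  \sum_(x <- s) \sum_(y <- t) x.1 * y.1 * conv (bs (M - x.2%:R)) (bs (M' - y.2%:R)) n.
  apply: eq_bigr => x _; apply: eq_bigr => y _; rewrite conv_bs; congr (_ * _).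
  by apply: bsE; rewrite natrD; ring.
under [RHS]eq_bigr => x _ do (under eq_bigr => y _ do rewrite big_distrr /=; rewrite exchange_big /=).
rewrite exchange_big /=; apply: eq_bigr => i _.
rewrite big_distrl /=; apply: eq_bigr => x _.
by rewrite big_distrr /=; apply: eq_bigr => y _; ring.
Qed.

Lemma span_deriv M f : span M f -> span (M + 2) (fun n => n%:R * f n).
Proof.
move=> [s fs].
have h : span (M + 2) (fun n => \sum_(x <- s) x.1 * (n%:R * bs (M - x.2%:R) n)).
  apply: span_sum => x _; apply: spanZ.
  have h1 := span_bs (M + 2) x.2 ((M - x.2%:R) / 2).
  have h2 := span_bs (M + 2) x.2.+2 (- ((M - x.2%:R) / 2)).
  apply: eq_span (spanD h1 h2) => n; rewrite bs_deriv mulNr.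
  by congr (_ * _ - _ * _); apply: bsE; rewrite -?[x.2.+2]addn2 ?natrD; ring.
apply: eq_span h => n; rewrite fs big_distrr /=; apply: eq_bigr => x _; ring.
Qed.

Lemma span_solve M f : span M (conv (bs (-1)) f) -> span (M + 1) f.
Proof.
move=> [s fs]; exists s.
apply: (conv_inj bsN1_0) => n; rewrite fs.
rewrite /conv; under [RHS]eq_bigr => i _ do rewrite big_distrr /=.
rewrite exchange_big /=; apply: eq_bigr => x _.
have -> : bs (M - x.2%:R) n = conv (bs (-1)) (bs (M + 1 - x.2%:R)) n.
  by rewrite conv_bs; apply: bsE; ring.
by rewrite /conv big_distrr /=; apply: eq_bigr => i _; ring.
Qed.

(* [f = e + c s ^- M + (lower order in s^-1)]. *)
Definition ord f e M c := span (M - 1) (fun n => f n - e * bs 0 n - c * bs M n).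

Lemma eq_ord f g e M c : f =1 g -> ord f e M c -> ord g e M c.
Proof. by move=> fg; apply: eq_span => n; rewrite fg. Qed.

Lemma ordD f g e e' M c c' :
  ord f e M c -> ord g e' M c' -> ord (fun n => f n + g n) (e + e') M (c + c').
Proof. by move=> h h'; apply: eq_span (spanD h h') => n /=; ring. Qed.

Lemma ordZ f a e M c : ord f e M c -> ord (fun n => a * f n) (a * e) M (a * c).
Proof. by move=> h; apply: eq_span (spanZ a h) => n /=; ring. Qed.

Lemma ord_sum M (I : Type) (r : seq I) (P : pred I) (F : I -> nat -> R) (c : I -> R) :
  (forall i, P i -> ord (F i) 0 M (c i)) ->
  ord (fun n => \sum_(i <- r | P i) F i n) 0 M (\sum_(i <- r | P i) c i).
Proof.
move=> H; apply: eq_span (span_sum r H) => n /=.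
rewrite mul0r subr0 big_distrl /= -sumrB; apply: eq_bigr => i _.
by rewrite subr0.
Qed.

Lemma ord_up f e M M' k c : M' = M + k.+1%:R -> ord f e M c -> ord f e M' 0.
Proof.
move=> eM h; have h1 : span (M' - 1) (fun n => f n - e * bs 0 n - c * bs M n).
  by apply: (span_up (k := k.+1)) h; rewrite eM addrAC.
have h2 := span_bs (M' - 1) k c.
apply: eq_span (spanD h1 h2) => n /=.
rewrite (@bsE (M' - 1 - k%:R) M); first ring.
by rewrite eM -natr1; ring.
Qed.

(** The constant is [s^0], which is one of the lower-order powers as soon as [M] is a positive
    integer. *)
Lemma ord_const f M k e c : M = k.+1%:R -> ord f e M c -> ord f 0 M c.
Proof.
move=> e' h; have h2 := span_bs (M - 1) k e.
apply: eq_span (spanD h h2) => n /=.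
rewrite (@bsE (M - 1 - k%:R) 0); first ring.
by rewrite e' -natr1; ring.
Qed.

(** [x d/dx] kills the constant, and the second term of [bs_deriv] is two orders below the first. *)
Lemma ord_deriv f e M c :
  ord f e M c -> ord (fun n => n%:R * f n) 0 (M + 2) (M / 2 * c).
Proof.
move=> /span_deriv; rewrite addrAC => h.
have h3 := span_bs (M + 2 - 1) 1 (- (c * (M / 2))).
apply: eq_span (spanD h h3) => n /=.
rewrite (@bsE (M + 2 - 1 - 1%:R) M); last by ring.
have e0 : n%:R * bs 0 n = 0 by rewrite bs0; case: n => [|n]; rewrite ?mul0r ?mulr0.
transitivity (n%:R * f n - e * (n%:R * bs 0 n) - c * (n%:R * bs M n) - c * (M / 2) * bs M n).
  ring.
by rewrite e0 bs_deriv; ring.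
Qed.

(** The constant of [g] reproduces [e f], of order [M]. For [M' = -1] this exceeds [M + M'], so it
    is subtracted rather than absorbed. *)
Lemma ord_conv f g e M M' c c' :
  ord f 0 M c -> ord g e M' c' ->
  ord (fun n => conv f g n - e * f n) 0 (M + M') (c * c').
Proof.
move=> hf hg.
have [f1 ef {}hf] : exists2 f1, f =1 (fun n => f1 n + c * bs (M - 0%:R) n) & span (M - 1) f1.
  by eexists; last exact: hf; move=> n; rewrite subr0; ring.
have [g1 eg {}hg] : exists2 g1, g =1 (fun n => g1 n + c' * bs (M' - 0%:R) n + e * bs 0 n)
    & span (M' - 1) g1.
  by eexists; last exact: hg; move=> n; rewrite subr0; ring.
have s1 := span_conv (span_bs M 0 c) hg.
have s2 := span_conv hf (span_bs M' 0 c').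
have s3 := span_conv hf hg.
have s : span (M + M' - 1) (fun n => conv (fun n => c * bs (M - 0%:R) n) g1 n
    + conv f1 (fun n => c' * bs (M' - 0%:R) n) n + conv f1 g1 n).
  apply: spanD; [apply: spanD|].
  - by apply: (span_up (k := 0)) s1; ring.
  - by apply: (span_up (k := 0)) s2; ring.
  - by apply: (span_up (k := 1)) s3; ring.
apply: eq_span s => n.
have ebs0 : conv f (bs 0) n = f n.
  rewrite convC /conv big_ord_recl /= bs0 mul1r subn0 big1 ?addr0 // => i _.
  by rewrite bs0 mul0r.
have e1 : conv f g n = conv f g1 n + conv f (fun n => c' * bs (M' - 0%:R) n) n + e * f n.
  by rewrite (eq_conv (frefl f) eg) convDr convZr ebs0 convDr.
have e2 h : conv f h n = conv f1 h n + conv (fun n => c * bs (M - 0%:R) n) h n.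
  by rewrite (eq_conv ef (frefl _)) convDl.
have e3 : conv (fun n => c * bs (M - 0%:R) n) (fun n => c' * bs (M' - 0%:R) n) n
    = c * (c' * bs (M - 0%:R + (M' - 0%:R)) n).
  by rewrite convZl convZr conv_bs.
rewrite e1 !e2 e3.
by rewrite (@bsE (M - _ + _) (M + M')); ring.
Qed.

Lemma ord_solve f M c : ord (conv (bs (-1)) f) 0 M c -> ord f 0 (M + 1) c.
Proof.
rewrite /ord => h.
have h' : span (M - 1) (conv (bs (-1)) (fun n => f n - 0 * bs 0 n - c * bs (M + 1) n)).
  apply: eq_span h => n.
  have ef : (fun k => f k - 0 * bs 0 k - c * bs (M + 1) k) =1
      (fun k => f k + (- c) * bs (M + 1) k) by move=> k; ring.
  rewrite (eq_conv (frefl _) ef) convDr convZr conv_bs (@bsE (-1 + (M + 1)) M); ring.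
by have := span_solve h'; rewrite addrAC.
Qed.

End Convolution.

(** * Generating functions over binary trees *)

Section TreeSeries.
Context {R : realType}.
Implicit Types (phi u v : bintree -> R).

Definition trees (n : nat) : seq bintree := [seq t <- bintrees_height n | nodes t == n].

Lemma perm_trees h n : (n <= h)%N -> perm_eq [seq t <- bintrees_height h | nodes t == n] (trees n).
Proof.
move=> nh; apply: uniq_perm; rewrite ?filter_uniq ?bintrees_height_uniq // => t.
rewrite !mem_filter; case: eqP => //= tn; rewrite !mem_bintrees_height ?tn //.
Qed.

Lemma sum_btree (V : nmodType) n (F : bintree -> V) :
  \sum_(t : btree n) F (val t) = \sum_(t <- trees n) F t.
Proof.
rewrite -(big_map val xpredT) /=; apply: perm_big; apply: uniq_perm.
- by rewrite (map_inj_uniq val_inj); exact: index_enum_uniq.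
- by rewrite filter_uniq ?bintrees_height_uniq.
- move=> t; rewrite mem_filter; apply/mapP/andP.
    move=> [x _ ->]; split; first exact: (valP x).
    by rewrite mem_bintrees_height // (eqP (valP x)).
  by move=> [tn _]; exists (exist _ t tn) => //; exact: (@mem_index_enum (btree n)).
Qed.

Lemma sum_trees_node n phi :
  \sum_(t <- trees n.+1) phi t =
  \sum_(i < n.+1) \sum_(l <- trees i) \sum_(r <- trees (n - i)) phi (Node l r).
Proof.
rewrite big_filter /= big_cons /= big_mkcond big_allpairs_dep /=.
transitivity (\sum_(l <- bintrees_height n) \sum_(i < n.+1)
   if nodes l == i then \sum_(r <- bintrees_height n | nodes r == (n - i)%N) phi (Node l r) else 0).
  apply: eq_bigr => l _; rewrite -big_mkcond /= -[RHS]big_mkcond /=.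
  have [ln|ln] := leqP (nodes l) n.
    rewrite (big_pred1 (Ordinal (ln : nodes l < n.+1)%N)) /=; last first.
      by move=> i; rewrite inE -[RHS]val_eqE /= eq_sym.
    apply: eq_bigl => r; rewrite eqSS; lia.
  rewrite big_pred0; last by move=> r; rewrite eqSS; apply/negbTE; lia.
  by rewrite big_pred0 // => i; have := ltn_ord i; lia.
rewrite exchange_big /=; apply: eq_bigr => i _.
rewrite -big_mkcond -big_filter.
rewrite (perm_big _ (perm_trees (_ : i <= n)%N)) /=; last by rewrite -ltnS.
apply: eq_bigr => l _; rewrite -big_filter.
by rewrite (perm_big _ (perm_trees (leq_subr _ _))).
Qed.

(* The exponent counts leaves, which makes [gf] multiplicative over [Node]. *)
Definition gf phi (n : nat) : R := if n is m.+1 then \sum_(t <- trees m) phi t else 0.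

Lemma eq_gf phi psi : phi =1 psi -> gf phi =1 gf psi.
Proof. by move=> e [|n] //=; apply: eq_bigr. Qed.

Lemma gf_sum (I : Type) (r : seq I) (P : pred I) (F : I -> bintree -> R) n :
  gf (fun t => \sum_(i <- r | P i) F i t) n = \sum_(i <- r | P i) gf (F i) n.
Proof. by case: n => [|n] /=; [rewrite big1 | rewrite exchange_big]. Qed.

Lemma gfZ c phi n : gf (fun t => c * phi t) n = c * gf phi n.
Proof. by case: n => [|n] /=; [rewrite mulr0 | rewrite big_distrr]. Qed.

Lemma gfD phi psi n : gf (fun t => phi t + psi t) n = gf phi n + gf psi n.
Proof. by case: n => [|n] /=; [rewrite addr0 | rewrite big_split]. Qed.

Definition sz (t : bintree) : R := (nodes t)%:R.

(** A tree has one leaf more than it has vertices, so the size acts as [x d/dx - 1]. *)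
Lemma gf_sz phi n : gf (fun t => sz t * phi t) n = n%:R * gf phi n - gf phi n.
Proof.
case: n => [|n] /=; first by rewrite mul0r subr0.
rewrite big_distrr /= -sumrB; apply: eq_big_seq => t.
rewrite mem_filter => /andP[/eqP tn _]; rewrite /sz tn -natr1; ring.
Qed.

Lemma trees0 : trees 0 = [:: Defs.Empty]. Proof. by []. Qed.

Lemma gf_prod u v n :
  conv (gf u) (gf v) n = gf (fun t => if t is Node l r then u l * v r else 0) n.
Proof.
case: n => [|[|n]] /=.
- by rewrite /conv big_ord1 /= mul0r.
- by rewrite /conv !big_ord_recl big_ord0 /= !(mul0r, mulr0, addr0) trees0 big_seq1.
rewrite sum_trees_node /conv big_ord_recl /= mul0r add0r big_ord_recr /=.
rewrite /bump /= add1n subnn /= mulr0 addr0; apply: eq_bigr => i _.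
rewrite /bump /= add1n subSS subSn /=; last by rewrite -ltnS.
by rewrite big_distrl /=; apply: eq_bigr => l _; rewrite big_distrr.
Qed.

Lemma gf_node (I : Type) (s : seq I) (P : pred I) (u v : I -> bintree -> R) phi n :
  phi Defs.Empty = 0 ->
  (forall l r, phi (Node l r) = \sum_(i <- s | P i) u i l * v i r) ->
  gf phi n = \sum_(i <- s | P i) conv (gf (u i)) (gf (v i)) n.
Proof.
move=> p0 pN; under [RHS]eq_bigr do rewrite gf_prod.
rewrite -gf_sum; apply: eq_gf => -[|l r]; last exact: pN.
by rewrite p0 big1.
Qed.

Lemma gf1_rec n : gf (fun=> 1) n = (n == 1%N)%:R + conv (gf (fun=> 1)) (gf (fun=> 1)) n.
Proof.
rewrite gf_prod; case: n => [|[|n]] /=; rewrite ?add0r //.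
  by rewrite trees0 !big_seq1 addr0.
by rewrite !sum_trees_node; do 3! (apply: eq_bigr => ? _); rewrite mulr1.
Qed.

Lemma bsN2 n : bs (-2) n = bs 0 n - 4 * (n == 1%N)%:R :> R.
Proof.
have -> : -2 = 0 + 2 * (-1) :> R by ring.
rewrite bs0 /bs; have -> : (0 + 2 * -1) / 2 = -1 :> R by field.
case: n => [|[|n]]; rewrite /rf ?big_ord0 ?big_ord1 /=; [by ring|by field|].
by rewrite !big_ord_recl /= addNr mul0r !(mulr0, mul0r) subrr.
Qed.

(** [h = (1 - s) / 2] solves the Catalan equation [h = x + h^2] with zero constant term, and this
    determines the coefficients one after the other. *)
Lemma gf1 n : gf (fun=> 1) n = 2^-1 * bs 0 n - 2^-1 * bs (-1) n.
Proof.
pose h n : R := 2^-1 * bs 0 n + (- 2^-1) * bs (-1) n.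
suff : gf (fun=> 1) n = h n by move=> ->; rewrite /h mulNr.
have h00 : h 0%N = 0 by rewrite /h /bs !rf0; ring.
have hrec m : h m = (m == 1%N)%:R + conv h h m.
  rewrite /h convDl !convDr !convZl !convZr !conv_bs addr0 add0r.
  have -> : -1 - 1 = -2 :> R by ring.
  by rewrite addr0 bsN2; field.
elim/ltn_ind: n => n IH; rewrite gf1_rec hrec; congr (_ + _).
case: n IH => [|n] IH; first by rewrite /conv !big_ord1 h00 /= mul0r.
rewrite /conv big_ord_recl [in RHS]big_ord_recl h00 [gf _ ord0]/= !mul0r.
congr (_ + _); apply: eq_bigr => i _.
have := ltn_ord i; rewrite !lift0 subSS => lin.
have [->|ni] := eqVneq (i : nat) n; first by rewrite subnn h00 /= !mulr0.
by rewrite !IH //; move: ni lin; lia.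
Qed.

Lemma ord_gf1 : ord (gf (fun=> 1)) 2^-1 (-1) (- 2^-1).
Proof.
apply: eq_span (span0 _) => n; rewrite gf1; ring.
Qed.

Lemma eq_ord_gf phi psi e (M c : R) : phi =1 psi -> ord (gf phi) e M c -> ord (gf psi) e M c.
Proof. by move=> /eq_gf; exact: eq_ord. Qed.

Lemma ord_sz phi e M c k : M + 2 = k.+1%:R :> R ->
  ord (gf phi) e M c -> ord (gf (fun t => sz t * phi t)) 0 (M + 2) (M / 2 * c).
Proof.
move=> Mk h; have h1 := ord_deriv h.
have h2 := ord_const Mk (ord_up (k := 1) (erefl (M + 2)) h).
have := ordD h1 (ordZ (-1) h2); rewrite !mulr0 !addr0.
by apply: eq_ord => n; rewrite gf_sz; ring.
Qed.

End TreeSeries.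

(** * Divided powers, and solving recursions by weight *)

Section DividedPowers.
Context {F : numFieldType}.
Implicit Types x y : F.

Definition dp x (k : nat) : F := x ^+ k / k`!%:R.

Lemma dp0 x : dp x 0 = 1. Proof. by rewrite /dp expr0 divr1. Qed.

Lemma factnz k : k`!%:R != 0 :> F.
Proof. by rewrite pnatr_eq0 -lt0n fact_gt0. Qed.

Lemma dpMC x i j : dp x i * dp x j = 'C(i + j, i)%:R * dp x (i + j).
Proof.
have f1 := factnz i; have f2 := factnz j; have f3 := factnz (i + j).
have := bin_fact (leq_addr j i); rewrite addKn => /(congr1 (fun n => n%:R : F)).
rewrite !natrM => e; rewrite /dp exprD -e.
have b0 : 'C(i + j, i)%:R != 0 :> F by rewrite pnatr_eq0 -lt0n bin_gt0 leq_addr.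
by field; rewrite f1 f2 b0.
Qed.

Lemma dpM x y k : dp (x * y) k = dp x k * y ^+ k.
Proof. by rewrite /dp exprMn; ring. Qed.

Lemma dpN x k : dp (- x) k = (-1) ^+ k * dp x k.
Proof. by rewrite /dp [(- x) ^+ k]exprNn; ring. Qed.

Lemma dpD x y k : dp (x + y) k = \sum_(0 <= i < k.+1) dp x i * dp y (k - i).
Proof.
rewrite /dp addrC exprDn big_mkord big_distrl /=; apply: eq_bigr => i _.
have ik : (i <= k)%N by rewrite -ltnS.
have := bin_fact ik => /(congr1 (fun n => n%:R : F)); rewrite !natrM => e.
have b0 : 'C(k, i)%:R != 0 :> F by rewrite pnatr_eq0 -lt0n bin_gt0.
have f1 := factnz i; have f2 := factnz (k - i).
by rewrite -e -mulr_natr; field; rewrite f1 f2 b0.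
Qed.

Lemma dpD3 x y z k : dp (x + y + z) k =
  \sum_(0 <= i < k.+1) \sum_(0 <= q < k.+1 | (i + q <= k)%N)
     dp x i * dp y q * dp z (k - i - q).
Proof.
rewrite -addrA dpD; apply: eq_big_nat => i /andP[_ ik].
rewrite dpD big_distrr /= (@big_nat_widen _ _ _ 0 (k - i).+1 k.+1); last by lia.
by apply: eq_big => [q|q _]; [rewrite /=; lia | rewrite mulrA].
Qed.

End DividedPowers.

(** The iterates of [Phi] from a constant function are stationary at [(k, l)] after [w k l + 1]
    steps, because each step settles one more weight. *)
Lemma weight_rec (V : Type) (v0 : V) (w : nat -> nat -> nat)
    (Phi : (nat -> nat -> V) -> nat -> nat -> V) :
  (forall f g k l, (forall a b, (w a b < w k l)%N -> f a b = g a b) -> Phi f k l = Phi g k l) ->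
  exists A, forall k l, A k l = Phi A k l.
Proof.
move=> loc; pose it n := iter n Phi (fun _ _ => v0).
have st n m k l : (w k l < n)%N -> (w k l < m)%N -> it n k l = it m k l.
  elim: n m k l => // n IH [|m] k l // wn wm.
  by apply: loc => a b ab; apply: IH; apply: leq_trans ab _.
exists (fun k l => it (w k l).+1 k l) => k l /=.
apply: loc => a b ab; rewrite -[RHS]/(it (w a b).+1 a b); exact: st.
Qed.

(** * The recursion for the leading coefficients *)

Section GenericRecursion.
Context {R : realType}.
(* [X (Node L R) = X L + X R + H L * K R] with [H] of weight [wH], and [K] equal
   to 1 if [eps] and to the size otherwise; [X] has weight [d], [Y] has weight
   3 and the size has weight 2. *)
Variables (XX YY H : bintree -> R) (eps : bool) (wH : nat) (ys : nat)
  (mu : nat -> nat -> nat -> nat -> R).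
Let K (t : bintree) : R := if eps then 1 else sz t.
Let d := (wH + (if eps then 1 else 2))%N.

Definition mon a b t : R := dp (XX t) a * dp (YY t) b.
(** The left factor in the expansion over [Node]: [q] counts the factors taken from the cross term
    of [XX], [f] the size factors coming from [YY]. *)
Definition left_mon a b q f t : R := mon a b t * dp (H t) q * dp (sz t) f.
(** The constant of the Catalan series [(1 - s) / 2], present for the trivial monomial only. *)
Definition triv (b : bool) : R := if b then 2^-1 else 0.

Definition ord_mon (A : nat -> nat -> R) a b :=
  ord (gf (mon a b)) (triv ((a == 0) && (b == 0))%N) ((d * a + 3 * b)%:R - 1) (A a b).

(** Each multiplication by the size raises the order by 2 and contributes half the current order,
    starting from [d i + 3 j - 1]. *)
Definition rho i j q : R := \prod_(m < q) (((d * i + 3 * j)%:R - 1) / 2 + m%:R).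

Definition top_cond k l i j q := [&& (i + q <= k)%N, eps ==> (q == 0)%N,
  (i, j, q) != (0, 0, 0)%N & (i, j, q) != (k, l, 0)%N].

(** The triple sum collects products of two leading coefficients. The last two terms come from the
    constant 1/2 of a trivial right subtree, with one size factor or, for constant [K], one cross
    factor on the left. *)
Definition rec_rhs (A : nat -> nat -> R) k l : R :=
  if (k + l == 0)%N then - 2^-1 else
  \sum_(0 <= i < k.+1) \sum_(0 <= j < l.+1)
    \sum_(0 <= q < k.+1 | top_cond k l i j q)
      mu (k - i - q) (l - j) q 0 * A (k - i - q)%N (l - j + ys * q)%N
        * (A i j * rho i j q)
  + (if (0 < l)%N then 2^-1 * (mu k (l - 1) 0 1 * A k (l - 1)%N) else 0)
  + (if eps && (0 < k)%N then 2^-1 * (mu (k - 1) l 1 0 * A (k - 1)%N (l + ys)%N) else 0).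

Hypothesis X0 : XX Defs.Empty = 0.
Hypothesis Y0 : YY Defs.Empty = 0.
Hypothesis YN : forall l r, YY (Node l r) = YY l + YY r + sz l.
Hypothesis XN : forall l r, XX (Node l r) = XX l + XX r + H l * K r.
Hypothesis d3 : (3 < d)%N.
Hypothesis ys1 : (ys <= 1)%N.
(** The input that is specific to [H]. The premise ranges over [g <= q] because [H] may contain
    [YY], which raises the exponent of [YY]. *)
Hypothesis left_ord : forall A a b q f,
  (forall g, (g <= q)%N -> ord_mon A a (b + g)) ->
  ord (gf (left_mon a b q f)) (triv [&& a == 0, b == 0, q == 0 & f == 0]%N)
    ((d * a + 3 * b + wH * q + 2 * f)%:R - 1) (mu a b q f * A a (b + ys * q)%N).

Lemma rec_exists : exists A, forall k l, A k l = rec_rhs A k l.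
Proof.
apply: (weight_rec (- 2^-1) (w := fun k l => d * k + 3 * l)%N) => f g k l fg.
rewrite /rec_rhs; case: ifP => // /negbT kl.
congr (_ + _ + _).
- apply: eq_big_nat => i /andP[_ ik]; apply: eq_big_nat => j /andP[_ jl].
  apply: eq_bigr => q; rewrite /top_cond !xpair_eqE.
  move=> /and4P[iq _ n0 n1]; rewrite (fg i j) ?(fg (k - i - q)%N) //.
    nia.
  nia.
- by case: ifP => // l0; rewrite fg //; nia.
- by case: ifP => // /andP[_ k0]; rewrite fg //; nia.
Qed.

Definition right_mon i j q t : R := mon i j t * K t ^+ q.

Lemma right_ord A i j q : ord_mon A i j ->
  ord (gf (right_mon i j q)) (triv [&& i == 0, j == 0 & (eps || (q == 0))]%N)
    ((d * i + 3 * j + (if eps then 0 else 2)%N * q)%:R - 1)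
    (A i j * (if eps then 1 else rho i j q)).
Proof.
move=> h; rewrite /right_mon /K; case: eps h => /= h.
  rewrite andbT mulr1 mul0n addn0; apply: eq_ord_gf h => t.
  by rewrite expr1n mulr1.
elim: q => [|q IH].
  rewrite eqxx andbT muln0 addn0 /rho big_ord0 mulr1.
  by apply: eq_ord_gf h => t; rewrite expr0 mulr1.
have := ord_sz _ IH; rewrite (_ : _ - 1 + 2 = (d * i + 3 * j + 2 * q).+1%:R); last first.
  by rewrite -natr1; ring.
move=> /(_ _ (erefl _)) h2.
rewrite !andbF /rho big_ord_recr /= -/(rho i j q).
rewrite (_ : _%:R - 1 = (d * i + 3 * j + 2 * q).+1%:R); last first.
  by rewrite mulnS -natr1 !natrD; ring.
rewrite (_ : A i j * _ = ((d * i + 3 * j + 2 * q)%:R - 1) / 2 * (A i j * rho i j q)); last first.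
  by rewrite [in RHS]natrD natrM; field.
by apply: eq_ord_gf h2 => t; rewrite exprS; ring.
Qed.

Lemma mon_node k l L Rt : mon k l (Node L Rt) =
  \sum_(x : 'I_k.+1 * 'I_k.+1 * 'I_l.+1 * 'I_l.+1 |
      (x.1.1.1 + x.1.1.2 <= k)%N && (x.1.2 + x.2 <= l)%N)
    left_mon (k - x.1.1.1 - x.1.1.2) (l - x.1.2 - x.2) x.1.1.2 x.2 L
     * right_mon x.1.1.1 x.1.2 x.1.1.2 Rt.
Proof.
rewrite /mon XN YN.
(* The summands are ordered so that the first index of each trinomial goes to the right subtree, the
   second to the cross term or to the size, and the remainder to the left subtree. *)
have -> : XX L + XX Rt + H L * K Rt = XX Rt + H L * K Rt + XX L by ring.
have -> : YY L + YY Rt + sz L = YY Rt + sz L + YY L by ring.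
have E3 (x y z : R) m : dp (x + y + z) m =
    \sum_(i < m.+1) \sum_(q < m.+1 | (i + q <= m)%N) dp x i * dp y q * dp z (m - i - q).
  by rewrite dpD3 big_mkord; apply: eq_bigr => i _; rewrite big_mkord.
rewrite !E3 pair_big_dep big_distrl /=.
under eq_bigr => p _ do rewrite big_distrr /=.
under eq_bigr => p _ do under eq_bigr => j _ do rewrite big_distrr /=.
rewrite pair_big_dep pair_big_dep /=; apply: eq_big => [x|x _]; first by rewrite andbT.
by rewrite /left_mon /right_mon /mon dpM; ring.
Qed.

Lemma quad_sum k l (G : nat -> nat -> nat -> nat -> R) :
  \sum_(x : 'I_k.+1 * 'I_k.+1 * 'I_l.+1 * 'I_l.+1) G x.1.1.1 x.1.1.2 x.1.2 x.2 =
  \sum_(0 <= i < k.+1) \sum_(0 <= q < k.+1) \sum_(0 <= j < l.+1) \sum_(0 <= f < l.+1) G i q j f.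
Proof.
rewrite big_mkord; under [RHS]eq_bigr do rewrite big_mkord.
under [RHS]eq_bigr do under eq_bigr do rewrite big_mkord.
under [RHS]eq_bigr do under eq_bigr do under eq_bigr do rewrite big_mkord.
by rewrite !pair_bigA.
Qed.

(* The two excluded indices are the terms in which one subtree carries the whole
   monomial; together they contribute [2 C G] with [C = gf 1], which [ord_mon_rec]
   moves to the left-hand side, where [1 - 2 C = s]. *)
Definition nonmain k l i q j f := [&& (i + q <= k)%N, (j + f <= l)%N,
  (i, q, j, f) != (0, 0, 0, 0)%N & (i, q, j, f) != (k, 0, l, 0)%N].

Definition lam (A : nat -> nat -> R) k l i q j f :=
  mu (k - i - q) (l - j - f) q f * A (k - i - q)%N (l - j - f + ys * q)%N.

Definition lead A k l i q j f : R :=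
  (if (f == 0%N) && (eps ==> (q == 0%N)) then lam A k l i q j f * (A i j * rho i j q) else 0)
  + (if [&& i == 0, j == 0, q == 0 & f == 1]%N then 2^-1 * lam A k l i q j f else 0)
  + (if [&& eps, i == 0, j == 0, q == 1 & f == 0]%N then 2^-1 * lam A k l i q j f else 0).

Lemma lead_split A k l i q j f : (0 < k + l)%N -> (j <= l)%N ->
  (if nonmain k l i q j f then lead A k l i q j f else 0) =
  (if f == 0%N then if top_cond k l i j q then lam A k l i q j 0 * (A i j * rho i j q) else 0 else 0)
  + (if f == 1%N then if j == 0%N then if q == 0%N then if i == 0%N then
       (if (0 < l)%N then 2^-1 * lam A k l 0 0 0 1 else 0) else 0 else 0 else 0 else 0)
  + (if f == 0%N then if j == 0%N then if q == 1%N then if i == 0%N then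
       (if eps && (0 < k)%N then 2^-1 * lam A k l 0 1 0 0 else 0) else 0 else 0 else 0 else 0).
Proof.
rewrite /lead /nonmain /top_cond !xpair_eqE; case: eps => /=;
case: i => [|i]; case: j => [|j]; case: q => [|[|q]]; case: f => [|[|f]];
  rewrite /= ?andbF ?andbT ?if_same ?(addr0, add0r, addn0, add0n) // => kl jl;
  (case: ifP => h1; (try case: ifP => h2); rewrite ?(addr0, add0r) //; lia).
Qed.

Lemma sum_lead A k l : (0 < k + l)%N ->
  \sum_(x : 'I_k.+1 * 'I_k.+1 * 'I_l.+1 * 'I_l.+1 |
      nonmain k l x.1.1.1 x.1.1.2 x.1.2 x.2) lead A k l x.1.1.1 x.1.1.2 x.1.2 x.2
  = rec_rhs A k l.
Proof.
move=> kl0; rewrite /rec_rhs ifF; last by lia.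
rewrite big_mkcond /= (@quad_sum k l (fun i q j f =>
  if nonmain k l i q j f then lead A k l i q j f else 0)).
pose S (G : nat -> nat -> nat -> nat -> R) := \sum_(0 <= i < k.+1) \sum_(0 <= q < k.+1)
   \sum_(0 <= j < l.+1) \sum_(0 <= f < l.+1) G i q j f.
have SD G1 G2 : S (fun i q j f => G1 i q j f + G2 i q j f) = S G1 + S G2.
  rewrite /S -big_split; apply: eq_bigr => i _ /=; rewrite -big_split.
  apply: eq_bigr => q _ /=; rewrite -big_split; apply: eq_bigr => j _ /=.
  by rewrite -big_split.
have Seq G1 G2 : (forall i q j f, (j <= l)%N -> G1 i q j f = G2 i q j f) -> S G1 = S G2.
  move=> e; apply: eq_bigr => i _; apply: eq_bigr => q _.
  by apply: eq_big_nat => j /andP[_ jl]; apply: eq_bigr => f _; exact: e.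
have bif n a (F : nat -> R) : \sum_(0 <= i < n) (if i == a then F i else 0) =
    if (a < n)%N then F a else 0 by rewrite -big_mkcond big_nat1_eq.
have Sif a b c : S (fun i q j f => if f == a then if j == 0%N then if q == b then
    if i == 0%N then c else 0 else 0 else 0 else 0) =
    if (a <= l)%N && (b <= k)%N then c else 0.
  rewrite /S; under eq_bigr do under eq_bigr do under eq_bigr do rewrite bif ltnS.
  case: (a <= l)%N => /=; last by rewrite !big1 // => *; rewrite !big1 // => *; rewrite big1.
  under eq_bigr do under eq_bigr do rewrite bif /=.
  under eq_bigr do rewrite bif ltnS.
  by case: (b <= k)%N; [rewrite bif|rewrite big1].
rewrite -/(S (fun i q j f => if nonmain k l i q j f then lead A k l i q j f else 0)).
rewrite (Seq _ (fun i q j f =>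
  (if f == 0%N then if top_cond k l i j q then lam A k l i q j 0 * (A i j * rho i j q) else 0 else 0)
  + (if f == 1%N then if j == 0%N then if q == 0%N then if i == 0%N then
       (if (0 < l)%N then 2^-1 * lam A k l 0 0 0 1 else 0) else 0 else 0 else 0 else 0)
  + (if f == 0%N then if j == 0%N then if q == 1%N then if i == 0%N then
       (if eps && (0 < k)%N then 2^-1 * lam A k l 0 1 0 0 else 0)
     else 0 else 0 else 0 else 0))); last first.
  by move=> i q j f jl; exact: lead_split.
rewrite !SD !Sif /=; congr (_ + _ + _).
- rewrite /S; apply: eq_bigr => i _; rewrite exchange_big /=; apply: eq_bigr => j _.
  rewrite [RHS]big_mkcond /=; apply: eq_bigr => q _; rewrite bif /=.
  by case: ifP => // _; rewrite /lam subn0.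
- by rewrite leq0n andbT; case: (0 < l)%N => //; rewrite /lam !subn0 muln0 addn0.
- by case: (boolP (eps && _)) => [/andP[_ ->]|_]; [rewrite /lam !subn0 muln1|case: ifP].
Qed.

(** The orders of the two factors add up to the target minus [del]: each size factor weighs 2 where
    [YY] weighs 3, and for constant [K] each cross factor weighs [wH = d - 1]. For [del = 0] the
    leading coefficients multiply. For [del = 1] only the constant of a trivial right factor makes
    up the loss, since multiplying by it avoids the order -1 of that factor. For [del > 1] nothing
    reaches the target order. *)
Lemma ord_term A k l i q j f :
  (forall a b, (d * a + 3 * b < d * k + 3 * l)%N -> ord_mon A a b) -> nonmain k l i q j f ->
  ord (conv (gf (left_mon (k - i - q) (l - j - f) q f)) (gf (right_mon i j q))) 0
    ((d * k + 3 * l)%:R - 2) (lead A k l i q j f).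
Proof.
move=> IH nm.
have d3' := d3.
have hR : ord_mon A i j by apply: IH; move: nm; rewrite /nonmain !xpair_eqE; nia.
(* Here [d > 3] matters: each cross factor removes [d] from the weight and returns at most 3. *)
have hL g : (g <= q)%N -> ord_mon A (k - i - q) (l - j - f + g).
  by move=> gq; apply: IH; move: nm; rewrite /nonmain !xpair_eqE; nia.
have oL := left_ord f hL; have oR := right_ord q hR.
rewrite -/(lam A k l i q j f) in oL.
(* A trivial left factor occurs only at an excluded index, so the left series may be taken without
   constant in [ord_conv]. *)
have eL : triv [&& (k - i - q == 0)%N, (l - j - f == 0)%N, q == 0%N & f == 0%N] = 0.
  by rewrite /triv ifF //; move: nm; rewrite /nonmain !xpair_eqE; lia.
rewrite eL in oL.
have oC := ord_conv oL oR.
set eR := triv _ in oC.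
have [iq jf n0 n1] : [/\ (i + q <= k)%N, (j + f <= l)%N,
    (i, q, j, f) != (0, 0, 0, 0)%N & (i, q, j, f) != (k, 0, l, 0)%N] by apply/and4P.
pose del := ((if eps then q else 0) + f)%N.
have w : (d * (k - i - q) + 3 * (l - j - f) + wH * q + 2 * f
   + (d * i + 3 * j + (if eps then 0 else 2) * q) + del = d * k + 3 * l)%N.
  have : k = (k - i - q + (i + q))%N by lia.
  have : l = (l - j - f + (j + f))%N by lia.
  move: (k - i - q)%N (l - j - f)%N => a b -> ->; rewrite /del /d; case: eps; nia.
have wR : (d * (k - i - q) + 3 * (l - j - f) + wH * q + 2 * f)%:R - 1
   + ((d * i + 3 * j + (if eps then 0 else 2) * q)%:R - 1) + del%:R
   = (d * k + 3 * l)%:R - 2 :> R by rewrite -w !natrD; ring.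
have conv_split c1 c2 :
  ord (fun n => conv (gf (left_mon (k - i - q) (l - j - f) q f)) (gf (right_mon i j q)) n
     - eR * gf (left_mon (k - i - q) (l - j - f) q f) n) 0 ((d * k + 3 * l)%:R - 2) c1 ->
  ord (fun n => eR * gf (left_mon (k - i - q) (l - j - f) q f) n) 0 ((d * k + 3 * l)%:R - 2) c2 ->
  ord (conv (gf (left_mon (k - i - q) (l - j - f) q f)) (gf (right_mon i j q))) 0
    ((d * k + 3 * l)%:R - 2) (c1 + c2).
  by move=> o1 o2; have := ordD o1 o2; rewrite addr0; apply: eq_ord => n; ring.
have o0 M : ord (fun n => 0 * gf (left_mon (k - i - q) (l - j - f) q f) n) 0 M 0.
  by apply: eq_span (span0 _) => n; ring.
have [del0|del0] := posnP del.
  have f0 : f = 0%N by move: del0; rewrite /del; lia.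
  have q0 : eps -> q = 0%N by move=> e; move: del0; rewrite /del e; lia.
  have eR0 : eR = 0.
    rewrite /eR /triv ifF //; move: n0; rewrite !xpair_eqE f0 /=.
    by move: q0; case: eps => [/(_ isT) ->|_]; lia.
  have -> : lead A k l i q j f = lam A k l i q j f * (A i j * (if eps then 1 else rho i j q)) + 0.
    rewrite /lead {1}f0 eqxx /= ifT; last by apply/implyP => /q0 ->.
    rewrite ifF ?f0 ?andbF // ifF; last first.
      by apply/negbTE/negP => /and4P[/q0 -> _ _ /andP[]].
    rewrite !addr0; congr (_ * (_ * _)); case: ifP => // /q0 ->.
    by rewrite /rho big_ord0.
  rewrite del0 addr0 in wR.
  apply: conv_split; first by rewrite -wR.
  by rewrite eR0; exact: o0.
have -> : lead A k l i q j f = 0 +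
   (if [&& i == 0, j == 0, eps || (q == 0) & del == 1]%N then 2^-1 * lam A k l i q j f else 0).
  rewrite /lead ifF; last by move: del0; rewrite /del; case: eps; lia.
  rewrite add0r /del; case: eps => /=; last first.
    by rewrite addr0 add0r add0n.
  have [->|i0] := eqVneq i 0%N; last by rewrite !add0r.
  have [->|j0] := eqVneq j 0%N; last by rewrite !add0r.
  move: (lam _ _ _ _ _ _ _) => c /=.
  case: ifP => h1; case: ifP => h2; case: ifP => h3; rewrite ?(addr0, add0r) //; lia.
apply: conv_split.
  apply: (ord_up (k := del.-1)) oC; rewrite prednK //; exact: esym.
rewrite /eR; case Eb : [&& i == 0, j == 0 & eps || (q == 0)]%N; last first.
  rewrite /triv ifF; first exact: o0.
  by move: Eb; case: (i == 0)%N; case: (j == 0)%N => //= ->.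
case/and3P: Eb => i0 j0 eq0; rewrite /triv i0 j0 eq0 /=.
have ML : (d * (k - i - q) + 3 * (l - j - f) + wH * q + 2 * f + del = d * k + 3 * l)%N.
  by move: w i0 j0 eq0; case: eps => /=; lia.
have MLR : (d * (k - i - q) + 3 * (l - j - f) + wH * q + 2 * f)%:R - 1 + del%:R
   = (d * k + 3 * l)%:R - 1 :> R by rewrite -ML !natrD; ring.
have := ordZ 2^-1 oL; rewrite mulr0 => o2.
case: eqP => del1.
  rewrite (_ : (d * k + 3 * l)%:R - 2 = (d * (k - i - q) + 3 * (l - j - f) + wH * q + 2 * f)%:R - 1) //.
  by move: MLR; rewrite del1; lra.
apply: (ord_up (k := del.-2)) o2.
have -> : del.-2.+1%:R = del%:R - 1 :> R.
  case: (del) del0 del1 => [|[|x]] // _ _.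
  by rewrite [in RHS]mulrS /=; ring.
by move: MLR; lra.
Qed.

Lemma ord_mon_rec A : (forall k l, A k l = rec_rhs A k l) -> forall k l, ord_mon A k l.
Proof.
move=> HA k l; have [n] := ubnP (d * k + 3 * l)%N; elim: n k l => // n IHn k l wn.
have IH a b : (d * a + 3 * b < d * k + 3 * l)%N -> ord_mon A a b.
  by move=> ab; apply: IHn; lia.
have [kl0|kl0] := posnP (k + l).
  have [-> ->] : k = 0%N /\ l = 0%N by lia.
  rewrite /ord_mon HA /rec_rhs /= !muln0 /= sub0r.
  by apply: eq_ord_gf ord_gf1 => t; rewrite /mon !dp0 mulr1.
pose T := ('I_k.+1 * 'I_k.+1 * 'I_l.+1 * 'I_l.+1)%type.
pose Fc i q j f := conv (gf (left_mon (k - i - q) (l - j - f) q f)) (gf (right_mon i j q)).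
have main0 : Fc 0%N 0%N 0%N 0%N =1 conv (gf (mon k l)) (gf (fun=> 1)).
  apply: eq_conv; apply: eq_gf => t.
    by rewrite /left_mon !subn0 !dp0 !mulr1.
  by rewrite /right_mon /mon !dp0 !mulr1.
have main1 : Fc k 0%N l 0%N =1 conv (gf (fun=> 1)) (gf (mon k l)).
  apply: eq_conv; apply: eq_gf => t.
    by rewrite /left_mon /mon !subnn !dp0 !mulr1.
  by rewrite /right_mon /mon expr0 !mulr1.
have E n' : conv (bs (-1)) (gf (mon k l)) n' =
    \sum_(x : T | nonmain k l x.1.1.1 x.1.1.2 x.1.2 x.2) Fc x.1.1.1 x.1.1.2 x.1.2 x.2 n'.
  have mE : mon k l Defs.Empty = 0.
    rewrite /mon X0 Y0 /dp !expr0n; case: k l kl0 {IH wn T Fc main0 main1} => [|k'] [|l'] //= _;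
      by rewrite ?(mul0r, mulr0).
  have e1 := gf_node n' mE (mon_node k l).
  pose x0 : T := (ord0, ord0, ord0, ord0).
  pose x1 : T := (ord_max, ord0, ord_max, ord0).
  have e2 : gf (mon k l) n' = Fc 0%N 0%N 0%N 0%N n' + (Fc k 0%N l 0%N n' +
    \sum_(x : T | nonmain k l x.1.1.1 x.1.1.2 x.1.2 x.2) Fc x.1.1.1 x.1.1.2 x.1.2 x.2 n').
    rewrite e1 (bigD1 x0) //= (bigD1 x1) /=; last first.
      by rewrite !addn0 !leqnn /= !xpair_eqE -!val_eqE /=; lia.
    congr (_ + (_ + _)); apply: eq_bigl => -[[[i q] j] f] /=.
    by rewrite /nonmain !xpair_eqE -!val_eqE /=; lia.
  have e3 : conv (bs (-1)) (gf (mon k l)) n' =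
     gf (mon k l) n' - 2 * conv (gf (fun=> 1)) (gf (mon k l)) n'.
    have eb : bs (-1) =1 (fun m => bs 0 m + (-2) * gf (fun=> 1) m) :> (nat -> R).
      by move=> m; rewrite gf1; field.
    rewrite (eq_conv eb (frefl _)) convDl convZl mulNr; congr (_ - _).
    rewrite /conv big_ord_recl bs0 mul1r subn0 big1 ?addr0 // => i _.
    by rewrite bs0 mul0r.
  rewrite e3 {1}e2 main0 main1 [conv (gf (mon k l)) _ _]convC; ring.
rewrite /ord_mon /triv ifF; last by lia.
have -> : (d * k + 3 * l)%:R - 1 = (d * k + 3 * l)%:R - 2 + 1 :> R by ring.
apply: ord_solve; rewrite HA -sum_lead //.
apply: eq_ord (fun n' => esym (E n')) _.
by apply: ord_sum => x; exact: ord_term.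
Qed.

End GenericRecursion.

(** * Limits of the moments *)

Section Limit.
Context {R : realType}.

Lemma cvg_scaled_sum (s : seq (R * nat)) (T : nat -> nat -> R) :
  (forall k, T k n @[n --> \oo] --> (0 : R)) ->
  \sum_(x <- s) x.1 * T x.2 n @[n --> \oo] --> (0 : R).
Proof.
move=> T0; elim: s => [|x s IH].
  by under eq_fun do rewrite big_nil; exact: cvg_cst.
under eq_fun do rewrite big_cons.
have h : x.1 * T x.2 n @[n --> \oo] --> x.1 * 0 by apply: cvgM; [exact: cvg_cst|exact: T0].
by have := cvgD h IH; rewrite mulr0 addr0; apply.
Qed.

(** [N = 1] would be the pole of [Gamma] at 0; [N = 0] gives the parameter -1/2 of the Catalan
    numbers. *)
Lemma rf_lim_order N : N != 1%N ->
  rf_lim ((N%:R - 1) / 2 : R) (Gamma ((N%:R - 1) / 2))^-1.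
Proof.
case: N => [|[|N]] // _.
  by rewrite sub0r mulN1r; exact: rf_lim_neghalf.
rewrite (_ : N.+2%:R - 1 = N.+1%:R); first exact: rf_lim_Gamma.
by rewrite -natr1; ring.
Qed.

(** The powers of 4 cancel in the quotient by the Catalan number, leaving rising factorials. The
    prefactor -2 inverts the coefficient of [s] in [(1 - s) / 2]; times [c Gamma (- 1/2)] it gives
    [4 sqrt pi c]. *)
Lemma ord_limit (phi : bintree -> R) N e c : N != 1%N ->
  ord (gf phi) e (N%:R - 1) c ->
  n%:R `^ (- (N%:R / 2)) * ((\sum_(t : btree n) phi (val t)) / #|{: btree n}|%:R) @[n --> \oo]
   --> 4 * Num.sqrt pi * c / Gamma ((N%:R - 1) / 2).
Proof.
move=> N1 [s hs].
set M := N%:R - 1 in hs *.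
pose T k n : R := rf ((M - 1 - k%:R) / 2) n.+1 * n%:R `^ (1 - M / 2).
have T0 k : T k n @[n --> \oo] --> (0 : R).
  have [l hl] := @rf_lim_half_ex R (N%:Z - 2 - k%:Z).
  apply: rf_lim_lower; last first.
    rewrite (_ : (M - 1 - k%:R) / 2 = (N%:Z - 2 - k%:Z)%:~R / 2); first exact: hl.
    by rewrite !intrB /M; congr (_ / _); ring.
  by rewrite ltr_pM2r ?invr_gt0 //; have := ler0n R k; lra.
have D1 := @rf_lim_neghalf R.
have g0 : Gamma (- 2^-1) != 0 :> R.
  by rewrite Gamma_neghalf mulf_neq0 ?oppr_eq0 // gt_eqF // sqrtr_gt0 pi_gt0.
have lim1 : -2 * (c * (rf (M / 2) n.+1 * n%:R `^ (1 - M / 2)) + \sum_(x <- s) x.1 * T x.2 n)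
    / (rf (- 2^-1) n.+1 * n%:R `^ (1 - (- 2^-1))) @[n --> \oo] -->
    -2 * (c * (Gamma (M / 2))^-1 + 0) / (Gamma (- 2^-1))^-1.
  apply: cvgM.
    apply: cvgM; first exact: cvg_cst.
    apply: cvgD; last exact: cvg_scaled_sum.
    by apply: cvgM; [exact: cvg_cst|exact: rf_lim_order].
  by apply: cvgV => //; rewrite invr_eq0.
have -> : 4 * Num.sqrt pi * c / Gamma (M / 2) = -2 * (c * (Gamma (M / 2))^-1 + 0) / (Gamma (- 2^-1))^-1.
  by rewrite addr0 invrK Gamma_neghalf; ring.
apply: cvg_trans lim1; apply: near_eq_cvg; near=> n.
have n0 : n%:R != 0 :> R by rewrite pnatr_eq0 -lt0n; near: n; exact: nbhs_infty_gt.
have -> : \sum_(t : btree n) phi (val t) = gf phi n.+1 by rewrite sum_btree.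
have -> : #|{: btree n}|%:R = gf (fun=> 1) n.+1 :> R.
  by rewrite /= -sum_btree sumr_const.
rewrite gf1 bs0 mulr0 sub0r.
have -> : gf phi n.+1 = 4 ^+ n.+1 * (c * rf (M / 2) n.+1 +
    \sum_(x <- s) x.1 * rf ((M - 1 - x.2%:R) / 2) n.+1).
  have /= := hs n.+1; rewrite bs0 mulr0 subr0 => /eqP; rewrite subr_eq => /eqP ->.
  rewrite mulrDr big_distrr /= addrC /bs; congr (_ + _); first by ring.
  by apply: eq_bigr => x _; ring.
rewrite /bs mulN1r.
have -> : n%:R `^ (1 - M / 2) = n%:R `^ (- (N%:R / 2)) * n%:R `^ (1 - (- 2^-1)) :> R.
  by rewrite -powRD ?n0 ?implybT //; congr (_ `^ _); rewrite /M; field.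
rewrite (_ : \sum_(x <- s) x.1 * T x.2 n = (\sum_(x <- s) x.1 * rf ((M - 1 - x.2%:R) / 2) n.+1) *
  (n%:R `^ (- (N%:R / 2)) * n%:R `^ (1 - (- 2^-1)))); last first.
  rewrite big_distrl /=; apply: eq_bigr => x _; rewrite /T -powRD ?n0 ?implybT //.
  by rewrite -mulrA; congr (_ * (_ * _ `^ _)); rewrite /M; field.
have f4 : 4 ^+ n.+1 != 0 :> R by rewrite expf_neq0.
have p0 : n%:R `^ (1 - (- 2^-1)) != 0 :> R by rewrite powR_eq0 (negbTE n0).
have r0 : rf (- 2^-1) n.+1 != 0 :> R.
  rewrite /rf; apply/prodf_neq0 => i _; rewrite mulf_neq0 ?invr_eq0 ?pnatr_eq0 //.
  case: (nat_of_ord i) => [|j]; first by rewrite addr0 oppr_eq0 invr_eq0 pnatr_eq0.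
  by rewrite gt_eqF // -[j.+1%:R]natr1; have := ler0n R j; lra.
by field; rewrite f4 p0 r0.
Unshelve. all: by end_near. Qed.

End Limit.

(** * Leading coefficients of the left factors *)

Section LeftFactors.
Context {R : realType}.
Variables (XX YY : bintree -> R) (eps : bool) (wH : nat).
Let d := (wH + (if eps then 1 else 2))%N.

Definition rise (a : R) f : R := \prod_(t < f) (a + t%:R).

(** Repeated [ord_sz]: successive factors are half of [M], [M + 2], [M + 4], and so on. Writing
    [M + 1] as a natural number makes every order after the first multiplication positive, so that
    the constant is absorbed. *)
Lemma ord_szX phi e M c m f : M + 1 = m%:R :> R -> ord (gf phi) e M c ->
  ord (gf (fun t => sz t ^+ f * phi t)) (if f == 0%N then e else 0) (M + 2 * f%:R)
    (c * rise (M / 2) f).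
Proof.
move=> Mm h; elim: f => [|f IH].
  rewrite mulr0 addr0 /rise big_ord0 mulr1.
  by apply: eq_ord_gf h => t; rewrite expr0 mul1r.
have Mk : M + 2 * f%:R + 2 = (m + 2 * f).+1%:R.
  by rewrite -[(m + 2 * f).+1%:R]natr1 natrD natrM -Mm; ring.
have h2 := ord_sz Mk IH.
rewrite /rise big_ord_recr /= -/(rise (M / 2) f).
rewrite (_ : M + 2 * f.+1%:R = M + 2 * f%:R + 2); last by rewrite -[f.+1%:R]natr1; ring.
rewrite (_ : c * _ = (M + 2 * f%:R) / 2 * (c * rise (M / 2) f)); last by field.
by apply: eq_ord_gf h2 => t; rewrite exprS mulrA.
Qed.

Definition ch2 (t : bintree) : R := (sz t ^+ 2 - sz t) / 2.

(** One factor [ch2] acts to leading order as two size factors and a division by 2. *)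
Definition rise2 (M : R) q : R := \prod_(t < q) ((M / 2 + 2 * t%:R) * (M / 2 + 2 * t%:R + 1) / 2).

Lemma ord_ch2X phi e M c m q : M + 1 = m%:R :> R -> ord (gf phi) e M c ->
  ord (gf (fun t => ch2 t ^+ q * phi t)) (if q == 0%N then e else 0) (M + 4 * q%:R)
    (c * rise2 M q).
Proof.
move=> Mm h; elim: q => [|q IH].
  rewrite mulr0 addr0 /rise2 big_ord0 mulr1.
  by apply: eq_ord_gf h => t; rewrite expr0 mul1r.
have Mk : M + 4 * q%:R + 2 = (m + 4 * q).+1%:R.
  by rewrite -[(m + 4 * q).+1%:R]natr1 natrD natrM -Mm; ring.
have h1 := ord_sz Mk IH.
have Mk' : M + 4 * q%:R + 2 + 2 = (m + 4 * q).+3%:R.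
  have -> : (m + 4 * q).+3%:R = (m + 4 * q)%:R + 3 :> R by rewrite -addn3 natrD.
  by rewrite natrD natrM -Mm; ring.
have h2 := ord_sz Mk' h1.
have h3 := ord_up (k := 1) (erefl (M + 4 * q%:R + 2 + 2)) h1.
have h4 := ordZ 2^-1 (ordD h2 (ordZ (-1) h3)).
rewrite !mulr0 !addr0 mulr0 in h4.
rewrite /rise2 big_ord_recr /= -/(rise2 M q).
rewrite (_ : M + 4 * q.+1%:R = M + 4 * q%:R + 2 + 2); last by rewrite -[q.+1%:R]natr1; ring.
rewrite (_ : c * _ =
  2^-1 * ((M + 4 * q%:R + 2) / 2 * ((M + 4 * q%:R) / 2 * (c * rise2 M q)))); last by field.
apply: eq_ord h4 => n.
rewrite -gfZ -gfD -gfZ; apply: eq_gf => t.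
by rewrite exprS {3}/ch2; field.
Qed.

(** The binomial merges the divided powers [b] and [q] of [YY]; the rising factorial over the
    factorial accounts for the size factors. *)
Definition muY a b q f : R := 'C(b + q, q)%:R / f`!%:R * rise (((d * a + 3 * (b + q))%:R - 1) / 2) f.

Lemma ord_monY A a b q f : ord_mon XX YY eps wH A a (b + q) ->
  ord (gf (fun t => mon XX YY a b t * dp (YY t) q * dp (sz t) f))
    (triv [&& a == 0, b == 0, q == 0 & f == 0]%N)
    ((d * a + 3 * b + 3 * q + 2 * f)%:R - 1) (muY a b q f * A a (b + q)%N).
Proof.
move=> h.
have Mm : ((d * a + 3 * (b + q))%:R - 1) + 1 = (d * a + 3 * (b + q))%:R :> R by ring.
have h1 := ordZ ('C(b + q, q)%:R / f`!%:R) (ord_szX f Mm h).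
have -> : (d * a + 3 * b + 3 * q + 2 * f)%:R - 1 = (d * a + 3 * (b + q))%:R - 1 + 2 * f%:R :> R.
  by rewrite !natrD !natrM natrD; ring.
have -> : muY a b q f * A a (b + q)%N = 'C(b + q, q)%:R / f`!%:R *
   (A a (b + q)%N * rise (((d * a + 3 * (b + q))%:R - 1) / 2) f) by rewrite /muY; ring.
have -> : triv [&& a == 0, b == 0, q == 0 & f == 0]%N = 'C(b + q, q)%:R / f`!%:R *
   (if f == 0%N then triv ((a == 0%N) && (b + q == 0)%N) else 0) :> R.
  rewrite addn_eq0; case: f {h1} => [|f]; last by rewrite !andbF mulr0.
  case: a b q {h Mm} => [|a] [|b] [|q]; rewrite /triv /= ?mulr0 //.
  by rewrite divr1 mul1r.
apply: eq_ord h1 => n; rewrite -gfZ; apply: eq_gf => t.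
rewrite /mon -[RHS]mulrA -[RHS]mulrA [dp (YY t) b * _]mulrA dpMC.
rewrite -(bin_sub (leq_addl b q)) addnK /dp; ring.
Qed.

Lemma sum_ord_lead M (s : nat -> bintree -> R) (c : nat -> R) e q :
  ord (gf (s 0%N)) e M (c 0%N) ->
  (forall i, (0 < i <= q)%N -> ord (gf (s i)) 0 (M - i%:R) (c i)) ->
  ord (gf (fun t => \sum_(0 <= i < q.+1) s i t)) e M (c 0%N).
Proof.
move=> h0 hi.
have h : ord (fun n => \sum_(1 <= i < q.+1) gf (s i) n) 0 M 0.
  rewrite [X in ord _ _ _ X](_ : 0 = \sum_(1 <= i < q.+1) (0 : R)); last by rewrite big1.
  rewrite big_nat_cond; apply: eq_ord (fun n => esym (big_nat_cond _ _ _ _ _ _)) _.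
  apply: ord_sum => i; rewrite andbT => /andP[i0 iq].
  have hi' : ord (gf (s i)) 0 (M - i%:R) (c i) by apply: hi; rewrite i0.
  apply: (ord_up (k := i.-1)) hi'; rewrite prednK //; ring.
have := ordD h0 h; rewrite !addr0; apply: eq_ord => n.
by rewrite gf_sum [RHS]big_ltn.
Qed.

Lemma left_ord_Y A a b q f : wH = 3%N ->
  (forall g, (g <= q)%N -> ord_mon XX YY eps wH A a (b + g)) ->
  ord (gf (left_mon XX YY YY a b q f)) (triv [&& a == 0, b == 0, q == 0 & f == 0]%N)
    ((d * a + 3 * b + wH * q + 2 * f)%:R - 1) (muY a b q f * A a (b + 1 * q)%N).
Proof.
move=> w3 h; rewrite mul1n.
have -> : (d * a + 3 * b + wH * q + 2 * f = d * a + 3 * b + 3 * q + 2 * f)%N by rewrite w3.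
by apply: ord_monY; exact: h.
Qed.

(** Replacing [i] of the factors [YY] by sizes loses [i] orders, so [YY + sz] has the same leading
    coefficient as [YY]. *)
Lemma left_ord_Ysz A a b q f : wH = 3%N ->
  (forall g, (g <= q)%N -> ord_mon XX YY eps wH A a (b + g)) ->
  ord (gf (left_mon XX YY (fun t => YY t + sz t) a b q f))
    (triv [&& a == 0, b == 0, q == 0 & f == 0]%N)
    ((d * a + 3 * b + wH * q + 2 * f)%:R - 1) (muY a b q f * A a (b + 1 * q)%N).
Proof.
move=> w3 h; rewrite mul1n.
have -> : (d * a + 3 * b + wH * q + 2 * f = d * a + 3 * b + 3 * q + 2 * f)%N by rewrite w3.
pose s i t := 'C(i + f, i)%:R * (mon XX YY a b t * dp (YY t) (q - i) * dp (sz t) (i + f)).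
have hs i : (i <= q)%N -> ord (gf (s i))
    ('C(i + f, i)%:R * triv [&& a == 0, b == 0, (q - i) == 0 & i + f == 0]%N)
    ((d * a + 3 * b + 3 * (q - i) + 2 * (i + f))%:R - 1)
    ('C(i + f, i)%:R * (muY a b (q - i) (i + f) * A a (b + (q - i))%N)).
  move=> iq; have o := ord_monY (i + f) (h (q - i)%N (leq_subr _ _)).
  by apply: eq_ord (ordZ 'C(i + f, i)%:R o) => n; rewrite -gfZ.
have h0 := hs 0%N isT; rewrite bin0 !mul1r subn0 !add0n in h0.
have := sum_ord_lead (q := q) (s := s)
  (c := fun i => 'C(i + f, i)%:R * (muY a b (q - i) (i + f) * A a (b + (q - i))%N)).
rewrite bin0 !mul1r subn0 !add0n => /(_ _ _ h0) H.
apply: eq_ord_gf (H _) => [t|i /andP[i0 iq]].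
  rewrite /left_mon addrC dpD big_distrr big_distrl /=; apply: eq_bigr => i _.
  transitivity (mon XX YY a b t * dp (YY t) (q - i) * ('C(i + f, i)%:R * dp (sz t) (i + f))).
    by rewrite /s; ring.
  by rewrite -dpMC; ring.
have := hs i iq; rewrite /triv (_ : (i + f == 0)%N = false) ?andbF ?mulr0; last by lia.
by rewrite (_ : _ - 1 - i%:R = (d * a + 3 * b + 3 * (q - i) + 2 * (i + f))%:R - 1) //
  !natrD !natrM !natrD natrB //; ring.
Qed.

Definition mu2 a b q f : R := rise (((d * a + 3 * b)%:R - 1) / 2) f / f`!%:R
  * rise2 ((d * a + 3 * b + 2 * f)%:R - 1) q / q`!%:R.

(** [ch2] has weight 4 against 3 for [YY], so only [ch2^q] survives and the exponent of [YY] is not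
    raised, whence [ys = 0]. *)
Lemma left_ord_ch2 A a b q f : wH = 4%N ->
  (forall g, (g <= q)%N -> ord_mon XX YY eps wH A a (b + g)) ->
  ord (gf (left_mon XX YY (fun t => ch2 t - YY t) a b q f))
    (triv [&& a == 0, b == 0, q == 0 & f == 0]%N)
    ((d * a + 3 * b + wH * q + 2 * f)%:R - 1) (mu2 a b q f * A a (b + 0 * q)%N).
Proof.
move=> w4 h; rewrite mul0n addn0.
pose s i t := (-1) ^+ i / (q - i)`!%:R *
  (ch2 t ^+ (q - i) * (mon XX YY a b t * dp (YY t) i * dp (sz t) f)).
have hs i : (i <= q)%N -> ord (gf (s i))
    ((-1) ^+ i / (q - i)`!%:R * (if (q - i == 0)%N
      then triv [&& a == 0, b == 0, i == 0 & f == 0]%N else 0))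
    ((d * a + 3 * b + 3 * i + 2 * f)%:R - 1 + 4 * (q - i)%:R)
    ((-1) ^+ i / (q - i)`!%:R * (muY a b i f * A a (b + i)%N
      * rise2 ((d * a + 3 * b + 3 * i + 2 * f)%:R - 1) (q - i))).
  move=> iq; have h1 := ord_monY f (h i iq).
  have h2 := ordZ ((-1) ^+ i / (q - i)`!%:R) (ord_ch2X (q - i) (subrK _ _) h1).
  by apply: eq_ord h2 => n; rewrite -gfZ.
have h0 := hs 0%N isT.
have := sum_ord_lead (q := q) (s := s)
  (c := fun i => (-1) ^+ i / (q - i)`!%:R *
    (muY a b i f * A a (b + i)%N * rise2 ((d * a + 3 * b + 3 * i + 2 * f)%:R - 1) (q - i))).
move=> /(_ _ _ h0) H.
have e1 : (d * a + 3 * b + wH * q + 2 * f)%:R - 1 =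
  (d * a + 3 * b + 3 * 0 + 2 * f)%:R - 1 + 4 * (q - 0)%:R :> R.
  by rewrite w4 subn0 !natrD !natrM; ring.
have e2 : mu2 a b q f * A a b = (-1) ^+ 0 / (q - 0)`!%:R *
  (muY a b 0 f * A a (b + 0)%N * rise2 ((d * a + 3 * b + 3 * 0 + 2 * f)%:R - 1) (q - 0)).
  by rewrite /mu2 /muY bin0 muln0 !addn0 subn0 expr0; ring.
have e3 : triv [&& a == 0, b == 0, q == 0 & f == 0]%N =
  ((-1) ^+ 0 / (q - 0)`!%:R * (if (q - 0 == 0)%N
    then triv [&& a == 0, b == 0, 0 == 0 & f == 0]%N else 0)) :> R.
  rewrite subn0; case: (q) => [|q'] /=; first by rewrite expr0 divr1 mul1r.
  by rewrite !andbF mulr0.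
rewrite e1 e2 e3; apply: eq_ord_gf (H _) => [t|i /andP[i0 iq]].
  rewrite /left_mon addrC dpD big_distrr big_distrl /=; apply: eq_bigr => i _.
  by rewrite /s dpN {4}/dp; ring.
have := hs i iq; rewrite /triv (_ : (i == 0)%N = false) ?andbF /= ?if_same ?mulr0; last by lia.
rewrite (_ : _ + 4 * (q - 0)%:R - i%:R = (d * a + 3 * b + 3 * i + 2 * f)%:R - 1 + 4 * (q - i)%:R) //.
by rewrite subn0 natrB // !natrD !natrM; ring.
Qed.

End LeftFactors.

(** * Tree recursions for the pattern counts, and the mirror involution *)

Fixpoint t12 (t : bintree) : nat :=
  if t is Node l r then (t12 l + t12 r + nodes l)%N else 0%N.

Fixpoint t21 (t : bintree) : nat :=
  if t is Node l r then (t21 l + t21 r + (nodes l).+1 * nodes r)%N else 0%N.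

Fixpoint t123 (t : bintree) : nat :=
  if t is Node l r then (t123 l + t123 r + t12 l)%N else 0%N.

Fixpoint t213 (t : bintree) : nat :=
  if t is Node l r then (t213 l + t213 r + t21 l)%N else 0%N.

Fixpoint t231 (t : bintree) : nat :=
  if t is Node l r then (t231 l + t231 r + (t12 l + nodes l) * nodes r)%N else 0%N.

Fixpoint t312 (t : bintree) : nat :=
  if t is Node l r then (t312 l + t312 r + (nodes l).+1 * t12 r)%N else 0%N.

(** Every pair of letters is an ascent or a descent. This expresses descents, on which 213 depends,
    through [t12] and the size. *)
Lemma t12_t21 t : ((t12 t + t21 t) * 2 + nodes t = nodes t * nodes t)%N.
Proof. by elim: t => //= l IHl r IHr; nia. Qed.

(* Appending [Node l Empty] at the end of the right spine of [t].  In terms of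
   permutations [mirror] is inversion. *)
Fixpoint spine_app (t l : bintree) : bintree :=
  if t is Node a b then Node a (spine_app b l) else Node l Defs.Empty.

Fixpoint mirror (t : bintree) : bintree :=
  if t is Node l r then spine_app (mirror r) (mirror l) else Defs.Empty.

Lemma mirror_app t l : mirror (spine_app t l) = Node (mirror l) (mirror t).
Proof. by elim: t => //= a _ b ->. Qed.

Lemma mirrorK : involutive mirror.
Proof. by elim=> //= l IHl r IHr; rewrite mirror_app IHl IHr. Qed.

Lemma nodes_app t l : nodes (spine_app t l) = (nodes t + nodes l).+1.
Proof. by elim: t => //= [|a _ b ->]; lia. Qed.

Lemma nodes_mirror t : nodes (mirror t) = nodes t.
Proof. by elim: t => //= l IHl r IHr; rewrite nodes_app IHl IHr addnC. Qed.

Lemma t12_app t l : t12 (spine_app t l) = (t12 t + t12 l + nodes l)%N.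
Proof. by elim: t => //= [|a _ b ->]; lia. Qed.

Lemma t12_mirror t : t12 (mirror t) = t12 t.
Proof. by elim: t => //= l IHl r IHr; rewrite t12_app IHl IHr nodes_mirror; lia. Qed.

Lemma t231_app t l : t231 (spine_app t l) =
  (t231 t + t231 l + t12 t * (nodes l).+1)%N.
Proof. by elim: t => [|a _ b /= ->]; rewrite /= ?nodes_app; nia. Qed.

Lemma t231_mirror t : t231 (mirror t) = t312 t.
Proof.
elim: t => //= l IHl r IHr.
by rewrite t231_app IHl IHr t12_mirror nodes_mirror; nia.
Qed.

Lemma mem_trees n t : (t \in trees n) = (nodes t == n).
Proof.
rewrite mem_filter; case: eqP => //= <-.
by rewrite mem_bintrees_height.
Qed.

Lemma sum_mirror (V : nmodType) n (F : bintree -> V) :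
  \sum_(t <- trees n) F (mirror t) = \sum_(t <- trees n) F t.
Proof.
rewrite -(big_map mirror xpredT) /=; apply: perm_big; apply: uniq_perm.
- rewrite (map_inj_uniq (can_inj mirrorK)) filter_uniq //; exact: bintrees_height_uniq.
- by rewrite filter_uniq //; exact: bintrees_height_uniq.
- move=> t; rewrite mem_trees; apply/mapP/idP => [[u]|tn].
    by rewrite mem_trees => un ->; rewrite nodes_mirror.
  by exists (mirror t); rewrite ?mirrorK // mem_trees nodes_mirror.
Qed.

(** * Specialisation to the patterns 123, 213 and 231 *)

Section Cases.
Context {R : realType}.

Lemma rec_rhs_const wH ys mu (A : nat -> nat -> R) k l :
  (forall a b, mu a b 0%N 0%N = 1 :> R) -> (0 < k + l)%N ->
  rec_rhs true wH ys mu A k l =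
  \sum_(0 <= i < k.+1) \sum_(0 <= j < l.+1 | (0 < i + j < k + l)%N) A i j * A (k - i)%N (l - j)%N
  + (if (0 < l)%N then 2^-1 * (mu k (l - 1)%N 0%N 1%N * A k (l - 1)%N) else 0)
  + (if (0 < k)%N then 2^-1 * (mu (k - 1)%N l 1%N 0%N * A (k - 1)%N (l + ys)%N) else 0).
Proof.
move=> mu1 kl; rewrite /rec_rhs ifF; last by lia.
congr (_ + _ + _); apply: eq_big_nat => i /andP[_ ik].
rewrite [RHS]big_mkcond /=; apply: eq_big_nat => j /andP[_ jl].
rewrite big_mkcond big_nat_recl //= big1 ?addr0; last first.
  by move=> q _; rewrite /top_cond andbF.
rewrite /top_cond !xpair_eqE /= !andbT !subn0 muln0 addn0 mu1 mul1r.
rewrite /rho big_ord0 mulr1 mulrC.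
by rewrite ?addn0; congr (if _ then _ else _); lia.
Qed.

Lemma rec_rhs_size wH ys mu (A : nat -> nat -> R) k l : (0 < k + l)%N ->
  rec_rhs false wH ys mu A k l =
  (if (0 < l)%N then 2^-1 * (mu k (l - 1)%N 0%N 1%N * A k (l - 1)%N) else 0)
  + \sum_(0 <= i < k.+1) \sum_(0 <= j < l.+1)
    \sum_(0 <= q < k.+1 | [&& (i + q <= k)%N, (i, j, q) != (0, 0, 0)%N & (i, j, q) != (k, l, 0)%N])
      mu (k - i - q)%N (l - j)%N q 0%N * A (k - i - q)%N (l - j + ys * q)%N
        * (A i j * rho false wH i j q).
Proof. by move=> kl; rewrite /rec_rhs ifF ?addr0 1?addrC //; lia. Qed.

(** Implements the convention that coefficients with a negative index vanish. *)
Definition ext (B : nat -> nat -> R) (k l : int) : R :=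
  if k is Posz k' then if l is Posz l' then B k' l' else 0 else 0.

Lemma ext_neg B k l : (k < 0) || (l < 0) -> ext B k l = 0.
Proof. by case: k l => [k|k] [l|l]. Qed.

Lemma ext_sub B (k l a b : nat) : (a <= k)%N -> (b <= l)%N ->
  ext B (k%:Z - a%:Z) (l%:Z - b%:Z) = B (k - a)%N (l - b)%N.
Proof. by move=> ak bl; rewrite !subzn. Qed.

Lemma moments_limit XX YY eps wH (A : nat -> nat -> R) d :
  d = (wH + (if eps then 1 else 2))%N -> (3 < d)%N ->
  (forall k l, ord_mon XX YY eps wH A k l) -> forall k l : nat,
  n%:R `^ (- ((d * k + 3 * l)%:R / 2)) *
    expect (fun t : btree n => XX (val t) ^+ k * YY (val t) ^+ l) @[n --> \oo] -->
  k`!%:R * l`!%:R * Num.sqrt pi / (2 ^ ((d * k + 3 * l)%:Z - 2) * Gamma (((d * k + 3 * l)%:R - 1) / 2))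
    * ext (fun k l => 2 ^+ (d * k + 3 * l) * A k l) k l.
Proof.
move=> -> d3 h k l.
(* A weight is 0 or at least 3, so the pole at weight 1 never occurs. *)
have N1 : ((wH + (if eps then 1 else 2)) * k + 3 * l)%N != 1%N.
  by move: d3; move: (_ + _)%N => d' d3; case: k => [|k]; lia.
have := ord_limit N1 (h k l); rewrite [ext _ _ _]/=.
move: N1 (_ * k + _)%N => _ N H.
have H' := cvgM (cvg_cst (k`!%:R * l`!%:R : R)) H.
rewrite (_ : _ / _ * (2 ^+ N * A k l) =
   k`!%:R * l`!%:R * (4 * Num.sqrt pi * A k l / Gamma ((N%:R - 1) / 2))); last first.
  rewrite invfM; move: (Gamma _)^-1 => G.
  have -> : (2 ^ (N%:Z - 2))^-1 * G = 4 / 2 ^+ N * G :> R.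
    have e4 : 2 ^ (- 2%:Z) = 4^-1 :> R by rewrite -exprnN; congr (_^-1); ring.
    by rewrite expfzDr ?pnatr_eq0 // e4 -exprnP; field; rewrite expf_neq0 ?pnatr_eq0.
  by field; rewrite expf_neq0 ?pnatr_eq0.
apply: cvg_trans (H' _ _); apply: near_eq_cvg; near=> n.
rewrite /= /expect mulrCA; congr (_ * _); rewrite mulrA; congr (_ / _).
rewrite big_distrr /=; apply: eq_bigr => t _; rewrite /mon /dp.
by field; rewrite !factnz.
Unshelve. all: by end_near. Qed.

(** Turns [rho] into the quotient of Gamma values in the recursion for 231. The case [N = 0] starts
    at -1/2, outside the range of Euler's integral. *)
Lemma Gamma_rise N m : N != 1%N ->
  Gamma ((N%:R - 1) / 2 + m%:R) / Gamma ((N%:R - 1) / 2) =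
  \prod_(t < m) ((N%:R - 1) / 2 + t%:R) :> R.
Proof.
move=> N1; elim: m => [|m IH].
  rewrite addr0 big_ord0 divff //; case: N N1 => [|[|N]] // _.
    by rewrite sub0r mulN1r Gamma_neghalf mulf_neq0 ?oppr_eq0 // gt_eqF // sqrtr_gt0 pi_gt0.
  rewrite (_ : N.+2%:R - 1 = N.+1%:R); last by rewrite -[N.+2%:R]natr1; ring.
  by rewrite gt_eqF // Gamma_half_gt0.
rewrite big_ord_recr /= -IH mulrAC; congr (_ / _).
have GS M : M != 1%N -> Gamma ((M%:R - 1) / 2 + 1) = (M%:R - 1) / 2 * Gamma ((M%:R - 1) / 2) :> R.
  case: M => [|[|M]] // _.
    rewrite sub0r mulN1r Gamma_neghalf (_ : - 2^-1 + 1 = 2^-1); last by field.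
    by rewrite Gamma_half; field.
  rewrite (_ : M.+2%:R - 1 = M.+1%:R) ?Gamma_halfS //.
  by rewrite -[M.+2%:R]natr1; ring.
have e : (N%:R - 1) / 2 + m%:R = ((N + 2 * m)%:R - 1) / 2 :> R.
  by rewrite natrD natrM; field.
rewrite -[m.+1%:R]natr1 addrA e GS; first by ring.
by move: N1; lia.
Qed.

Lemma leading_123 : exists2 A : nat -> nat -> R, A 0%N 0%N = - 2^-1 /\
  (forall k l, (0 < k + l)%N -> A k l =
  \sum_(0 <= i < k.+1) \sum_(0 <= j < l.+1 | (0 < i + j < k + l)%N) A i j * A (k - i)%N (l - j)%N
  + (if (0 < l)%N then 2^-1 * (((4 * k + 3 * l)%:R - 4) / 2 * A k (l - 1)%N) else 0)
  + (if (0 < k)%N then 2^-1 * (l.+1%:R * A (k - 1)%N (l + 1)%N) else 0)) &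
  forall k l, ord_mon (fun t => (t123 t)%:R) (fun t => (t12 t)%:R) true 3 A k l.
Proof.
have [A HA] := @rec_exists R true 3 1 (muY true 3) isT isT.
exists A; last first.
  apply: (ord_mon_rec (H := fun t => (t12 t)%:R) (ys := 1) (mu := muY true 3)) => //.
  - by move=> L Rt; rewrite /sz -!natrD.
  - by move=> L Rt; rewrite mulr1 -!natrD.
  - by move=> *; apply: left_ord_Y.
split; first by rewrite HA.
move=> k l kl; rewrite HA rec_rhs_const //.
  congr (_ + _ + _).
    case: ifP => // l0; congr (_ * (_ * _)).
    rewrite /muY addn0 bin0 divr1 mul1r /rise big_ord1 addr0; congr (_ / _).
    by rewrite (_ : (4 * k + 3 * l = (4 * k + 3 * (l - 1)) + 3)%N) ?natrD; [ring|lia].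
  case: ifP => // k0; congr (_ * (_ * _)).
  by rewrite /muY addn1 bin1 divr1 /rise big_ord0 mulr1.
by move=> a b; rewrite /muY addn0 bin0 divr1 mul1r /rise big_ord0.
Qed.

Lemma leading_213 : exists2 A : nat -> nat -> R, A 0%N 0%N = - 2^-1 /\
  (forall k l, (0 < k + l)%N -> A k l =
  \sum_(0 <= i < k.+1) \sum_(0 <= j < l.+1 | (0 < i + j < k + l)%N) A i j * A (k - i)%N (l - j)%N
  + (if (0 < l)%N then 2^-1 * (((5 * k + 3 * l)%:R - 4) / 2 * A k (l - 1)%N) else 0)
  + (if (0 < k)%N then 2^-1 * (((5 * k + 3 * l)%:R - 6) * ((5 * k + 3 * l)%:R - 4) / 8 *
      A (k - 1)%N l) else 0)) &
  forall k l, ord_mon (fun t => (t213 t)%:R) (fun t => (t12 t)%:R) true 4 A k l.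
Proof.
have [A HA] := @rec_exists R true 4 0 (mu2 true 4) isT isT.
exists A; last first.
  apply: (ord_mon_rec (H := fun t => ch2 t - (t12 t)%:R) (ys := 0) (mu := mu2 true 4)) => //.
  - by move=> L Rt; rewrite /sz -!natrD.
  - move=> L Rt; rewrite mulr1 /= !natrD /ch2 /sz; congr (_ + _).
    have /(congr1 (fun n => n%:R : R)) := t12_t21 L; rewrite natrD !natrM natrD => e.
    by rewrite expr2 -e; field.
  - by move=> *; apply: left_ord_ch2.
split; first by rewrite HA.
move=> k l kl; rewrite HA rec_rhs_const //.
  congr (_ + _ + _).
    case: ifP => // l0; congr (_ * (_ * _)).
    rewrite /mu2 !divr1 /rise big_ord1 addr0 /rise2 big_ord0 mulr1; congr (_ / _).
    by rewrite (_ : (5 * k + 3 * l = (5 * k + 3 * (l - 1)) + 3)%N) ?natrD; [ring|lia].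
  case: ifP => // k0; rewrite addn0; congr (_ * (_ * _)).
  (* With [M = 5 k + 3 l - 6], the order at [(k - 1, l)], one factor [ch2] gives
     [(M / 2) (M / 2 + 1) / 2], hence the 8. *)
  rewrite /mu2 !divr1 /rise big_ord0 mul1r /rise2 big_ord1 mulr0 addr0 muln0 addn0.
  rewrite (_ : (5 * k + 3 * l = (5 * (k - 1) + 3 * l) + 5)%N) ?natrD; last by lia.
  by rewrite /=; field.
by move=> a b; rewrite /mu2 !divr1 /rise /rise2 !big_ord0 mulr1.
Qed.

Lemma leading_231 : exists2 A : nat -> nat -> R, A 0%N 0%N = - 2^-1 /\
  (forall k l, (0 < k + l)%N -> A k l =
  (if (0 < l)%N then 2^-1 * (((5 * k + 3 * l)%:R - 4) / 2 * A k (l - 1)%N) else 0)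
  + \sum_(0 <= i < k.+1) \sum_(0 <= j < l.+1)
    \sum_(0 <= q < k.+1 | [&& (i + q <= k)%N, (i, j, q) != (0, 0, 0)%N & (i, j, q) != (k, l, 0)%N])
      'C(l - j + q, q)%:R * A (k - i - q)%N (l - j + q)%N
        * (A i j * (Gamma (((5 * i + 3 * j)%:R - 1) / 2 + q%:R)
          / Gamma (((5 * i + 3 * j)%:R - 1) / 2)))) &
  forall k l, ord_mon (fun t => (t231 t)%:R) (fun t => (t12 t)%:R) false 3 A k l.
Proof.
have [A HA] := @rec_exists R false 3 1 (muY false 3) isT isT.
exists A; last first.
  apply: (ord_mon_rec (H := fun t => (t12 t)%:R + sz t) (ys := 1) (mu := muY false 3)) => //.
  - by move=> L Rt; rewrite /sz -!natrD.
  - by move=> L Rt; rewrite /sz -!natrD -natrM -natrD.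
  - by move=> *; apply: left_ord_Ysz.
split; first by rewrite HA.
move=> k l kl; rewrite HA rec_rhs_size //; congr (_ + _).
  case: ifP => // l0; congr (_ * (_ * _)).
  rewrite /muY addn0 bin0 divr1 mul1r /rise big_ord1 addr0; congr (_ / _).
  by rewrite (_ : (5 * k + 3 * l = (5 * k + 3 * (l - 1)) + 3)%N) ?natrD; [ring|lia].
apply: eq_bigr => i _; apply: eq_bigr => j _; apply: eq_bigr => q _.
rewrite Gamma_rise; last by lia.
by rewrite mul1n /muY divr1 /rise big_ord0 mulr1.
Qed.

End Cases.

(** * Pattern counts in words and permutations *)

Section PatternCounts.
Implicit Types (w u v : seq nat) (F : nat -> nat -> nat) (Q : nat -> nat -> nat -> bool).
Local Open Scope nat_scope.

Fixpoint ps2 F w : nat :=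
  if w is x :: w' then \sum_(y <- w') F x y + ps2 F w' else 0.

Fixpoint pc3 Q w : nat :=
  if w is x :: w' then ps2 (fun y z => Q x y z : nat) w' + pc3 Q w' else 0.

Lemma sum_nth (F : nat -> nat) w : \sum_(y <- w) F y = \sum_(i < size w) F (nth 0 w i).
Proof. by rewrite (big_nth 0) big_mkord. Qed.

Lemma ps2_nth F w : ps2 F w =
  \sum_(i < size w) \sum_(j < size w | i < j) F (nth 0 w i) (nth 0 w j).
Proof.
elim: w => [|x w IH] /=; first by rewrite big_ord0.
rewrite big_ord_recl [X in _ = X + _]big_mkcond big_ord_recl /= add0n IH sum_nth; congr (_ + _).
apply: eq_bigr => i _; rewrite [RHS]big_mkcond big_ord_recl /= add0n [LHS]big_mkcond.
by apply: eq_bigr => j _; rewrite /bump !add1n ltnS.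
Qed.

Lemma pc3_nth Q w : pc3 Q w =
  \sum_(i < size w) \sum_(j < size w | i < j) \sum_(k < size w | j < k)
    Q (nth 0 w i) (nth 0 w j) (nth 0 w k).
Proof.
elim: w => [|x w IH] /=; first by rewrite big_ord0.
have E (G : 'I_(size w) -> nat) (H : nat -> nat -> nat) (a : nat) :
  \sum_(k < (size w).+1 | a.+1 < k) H a.+1 k = \sum_(k < size w | a < k) H a.+1 k.+1.
  rewrite big_mkcond big_ord_recl /= add0n [RHS]big_mkcond /=.
  by apply: eq_bigr => k _; rewrite /bump add1n ltnS.
rewrite big_ord_recl big_mkcond big_ord_recl /= add0n IH ps2_nth; congr (_ + _).
  apply: eq_bigr => i _; rewrite [RHS]big_mkcond big_ord_recl /= add0n [LHS]big_mkcond.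
  by apply: eq_bigr => j _; rewrite /bump !add1n ltnS.
apply: eq_bigr => i _; rewrite [RHS]big_mkcond big_ord_recl /= add0n [LHS]big_mkcond.
apply: eq_bigr => j _; rewrite /bump !add1n ltnS; case: ifP => // _.
rewrite [RHS]big_mkcond big_ord_recl /= add0n [LHS]big_mkcond.
by apply: eq_bigr => k _; rewrite /bump !add1n ltnS.
Qed.

Lemma eq_ps2 F F' w : {in w &, F =2 F'} -> ps2 F w = ps2 F' w.
Proof.
elim: w => //= x w IH e; rewrite IH; last first.
  by move=> y z yw zw; apply: e; rewrite inE ?yw ?zw orbT.
by congr (_ + _); apply: eq_big_seq => y yw; apply: e; rewrite inE ?eqxx ?yw ?orbT.
Qed.

Lemma eq_ps2_uniq F F' w : uniq w -> {in w &, forall x y, x != y -> F x y = F' x y} ->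
  ps2 F w = ps2 F' w.
Proof.
elim: w => //= x w IH /andP[xw uw] e; rewrite IH //; last first.
  by move=> y z yw zw; apply: e; rewrite inE ?yw ?zw orbT.
congr (_ + _); apply: eq_big_seq => y yw; apply: e; rewrite ?inE ?eqxx ?yw ?orbT //.
by apply: contraNneq xw => ->.
Qed.

Lemma sum_seq_const (T : Type) (w : seq T) c : \sum_(x <- w) c = size w * c.
Proof. by rewrite big_const_seq count_predT iter_addn_0 mulnC. Qed.

Lemma ps2_0 w : ps2 (fun _ _ => 0) w = 0.
Proof. by elim: w => //= x w ->; rewrite big1. Qed.

Lemma ps2Z F c w : ps2 (fun x y => F x y * c) w = ps2 F w * c.
Proof. by elim: w => //= x w ->; rewrite mulnDl big_distrl. Qed.

Lemma ps2_cat F u v : ps2 F (u ++ v) = ps2 F u + ps2 F v + \sum_(x <- u) \sum_(y <- v) F x y.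
Proof.
elim: u => /= [|x u IH]; first by rewrite big_nil addn0.
by rewrite IH big_cat big_cons /=; lia.
Qed.

Lemma pc3_cat Q u v : pc3 Q (u ++ v) = pc3 Q u + pc3 Q v
  + ps2 (fun x y => \sum_(z <- v) Q x y z) u + \sum_(x <- u) ps2 (fun y z => Q x y z : nat) v.
Proof.
elim: u => /= [|x u IH]; first by rewrite big_nil !addn0.
by rewrite IH ps2_cat big_cons /=; lia.
Qed.

Lemma ps2_map F f w : ps2 F (map f w) = ps2 (fun x y => F (f x) (f y)) w.
Proof. by elim: w => //= x w ->; rewrite big_map. Qed.

Lemma pc3_map Q f w : pc3 Q (map f w) = pc3 (fun x y z => Q (f x) (f y) (f z)) w.
Proof. by elim: w => //= x w ->; rewrite ps2_map. Qed.

Lemma eq_pc3 Q Q' w :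
  (forall x y z, x \in w -> y \in w -> z \in w -> Q x y z = Q' x y z) -> pc3 Q w = pc3 Q' w.
Proof.
elim: w => //= x w IH e; rewrite IH; last first.
  by move=> y z t yw zw tw; apply: e; rewrite inE ?yw ?zw ?tw orbT.
by congr (_ + _); apply: eq_ps2 => y z yw zw; rewrite e ?inE ?eqxx ?yw ?zw ?orbT.
Qed.

(* [x y z] has the same relative order as [a b c]. *)
Definition pat3 a b c x y z :=
  [&& (a < b) == (x < y), (b < a) == (y < x), (a < c) == (x < z),
      (c < a) == (z < x), (b < c) == (y < z) & (c < b) == (z < y)].

Definition gtb x y : nat := y < x.
Definition ltb x y : nat := x < y.

Lemma pc3_pat_mono a b c f w : {in w &, {mono f : x y / x < y}} ->
  pc3 (pat3 a b c) (map f w) = pc3 (pat3 a b c) w.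
Proof.
move=> fm; rewrite pc3_map; apply: eq_pc3 => x y z xw yw zw.
by rewrite /pat3 !fm.
Qed.

(* The word of a permutation cut at its largest letter, for a 132-avoiding one. *)
Definition split_word (L : seq nat) (m : nat) (Rw : seq nat) :=
  [/\ uniq (L ++ m :: Rw), {in L, forall x, x < m},
  {in Rw, forall y, y < m} & {in L & Rw, forall x y, y < x}].

Lemma ps2_ltb_split (L : seq nat) (m : nat) (Rw : seq nat) : split_word L m Rw ->
  ps2 ltb (L ++ m :: Rw) = ps2 ltb L + ps2 ltb Rw + size L.
Proof.
move=> [_ Lm Rm LR]; rewrite ps2_cat /=.
rewrite [\sum_(y <- Rw) ltb m y]big1_seq; last first.
  by move=> y /andP[_ /Rm]; rewrite /ltb; lia.
rewrite add0n -sum1_size; congr (_ + _); apply: eq_big_seq => x xL.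
rewrite big_cons {1}/ltb Lm // big1_seq // => y /andP[_ yR].
by have := LR x y xL yR; rewrite /ltb; lia.
Qed.

Lemma ps2_gtb_split (L : seq nat) (m : nat) (Rw : seq nat) : split_word L m Rw ->
  ps2 gtb (L ++ m :: Rw) = ps2 gtb L + ps2 gtb Rw + (size L).+1 * size Rw.
Proof.
move=> [_ Lm Rm LR]; rewrite ps2_cat /=.
have -> : \sum_(y <- Rw) gtb m y = size Rw.
  by rewrite -sum1_size; apply: eq_big_seq => y yR; rewrite /gtb Rm.
have -> : \sum_(x <- L) \sum_(y <- m :: Rw) gtb x y = size L * size Rw.
  rewrite -sum_seq_const; apply: eq_big_seq => x xL.
  rewrite big_cons {1}/gtb ltnNge ltnW ?Lm // add0n -sum1_size.
  by apply: eq_big_seq => y yR; rewrite /gtb LR.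
by rewrite mulSn; lia.
Qed.

(** Triples meeting more than one block: [f] covers two letters of [L] followed by [m] or a letter
    of [Rw], [c1] one letter from each block, and [g] two letters of [Rw] after [m] or a letter of
    [L], which look alike since both exceed all of [Rw]. *)
Lemma pc3_split Q (L : seq nat) (m : nat) (Rw : seq nat) (f : nat -> nat -> nat) (c1 : nat)
    (g : nat -> nat -> nat) :
  split_word L m Rw ->
  {in L &, forall x y, x != y -> Q x y m + \sum_(z <- Rw) Q x y z = f x y} ->
  {in L & Rw, forall x y, Q x m y = c1 :> nat} ->
  {in L, forall x, {in Rw &, forall y z, y != z -> Q x y z = g y z :> nat}} ->
  {in Rw &, forall y z, y != z -> Q m y z = g y z :> nat} ->
  pc3 Q (L ++ m :: Rw) = pc3 Q L + pc3 Q Rw + ps2 f L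
    + size L * (c1 * size Rw) + (size L).+1 * ps2 g Rw.
Proof.
move=> [uw Lm Rm LR] H1 H2 H3 H4; rewrite pc3_cat /=.
move: uw; rewrite cat_uniq /= => /and4P[uL _ mR uR].
have -> : ps2 (fun x y => \sum_(z <- m :: Rw) Q x y z) L = ps2 f L.
  by apply: eq_ps2_uniq => // x y xL yL xy; rewrite big_cons H1.
rewrite (eq_ps2_uniq uR H4).
have -> : \sum_(x <- L) (\sum_(y <- Rw) Q x m y + ps2 (fun y z => Q x y z : nat) Rw) =
   \sum_(x <- L) (c1 * size Rw + ps2 g Rw).
  apply: eq_big_seq => x xL; congr (_ + _).
    rewrite mulnC -sum_seq_const; apply: eq_big_seq => y yR; exact: H2.
  exact: eq_ps2_uniq (H3 x xL).
by rewrite sum_seq_const mulSn mulnDr; lia.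
Qed.

Ltac pat3_lia :=
  rewrite /pat3 /ltb /gtb /=; lia.

Lemma pc3_123_split (L : seq nat) (m : nat) (Rw : seq nat) : split_word L m Rw ->
  pc3 (pat3 1 2 3) (L ++ m :: Rw) = pc3 (pat3 1 2 3) L + pc3 (pat3 1 2 3) Rw + ps2 ltb L.
Proof.
move=> sw; have [_ Lm Rm LR] := sw.
rewrite (@pc3_split _ _ _ _ ltb 0 (fun _ _ => 0)) //.
- by rewrite ps2_0; lia.
- move=> x y xL yL xy; rewrite big1_seq => [|z /andP[_ zR]].
    by have := Lm x xL; have := Lm y yL; pat3_lia.
  by have := LR x z xL zR; pat3_lia.
- by move=> x y xL yR; have := LR x y xL yR; have := Lm x xL; pat3_lia.
- by move=> x xL y z yR zR yz; have := LR x y xL yR; have := LR x z xL zR; pat3_lia.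
- by move=> y z yR zR yz; have := Rm y yR; have := Rm z zR; pat3_lia.
Qed.

Lemma pc3_132_split (L : seq nat) (m : nat) (Rw : seq nat) : split_word L m Rw ->
  pc3 (pat3 1 3 2) (L ++ m :: Rw) = pc3 (pat3 1 3 2) L + pc3 (pat3 1 3 2) Rw.
Proof.
move=> sw; have [_ Lm Rm LR] := sw.
rewrite (@pc3_split _ _ _ _ (fun _ _ => 0) 0 (fun _ _ => 0)) //.
- by rewrite !ps2_0; lia.
- move=> x y xL yL xy; rewrite big1_seq => [|z /andP[_ zR]].
    by have := Lm x xL; have := Lm y yL; pat3_lia.
  by have := LR x z xL zR; pat3_lia.
- by move=> x y xL yR; have := LR x y xL yR; have := Lm x xL; pat3_lia.
- by move=> x xL y z yR zR yz; have := LR x y xL yR; have := LR x z xL zR; pat3_lia.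
- by move=> y z yR zR yz; have := Rm y yR; have := Rm z zR; pat3_lia.
Qed.

Lemma pc3_213_split (L : seq nat) (m : nat) (Rw : seq nat) : split_word L m Rw ->
  pc3 (pat3 2 1 3) (L ++ m :: Rw) = pc3 (pat3 2 1 3) L + pc3 (pat3 2 1 3) Rw + ps2 gtb L.
Proof.
move=> sw; have [_ Lm Rm LR] := sw.
rewrite (@pc3_split _ _ _ _ gtb 0 (fun _ _ => 0)) //.
- by rewrite ps2_0; lia.
- move=> x y xL yL xy; rewrite big1_seq => [|z /andP[_ zR]].
    by have := Lm x xL; have := Lm y yL; pat3_lia.
  by have := LR x z xL zR; pat3_lia.
- by move=> x y xL yR; have := LR x y xL yR; have := Lm x xL; pat3_lia.
- by move=> x xL y z yR zR yz; have := LR x y xL yR; have := LR x z xL zR; pat3_lia.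
- by move=> y z yR zR yz; have := Rm y yR; have := Rm z zR; pat3_lia.
Qed.

Lemma pc3_231_split (L : seq nat) (m : nat) (Rw : seq nat) : split_word L m Rw ->
  pc3 (pat3 2 3 1) (L ++ m :: Rw) = pc3 (pat3 2 3 1) L + pc3 (pat3 2 3 1) Rw
    + (ps2 ltb L + size L) * size Rw.
Proof.
move=> sw; have [_ Lm Rm LR] := sw.
rewrite (@pc3_split _ _ _ _ (fun x y => ltb x y * size Rw) 1 (fun _ _ => 0)) //.
- by rewrite ps2_0 ps2Z; lia.
- move=> x y xL yL xy; rewrite (_ : pat3 2 3 1 x y m = false); last first.
    by have := Lm x xL; have := Lm y yL; pat3_lia.
  rewrite add0n mulnC -sum_seq_const; apply: eq_big_seq => z zR.
  by have := LR x z xL zR; have := LR y z yL zR; pat3_lia.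
- by move=> x y xL yR; have := LR x y xL yR; have := Lm x xL; have := Rm y yR; pat3_lia.
- by move=> x xL y z yR zR yz; have := LR x y xL yR; have := LR x z xL zR; pat3_lia.
- by move=> y z yR zR yz; have := Rm y yR; have := Rm z zR; pat3_lia.
Qed.

Lemma pc3_312_split (L : seq nat) (m : nat) (Rw : seq nat) : split_word L m Rw ->
  pc3 (pat3 3 1 2) (L ++ m :: Rw) = pc3 (pat3 3 1 2) L + pc3 (pat3 3 1 2) Rw
    + (size L).+1 * ps2 ltb Rw.
Proof.
move=> sw; have [_ Lm Rm LR] := sw.
rewrite (@pc3_split _ _ _ _ (fun _ _ => 0) 0 ltb) //.
- by rewrite ps2_0; lia.
- move=> x y xL yL xy; rewrite big1_seq => [|z /andP[_ zR]].
    by have := Lm x xL; have := Lm y yL; pat3_lia.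
  by have := LR x z xL zR; have := LR y z yL zR; pat3_lia.
- by move=> x y xL yR; have := LR x y xL yR; have := Lm x xL; pat3_lia.
- by move=> x xL y z yR zR yz; have := LR x y xL yR; have := LR x z xL zR; pat3_lia.
- by move=> y z yR zR yz; have := Rm y yR; have := Rm z zR; pat3_lia.
Qed.

End PatternCounts.

(** * Permutation words, ranks and the inverse of the tree map *)

Section Words.
Implicit Types (w u v L : seq nat).
Local Open Scope nat_scope.

Definition perm_word w := perm_eq w (iota 1 (size w)).

Lemma perm_word_uniq w : perm_word w -> uniq w.
Proof. by move=> /perm_uniq ->; exact: iota_uniq. Qed.

Lemma perm_word_mem w x : perm_word w -> (x \in w) = (0 < x <= size w).
Proof. by move=> /perm_mem ->; rewrite mem_iota add1n ltnS. Qed.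

Lemma perm_wordP w : uniq w -> {in w, forall x, 0 < x <= size w} -> perm_word w.
Proof.
move=> uw h; apply: uniq_perm; rewrite ?iota_uniq //.
have sub : {subset w <= iota 1 (size w)} by move=> x /h; rewrite mem_iota add1n ltnS.
by have [] := uniq_min_size uw sub; rewrite ?size_iota.
Qed.

Lemma size_ranks w : size (ranks w) = size w. Proof. by rewrite size_map. Qed.

Definition rank w x := count (fun y => y <= x) w.

Lemma ranksE w : ranks w = map (rank w) w. Proof. by []. Qed.

Lemma rank_mono w : {in w &, {mono rank w : x y / x < y}}.
Proof.
have lt (x y : nat) : y \in w -> x < y -> rank w x < rank w y.
  move=> yw xy; have -> : rank w y = rank w x + count (fun z => x < z <= y) w.
    by rewrite /rank; elim: (w) => //= z w' ->; lia.
  by rewrite -[X in X < _]addn0 ltn_add2l -has_count; apply/hasP; exists y; rewrite ?xy ?leqnn.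
move=> x y xw yw; case: (ltngtP x y) => [xy|yx|->].
- by rewrite lt.
- by apply/negbTE; rewrite -leqNgt ltnW // lt.
- by rewrite ltnn.
Qed.

Lemma perm_word_ranks w : uniq w -> perm_word (ranks w).
Proof.
move=> uw; apply: perm_wordP.
  rewrite ranksE map_inj_in_uniq // => x y xw yw e.
  case: (ltngtP x y) => // xy; [have := rank_mono xw yw|have := rank_mono yw xw];
    by rewrite xy e ltnn.
move=> r /mapP[x xw ->]; rewrite size_ranks count_size andbT -has_count.
by apply/hasP; exists x.
Qed.

Lemma ranks_id w : perm_word w -> ranks w = w.
Proof.
move=> pw; rewrite -[RHS]map_id; apply/eq_in_map => x.
rewrite (perm_word_mem _ pw) => /andP[x0 xs].
have /seq.permP -> := pw.
have -> : size w = x + (size w - x) by lia.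
rewrite iotaD count_cat [X in _ + X](_ : _ = 0) ?addn0; last first.
  apply/eqP; rewrite -leqn0 leqNgt -has_count; apply/hasPn => z.
  by rewrite mem_iota /=; lia.
rewrite -[RHS](size_iota 1 x); apply/eqP; rewrite -all_count; apply/allP => z.
by rewrite mem_iota /=; lia.
Qed.

Lemma ranks_addn k w : ranks (map (addn k) w) = ranks w.
Proof.
rewrite /ranks -map_comp; apply: eq_map => x /=.
by rewrite count_map; apply: eq_count => y /=; rewrite leq_add2l.
Qed.

Definition avoid w := pc3 (pat3 1 3 2) w == 0.

Lemma ps2_ltb_ranks w : ps2 ltb (ranks w) = ps2 ltb w.
Proof.
by rewrite ranksE ps2_map; apply: eq_ps2 => x y xw yw; rewrite /ltb rank_mono.
Qed.

Lemma ps2_gtb_ranks w : ps2 gtb (ranks w) = ps2 gtb w.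
Proof.
by rewrite ranksE ps2_map; apply: eq_ps2 => x y xw yw; rewrite /gtb rank_mono.
Qed.

Lemma pc3_ranks a b c w : pc3 (pat3 a b c) (ranks w) = pc3 (pat3 a b c) w.
Proof. by rewrite ranksE pc3_pat_mono //; exact: rank_mono. Qed.

Lemma pc3_gt0 (Q : nat -> nat -> nat -> bool) (L : seq nat) (m : nat) (Rw : seq nat)
    (x y : nat) :
  x \in L -> y \in Rw -> Q x m y -> 0 < pc3 Q (L ++ m :: Rw).
Proof.
move=> xL yR q; rewrite pc3_cat /=; apply: (@leq_trans 1) => //.
apply: leq_trans (leq_addl _ _).
rewrite (big_rem x) //= (big_rem y) //= q; lia.
Qed.

(** A letter before the maximum and a larger letter after it would form a 132 together with the
    maximum. *)
Lemma word_split w : perm_word w -> avoid w -> 0 < size w ->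
  let l := index (size w) w in
  w = take l w ++ size w :: drop l.+1 w /\ split_word (take l w) (size w) (drop l.+1 w).
Proof.
move=> pw aw w0 l.
have mw : size w \in w by rewrite (perm_word_mem _ pw) w0 leqnn.
have e : w = take l w ++ size w :: drop l.+1 w.
  by rewrite -{1}(nth_index 0 mw) -drop_nth ?index_mem // cat_take_drop.
split=> //; have uw := perm_word_uniq pw.
have lem x : x \in w -> x <= size w by rewrite (perm_word_mem _ pw) => /andP[].
move: aw; rewrite /avoid; move: (uw); rewrite {1 2}e.
move: e; move: (take l w) (drop l.+1 w) => L Rw e.
rewrite cat_uniq /= negb_or => /and3P[uL /andP[mL disj] /andP[mR uR]] aw.
have Lm : {in L, forall x, x < size w}.
  move=> x xL; have xw : x \in w by rewrite e mem_cat xL.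
  rewrite ltn_neqAle lem // andbT.
  by apply: contraNneq mL => <-.
have Rm : {in Rw, forall x, x < size w}.
  move=> x xR; have xw : x \in w by rewrite e mem_cat inE xR !orbT.
  rewrite ltn_neqAle lem // andbT.
  by apply: contraNneq mR => <-.
split => //.
- by rewrite -e.
- move=> x y xL yR; case: (ltngtP x y) => // [xy|xy].
    have := @pc3_gt0 (pat3 1 3 2) L (size w) Rw x y xL yR; rewrite (eqP aw) => /(_ _)/notF; case.
    by have := Rm y yR; rewrite /pat3 /=; lia.
  by move/hasPn: disj => /(_ y yR) /=; rewrite -xy xL.
Qed.

(** Avoidance passes to both pieces by [pc3_132_split], and taking ranks changes no count. *)
Lemma word_tree_stats m w : size w <= m -> perm_word w -> avoid w ->
  let t := word_tree m w in
  [/\ nodes t = size w, t12 t = ps2 ltb w & t21 t = ps2 gtb w] /\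
  [/\ t123 t = pc3 (pat3 1 2 3) w, t213 t = pc3 (pat3 2 1 3) w,
      t231 t = pc3 (pat3 2 3 1) w & t312 t = pc3 (pat3 3 1 2) w].
Proof.
elim: m w => [|m IH] w.
  by rewrite leqn0 => /nilP ->.
move=> wm pw aw /=; case: nilP => [->//|/eqP w0].
have sw : 0 < size w by rewrite lt0n size_eq0.
have [e sp] := word_split pw aw sw.
move: e sp; set L := take _ _; set Rw := drop _ _ => e sp.
have [uw Lm Rm LR] := sp.
move: uw; rewrite cat_uniq /= => /and4P[uL _ _ uR].
have se : size w = size L + (size Rw).+1 by rewrite {1}e size_cat.
have aLR : (pc3 (pat3 1 3 2) L == 0) && (pc3 (pat3 1 3 2) Rw == 0).
  by move: aw; rewrite /avoid {1}e pc3_132_split // addn_eq0.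
have [aL aR] := andP aLR.
have [||/=|[nL yL vL] [x1 x2 x3 x4]] := IH (ranks L).
- by rewrite size_ranks; lia.
- exact: perm_word_ranks.
- by rewrite /avoid pc3_ranks.
have [||/=|[nR yR vR] [z1 z2 z3 z4]] := IH (ranks Rw).
- by rewrite size_ranks; lia.
- exact: perm_word_ranks.
- by rewrite /avoid pc3_ranks.
rewrite !size_ranks !pc3_ranks !ps2_ltb_ranks !ps2_gtb_ranks in
  nL yL vL x1 x2 x3 x4 nR yR vR z1 z2 z3 z4.
rewrite nL yL vL x1 x2 x3 x4 nR yR vR z1 z2 z3 z4; split; split.
- by rewrite se addnS.
- by rewrite [in RHS]e ps2_ltb_split //; lia.
- by rewrite [in RHS]e ps2_gtb_split.
- by rewrite [in RHS]e pc3_123_split.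
- by rewrite [in RHS]e pc3_213_split.
- by rewrite [in RHS]e pc3_231_split.
- by rewrite [in RHS]e pc3_312_split.
Qed.

(** The left block is shifted above the right one, as 132-avoidance forces. *)
Fixpoint tree_word (t : bintree) : seq nat :=
  if t is Node l r then
    map (addn (nodes r)) (tree_word l) ++ (nodes l + nodes r).+1 :: tree_word r
  else [::].

Lemma size_tree_word t : size (tree_word t) = nodes t.
Proof. by elim: t => //= l IHl r IHr; rewrite size_cat size_map /= IHl IHr addnS. Qed.

Lemma tree_word_perm t : perm_word (tree_word t).
Proof.
elim: t => //= l IHl r IHr.
have ml x : (x \in tree_word l) = (0 < x <= nodes l) by rewrite perm_word_mem // size_tree_word.
have mr x : (x \in tree_word r) = (0 < x <= nodes r) by rewrite perm_word_mem // size_tree_word.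
have s : size (map (addn (nodes r)) (tree_word l) ++ (nodes l + nodes r).+1 :: tree_word r)
   = (nodes l + nodes r).+1 by rewrite size_cat size_map /= !size_tree_word addnS.
apply: perm_wordP; last first.
  move=> x; rewrite s mem_cat inE mr => /or3P[/mapP[y]|/eqP->|]; rewrite ?ml; lia.
rewrite cat_uniq map_inj_uniq; last exact: addnI.
rewrite (perm_word_uniq IHl) /= mr (perm_word_uniq IHr) andbT negb_or.
rewrite -andbA; apply/and3P; split; last by lia.
- by apply/mapP => -[y]; rewrite ml; lia.
- by apply/hasPn => y; rewrite mr => yr; apply/mapP => -[z]; rewrite ml; lia.
Qed.

Lemma tree_word_split (l r : bintree) : split_word (map (addn (nodes r)) (tree_word l))
  (nodes l + nodes r).+1 (tree_word r).
Proof.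
have ml x : (x \in tree_word l) = (0 < x <= nodes l).
  by rewrite perm_word_mem ?size_tree_word //; exact: tree_word_perm.
have mr x : (x \in tree_word r) = (0 < x <= nodes r).
  by rewrite perm_word_mem ?size_tree_word //; exact: tree_word_perm.
split.
- exact: perm_word_uniq (tree_word_perm (Node l r)).
- by move=> x /mapP[y]; rewrite ml; lia.
- by move=> y; rewrite mr; lia.
- by move=> x y /mapP[z]; rewrite ml mr; lia.
Qed.

Lemma tree_word_avoid t : avoid (tree_word t).
Proof.
elim: t => //= l IHl r IHr; rewrite /avoid pc3_132_split; last exact: tree_word_split.
rewrite pc3_pat_mono; last by move=> x y _ _; rewrite ltn_add2l.
by rewrite (eqP IHl) (eqP IHr).
Qed.

(** Surjectivity of the tree map, which makes the choice in [perm_of_tree] succeed. *)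
Lemma tree_wordK m t : nodes t <= m -> word_tree m (tree_word t) = t.
Proof.
elim: m t => [|m IH] [|l r] //= tm.
have [_ Lm Rm LR] := tree_word_split l r.
set w := _ ++ _ :: _.
have sw : size w = (nodes l + nodes r).+1.
  by rewrite /w size_cat size_map /= !size_tree_word addnS.
have -> : nilp w = false by rewrite /nilp sw.
have iw : index (size w) w = nodes l.
  rewrite /w index_cat sw ifF; last first.
    by apply/negbTE/negP => /Lm; rewrite ltnn.
  by rewrite /= eqxx size_map size_tree_word addn0.
rewrite iw /w take_size_cat ?drop_cat ?size_map ?size_tree_word //.
rewrite ltnNge leqnSn /= subSnn /= drop0 ranks_addn !ranks_id ?IH //; try exact: tree_word_perm; lia.
Qed.

End Words.

(** * From occurrences in permutations to counts in words and trees *)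

Section PermutationStatistics.
Local Open Scope nat_scope.

Lemma oneline_nth n (p : 'S_n) (i : 'I_n) : nth 0 (oneline p) i = (p i).+1.
Proof. by rewrite (nth_map i) ?size_enum_ord // nth_ord_enum. Qed.

Lemma size_oneline n (p : 'S_n) : size (oneline p) = n.
Proof. by rewrite size_map size_enum_ord. Qed.

Lemma oneline_perm_word n (p : 'S_n) : perm_word (oneline p).
Proof.
apply: perm_wordP; first by rewrite map_inj_uniq ?enum_uniq // => i j [] /val_inj /perm_inj.
by move=> x /mapP[i _ ->]; rewrite size_oneline ltn_ord.
Qed.

Lemma forall_ord2 (P : pred 'I_2) : [forall a, P a] = P ord0 && P (lift ord0 ord0).
Proof.
apply/forallP/andP => [h|[h0 h1] [[|[|a]] ai]] //.
  by rewrite (_ : Ordinal ai = ord0) //; exact: val_inj.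
by rewrite (_ : Ordinal ai = lift ord0 ord0) //; exact: val_inj.
Qed.

Lemma forall_ord3 (P : pred 'I_3) :
  [forall a, P a] = [&& P ord0, P (lift ord0 ord0) & P (lift ord0 (lift ord0 ord0))].
Proof.
apply/forallP/and3P => [h|[h0 h1 h2] [[|[|[|a]]] ai]] //.
- by rewrite (_ : Ordinal ai = ord0) //; exact: val_inj.
- by rewrite (_ : Ordinal ai = lift ord0 ord0) //; exact: val_inj.
- by rewrite (_ : Ordinal ai = lift ord0 (lift ord0 ord0)) //; exact: val_inj.
Qed.

Lemma occ2 n (p : 'S_n) : occ pat12 p = ps2 ltb (oneline p).
Proof.
rewrite ps2_nth size_oneline pair_big_dep /= /occ -sum1_card.
pose h (x : 'I_n * 'I_n) : {ffun 'I_2 -> 'I_n} := [ffun a => if a == ord0 then x.1 else x.2].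
pose h' (f : {ffun 'I_2 -> 'I_n}) := (f ord0, f (lift ord0 ord0)).
have hK : cancel h h' by case=> a b; rewrite /h' /h !ffunE /=.
have h'K : cancel h' h.
  move=> f; apply/ffunP => a; rewrite ffunE /=.
  case: ifP => [/eqP->//|]; case: a => [[|[|a]] ai] // _; congr (f _); exact: val_inj.
rewrite (reindex h) /=; last by exists h' => x _; [exact: hK|exact: h'K].
rewrite big_mkcond [RHS]big_mkcond; apply: eq_bigr => -[a b] _ /=.
rewrite !inE !forall_ord2 /h !ffunE /= !perm1 /= !oneline_nth /ltb.
by rewrite /bump /= !ltnS; case: (a < b) => //=; case: ifP; lia.
Qed.

(** Position functions are reindexed by triples, and the pattern enters through its one-line word
    only, so one proof serves all patterns of length 3. *)
Lemma occ3 n (s : 'S_3) (p : 'S_n) x y z : oneline s = [:: x; y; z] ->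
  occ s p = pc3 (pat3 x y z) (oneline p).
Proof.
move=> os.
have [s0 s1 s2] : [/\ x = (s ord0).+1, y = (s (lift ord0 ord0)).+1
    & z = (s (lift ord0 (lift ord0 ord0))).+1].
  by move: os; rewrite /oneline !enum_ordSl enum_ord0 /= => -[<- <- <-].
rewrite pc3_nth size_oneline /occ -sum1_card.
under [RHS]eq_bigr => i _ do under eq_bigr => j _ do rewrite big_mkcond /=.
rewrite pair_big_dep pair_big_dep /=.
pose h (x : 'I_n * 'I_n * 'I_n) : {ffun 'I_3 -> 'I_n} :=
  [ffun a => if a == ord0 then x.1.1 else if a == lift ord0 ord0 then x.1.2 else x.2].
pose h' (f : {ffun 'I_3 -> 'I_n}) :=
  (f ord0, f (lift ord0 ord0), f (lift ord0 (lift ord0 ord0))).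
have hK : cancel h h' by case=> -[a b] c; rewrite /h' /h !ffunE /=.
have h'K : cancel h' h.
  move=> f; apply/ffunP => a; rewrite ffunE /=.
  case: ifP => [/eqP->//|]; case: ifP => [/eqP->//|].
  case: a => [[|[|[|a]]] ai] // _ _; congr (f _); exact: val_inj.
rewrite (reindex h) /=; last by exists h' => u _; [exact: hK|exact: h'K].
rewrite big_mkcond [RHS]big_mkcond; apply: eq_bigr => -[[a b] c] _ /=.
rewrite !inE !forall_ord3 /h !ffunE /= !oneline_nth /pat3 s0 s1 s2 !ltnS /bump /=.
case ab: (a < b) => //=; case bc: (b < c) => //=; rewrite ?andbF ?andbT //=.
rewrite (ltn_trans ab bc) /=; case: ifP; lia.
Qed.

Lemma word_permutation n w : perm_word w -> size w = n -> exists p : 'S_n, oneline p = w.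
Proof.
move=> pw sw.
have wi (i : 'I_n) : 0 < nth 0 w i <= n.
  by have : nth 0 w i \in w; [rewrite mem_nth // sw|rewrite perm_word_mem // sw].
pose f (i : 'I_n) : 'I_n := insubd i (nth 0 w i).-1.
have fE i : (f i).+1 = nth 0 w i.
  by have := wi i; rewrite /f val_insubd; case: (nth 0 w i) => // m /= ->.
have finj : injective f.
  move=> i j e; apply: val_inj; apply/eqP.
  have /eqP : nth 0 w i = nth 0 w j by rewrite -!fE e.
  by rewrite nth_uniq ?sw //; exact: perm_word_uniq.
exists (perm finj); apply: (@eq_from_nth _ 0) => [|i]; rewrite size_oneline // => ni.
by rewrite (oneline_nth _ (Ordinal ni)) permE fE.
Qed.

Lemma perm_of_treeP n (t : btree n) :
  avoid (oneline (perm_of_tree t)) /\ tree_of_perm (perm_of_tree t) = val t.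
Proof.
have avE (p : 'S_n) : (p \in @avoids132 n) = avoid (oneline p).
  by rewrite inE (occ3 _ oneline132).
rewrite /perm_of_tree; case: pickP => [p /andP[av /eqP e]|h] /=; first by rewrite -avE.
have tn := eqP (valP t).
have [p pE] := word_permutation (tree_word_perm (val t)) (etrans (size_tree_word _) tn).
have := h p; rewrite /= avE pE tree_word_avoid /tree_of_perm pE tree_wordK ?eqxx //.
by rewrite tn.
Qed.

Lemma X_tree n (t : btree n) : [/\ Y t = t12 (val t), X pat123 t = t123 (val t),
  X pat213 t = t213 (val t), X pat231 t = t231 (val t) & X pat312 t = t312 (val t)].
Proof.
have [av e] := perm_of_treeP t.
have sn : size (oneline (perm_of_tree t)) <= n by rewrite size_oneline.
have [[_ e1 _] [e2 e3 e4 e5]] := word_tree_stats sn (oneline_perm_word _) av.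
rewrite -/(tree_of_perm (perm_of_tree t)) e in e1 e2 e3 e4 e5.
rewrite e1 e2 e3 e4 e5 /Y /X occ2.
by rewrite (occ3 _ oneline123) (occ3 _ oneline213) (occ3 _ oneline231) (occ3 _ oneline312).
Qed.

End PermutationStatistics.

Lemma expect_eq (R : realType) n (F : btree n -> R) (G : bintree -> R) :
  (forall t, F t = G (val t)) -> expect F = expect (fun t : btree n => G (val t)).
Proof. by move=> e; rewrite /expect; congr (_ / _); apply: eq_bigr. Qed.

Lemma expect_231_312 (R : realType) n k l :
  expect (fun t : btree n => (X pat231 t)%:R ^+ k * (Y t)%:R ^+ l) =
  expect (fun t : btree n => (X pat312 t)%:R ^+ k * (Y t)%:R ^+ l) :> R.
Proof.
rewrite (expect_eq (F := fun t : btree n => (X pat231 t)%:R ^+ k * (Y t)%:R ^+ l)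
  (G := fun t => (t231 t)%:R ^+ k * (t12 t)%:R ^+ l)); last first.
  by move=> t; have [eY _ _ e231 _] := X_tree t; rewrite eY e231.
rewrite (expect_eq (F := fun t : btree n => (X pat312 t)%:R ^+ k * (Y t)%:R ^+ l)
  (G := fun t => (t312 t)%:R ^+ k * (t12 t)%:R ^+ l)); last first.
  by move=> t; have [eY _ _ _ e312] := X_tree t; rewrite eY e312.
rewrite /expect; congr (_ / _).
rewrite (sum_btree n (fun t => (t231 t)%:R ^+ k * (t12 t)%:R ^+ l)).
rewrite (sum_btree n (fun t => (t312 t)%:R ^+ k * (t12 t)%:R ^+ l)).
rewrite -sum_mirror; apply: eq_bigr => t _.
by rewrite t231_mirror t12_mirror.
Qed.

(** * Rescaled coefficients and the three limits *)

Section Final.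
Context {R : realType}.

(** The weight is additive, so the quadratic sum is unchanged by the rescaling. *)
Lemma ext_quadratic d (A : nat -> nat -> R) k l :
  2 ^+ (d * k + 3 * l) * (\sum_(0 <= i < k.+1) \sum_(0 <= j < l.+1 | (0 < i + j < k + l)%N)
     A i j * A (k - i)%N (l - j)%N) =
  \sum_(0 <= i < k.+1) \sum_(0 <= j < l.+1 | (0 < i + j < k + l)%N)
     ext (fun k l => 2 ^+ (d * k + 3 * l) * A k l) i%:Z j%:Z *
     ext (fun k l => 2 ^+ (d * k + 3 * l) * A k l) (k%:Z - i%:Z) (l%:Z - j%:Z).
Proof.
rewrite big_distrr /=; apply: eq_big_nat => i /andP[_ ik].
rewrite big_distrr /= big_nat_cond [RHS]big_nat_cond; apply: eq_bigr => j /andP[/andP[_ jl] _].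
rewrite ext_sub //= mulrACA -exprD; congr (2 ^+ _ * _).
nia.
Qed.

(** Lowering [l] by one drops the weight by 3, and [2^3 / 4 = 2]. *)
Lemma ext_step d (A : nat -> nat -> R) k l (c : R) :
  2 ^+ (d * k + 3 * l) * (if (0 < l)%N then 2^-1 * (c / 2 * A k (l - 1)%N) else 0) =
  2 * c * ext (fun k l => 2 ^+ (d * k + 3 * l) * A k l) k%:Z (l%:Z - 1).
Proof.
case: l => [|l] /=; first by rewrite !mulr0.
rewrite subn1 /=; have -> : (d * k + 3 * l.+1 = 3 + (d * k + 3 * l))%N by lia.
by rewrite exprD; field.
Qed.

Lemma ext_moments d (A : nat -> nat -> R) XX wH eps (s : 'S_3) :
  d = (wH + (if eps then 1 else 2))%N -> (3 < d)%N ->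
  (forall k l, ord_mon XX (fun t => (t12 t)%:R) eps wH A k l) ->
  (forall n (t : btree n), (X s t)%:R = XX (val t)) -> forall k l : nat,
  (fun n : nat => n%:R `^ (- ((d * k + 3 * l)%:R / 2))
             * expect (fun t : btree n => (X s t)%:R ^+ k * (Y t)%:R ^+ l)) @ \oo -->
          k`!%:R * l`!%:R * Num.sqrt pi
            / (2 ^ ((d * k + 3 * l)%:Z - 2)
               * Gamma (((d * k + 3 * l)%:R - 1) / 2))
            * ext (fun k l => 2 ^+ (d * k + 3 * l) * A k l) k%:Z l%:Z.
Proof.
move=> dE d3 Aord sX k l; have := moments_limit dE d3 Aord (k := k) (l := l).
apply: cvg_trans; apply: near_eq_cvg; near=> n.
rewrite /expect; congr (_ * (_ / _)); apply: eq_bigr => t _.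
by have [eY _ _ _ _] := X_tree t; rewrite sX eY.
Unshelve. all: by end_near. Qed.

Lemma big_quadratic0 (F : nat -> nat -> R) k l : (k + l <= 1)%N ->
  \sum_(0 <= i < k.+1) \sum_(0 <= j < l.+1 | (0 < i + j < k + l)%N) F i j = 0.
Proof. by move=> kl; rewrite big1 // => i _; rewrite big_pred0 // => j; lia. Qed.

Lemma limits_123 : exists alpha : int -> int -> R,
    [/\ (forall k l : int, (k < 0) || (l < 0) -> alpha k l = 0),
        alpha 0 0 = - 2^-1, alpha 1 0 = 1, alpha 0 1 = 1
      & (forall k l : nat, (1 <= k + l)%N ->
          alpha k%:Z l%:Z =
            l.+1%:R * alpha (k%:Z - 1) (l%:Z + 1)
            + 2 * ((4 * k + 3 * l)%:R - 4) * alpha k%:Z (l%:Z - 1)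
            + \sum_(0 <= i < k.+1) \sum_(0 <= j < l.+1 | (0 < i + j < k + l)%N)
                alpha i%:Z j%:Z * alpha (k%:Z - i%:Z) (l%:Z - j%:Z))
        /\
        (forall k l : nat,
          (fun n : nat => n%:R `^ (- ((4 * k + 3 * l)%:R / 2))
             * expect (fun t : btree n =>
                 (X pat123 t)%:R ^+ k * (Y t)%:R ^+ l)) @ \oo -->
          k`!%:R * l`!%:R * Num.sqrt pi
            / (2 ^ ((4 * k + 3 * l)%:Z - 2)
               * Gamma (((4 * k + 3 * l)%:R - 1) / 2))
            * alpha k%:Z l%:Z)].
Proof.
have [A [A00 Arec] Aord] := @leading_123 R.
pose al := ext (fun k l => 2 ^+ (4 * k + 3 * l) * A k l).
have rec k l : (1 <= k + l)%N -> al k%:Z l%:Z =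
    l.+1%:R * al (k%:Z - 1) (l%:Z + 1)
    + 2 * ((4 * k + 3 * l)%:R - 4) * al k%:Z (l%:Z - 1)
    + \sum_(0 <= i < k.+1) \sum_(0 <= j < l.+1 | (0 < i + j < k + l)%N)
        al i%:Z j%:Z * al (k%:Z - i%:Z) (l%:Z - j%:Z).
  move=> kl.
  have -> : al k%:Z l%:Z = 2 ^+ (4 * k + 3 * l) * A k l by [].
  rewrite Arec // mulrDr mulrDr ext_quadratic ext_step -/al.
  rewrite (_ : _ * (if (0 < k)%N then _ else 0) = l.+1%:R * al (k%:Z - 1) (l%:Z + 1)); first ring.
  case: k {kl} => [|k] /=; first by rewrite !mulr0.
  (* Passing to [(k - 1, l + 1)] drops the weight by 1, which cancels the factor 1/2. *)
  rewrite subn1 /=; have -> : (4 * k.+1 + 3 * l = 1 + (4 * k + 3 * (l + 1)))%N by lia.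
  by rewrite exprD; field.
have neg k l : (k < 0) || (l < 0) -> al k l = 0 by exact: ext_neg.
have a00 : al 0 0 = - 2^-1 by rewrite /al /= A00 mul1r.
have a01 : al 0 1 = 1.
  by rewrite (rec 0 1)%N // big_quadratic0 // subrr a00 neg //; field.
have a10 : al 1 0 = 1.
  by rewrite (rec 1 0)%N // big_quadratic0 // subrr add0r a01 [al _ (0 - 1)]neg //; field.
exists al; split => //.
split => //; apply: (ext_moments _ _ Aord) => // n t.
by have [_ -> _ _ _] := X_tree t.
Qed.

Lemma limits_213 : exists beta : int -> int -> R,
    [/\ (forall k l : int, (k < 0) || (l < 0) -> beta k l = 0),
        beta 0 0 = - 2^-1, beta 1 0 = 1, beta 0 1 = 1
      & (forall k l : nat, (1 <= k + l)%N ->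
          beta k%:Z l%:Z =
            2 * ((5 * k + 3 * l)%:R - 6) * ((5 * k + 3 * l)%:R - 4)
              * beta (k%:Z - 1) l%:Z
            + 2 * ((5 * k + 3 * l)%:R - 4) * beta k%:Z (l%:Z - 1)
            + \sum_(0 <= i < k.+1) \sum_(0 <= j < l.+1 | (0 < i + j < k + l)%N)
                beta i%:Z j%:Z * beta (k%:Z - i%:Z) (l%:Z - j%:Z))
        /\
        (forall k l : nat,
          (fun n : nat => n%:R `^ (- ((5 * k + 3 * l)%:R / 2))
             * expect (fun t : btree n =>
                 (X pat213 t)%:R ^+ k * (Y t)%:R ^+ l)) @ \oo -->
          k`!%:R * l`!%:R * Num.sqrt pi
            / (2 ^ ((5 * k + 3 * l)%:Z - 2)
               * Gamma (((5 * k + 3 * l)%:R - 1) / 2))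
            * beta k%:Z l%:Z)].
Proof.
have [A [A00 Arec] Aord] := @leading_213 R.
pose be := ext (fun k l => 2 ^+ (5 * k + 3 * l) * A k l).
have rec k l : (1 <= k + l)%N -> be k%:Z l%:Z =
    2 * ((5 * k + 3 * l)%:R - 6) * ((5 * k + 3 * l)%:R - 4) * be (k%:Z - 1) l%:Z
    + 2 * ((5 * k + 3 * l)%:R - 4) * be k%:Z (l%:Z - 1)
    + \sum_(0 <= i < k.+1) \sum_(0 <= j < l.+1 | (0 < i + j < k + l)%N)
        be i%:Z j%:Z * be (k%:Z - i%:Z) (l%:Z - j%:Z).
  move=> kl.
  have -> : be k%:Z l%:Z = 2 ^+ (5 * k + 3 * l) * A k l by [].
  rewrite Arec // mulrDr mulrDr ext_quadratic ext_step -/be.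
  rewrite (_ : _ * (if (0 < k)%N then _ else 0) =
    2 * ((5 * k + 3 * l)%:R - 6) * ((5 * k + 3 * l)%:R - 4) * be (k%:Z - 1) l%:Z); first ring.
  case: k {kl} => [|k] /=; first by rewrite !mulr0.
  rewrite subn1 /=; move: (_%:R - 6) (_%:R - 4) => a b.
  (* The weight drops by 5, and [2^5 / (2 * 8) = 2]. *)
  have -> : (5 * k.+1 + 3 * l = 5 + (5 * k + 3 * l))%N by lia.
  by rewrite exprD; field.
have neg k l : (k < 0) || (l < 0) -> be k l = 0 by exact: ext_neg.
have b00 : be 0 0 = - 2^-1 by rewrite /be /= A00 mul1r.
have b01 : be 0 1 = 1.
  by rewrite (rec 0 1)%N // big_quadratic0 // subrr b00 neg //; field.
have b10 : be 1 0 = 1.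
  by rewrite (rec 1 0)%N // big_quadratic0 // subrr b00 [be _ (0 - 1)]neg //; field.
exists be; split => //.
split => //; apply: (ext_moments _ _ Aord) => // n t.
by have [_ _ -> _ _] := X_tree t.
Qed.

Lemma limits_231 : exists gamma : int -> int -> R,
    [/\ (forall k l : int, (k < 0) || (l < 0) -> gamma k l = 0),
        gamma 0 0 = - 2^-1, gamma 1 0 = 1, gamma 0 1 = 1
      & (forall k l : nat, (1 <= k + l)%N ->
          gamma k%:Z l%:Z =
            2 * ((5 * k + 3 * l)%:R - 4) * gamma k%:Z (l%:Z - 1)
            + \sum_(0 <= i < k.+1) \sum_(0 <= j < l.+1)
                \sum_(0 <= m < k.+1 |
                        [&& (i + m <= k)%N, (i, j, m) != (0, 0, 0)%N
                          & (i, j, m) != (k, l, 0%N)])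
                  2 ^+ (2 * m)
                  * (Gamma (((5 * i + 3 * j)%:R - 1) / 2 + m%:R)
                     / Gamma (((5 * i + 3 * j)%:R - 1) / 2))
                  * 'C(l - j + m, m)%:R
                  * gamma i%:Z j%:Z
                  * gamma (k%:Z - i%:Z - m%:Z) (l%:Z - j%:Z + m%:Z))
        /\
        (forall k l : nat,
          (fun n : nat => n%:R `^ (- ((5 * k + 3 * l)%:R / 2))
             * expect (fun t : btree n =>
                 (X pat231 t)%:R ^+ k * (Y t)%:R ^+ l)) @ \oo -->
          k`!%:R * l`!%:R * Num.sqrt pi
            / (2 ^ ((5 * k + 3 * l)%:Z - 2)
               * Gamma (((5 * k + 3 * l)%:R - 1) / 2))
            * gamma k%:Z l%:Z)].
Proof.
have [A [A00 Arec] Aord] := @leading_231 R.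
pose ga := ext (fun k l => 2 ^+ (5 * k + 3 * l) * A k l).
have rec k l : (1 <= k + l)%N -> ga k%:Z l%:Z =
    2 * ((5 * k + 3 * l)%:R - 4) * ga k%:Z (l%:Z - 1)
    + \sum_(0 <= i < k.+1) \sum_(0 <= j < l.+1)
        \sum_(0 <= m < k.+1 |
                [&& (i + m <= k)%N, (i, j, m) != (0, 0, 0)%N & (i, j, m) != (k, l, 0%N)])
          2 ^+ (2 * m)
          * (Gamma (((5 * i + 3 * j)%:R - 1) / 2 + m%:R) / Gamma (((5 * i + 3 * j)%:R - 1) / 2))
          * 'C(l - j + m, m)%:R * ga i%:Z j%:Z
          * ga (k%:Z - i%:Z - m%:Z) (l%:Z - j%:Z + m%:Z).
  move=> kl.
  have -> : ga k%:Z l%:Z = 2 ^+ (5 * k + 3 * l) * A k l by [].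
  rewrite Arec // mulrDr ext_step -/ga; congr (_ + _).
  rewrite big_distrr; apply: eq_big_nat => i /andP[_ ik].
  rewrite big_distrr; apply: eq_big_nat => j /andP[_ jl].
  rewrite big_distrr; apply: eq_bigr => m /and3P[im _ _].
  rewrite (_ : k%:Z - i%:Z - m%:Z = (k - i - m)%N); last by lia.
  rewrite (_ : l%:Z - j%:Z + m%:Z = (l - j + m)%N); last by lia.
  rewrite /ga /=.
  (* Each of the [m] cross factors uses up weight 5 and returns 3 through [Y]; the remaining [2 m]
     gives the power of 2 in the recursion. *)
  have -> : (5 * k + 3 * l = 2 * m + (5 * i + 3 * j) + (5 * (k - i - m) + 3 * (l - j + m)))%N by lia.
  by rewrite !exprD; ring.
have neg k l : (k < 0) || (l < 0) -> ga k l = 0 by exact: ext_neg.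
have g00 : ga 0 0 = - 2^-1 by rewrite /ga /= A00 mul1r.
have g01 : ga 0 1 = 1.
  rewrite (rec 0 1)%N // big_nat1 big_nat_cond big1 ?addr0.
    by rewrite subrr g00; field.
  move=> j; rewrite andbT => /andP[_ j2]; rewrite big_pred0 // => m.
  by rewrite !xpair_eqE; lia.
have g10 : ga 1 0 = 1.
  rewrite (rec 1 0)%N // [ga _ (0 - 1)]neg // mulr0 add0r.
  have sum2 (P : pred nat) (F : nat -> R) : \sum_(0 <= m < 2 | P m) F m =
      (if P 0%N then F 0%N else 0) + (if P 1%N then F 1%N else 0).
    by rewrite big_mkcond big_ltn // big_nat1.
  (* The only surviving triple is [(0, 0, 1)], with value [4 (- 1/2) (- 1/2) = 1], where the first
     -1/2 is [Gamma (1/2) / Gamma (- 1/2)]. *)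
  have GR := @Gamma_rise R 0 1 isT; rewrite big_ord1 in GR.
  rewrite big_ltn // big_nat1 !big_nat1 !sum2; clearbody ga => /=.
  rewrite (_ : Gamma _ / Gamma _ = (0%:R - 1) / 2 + 0%:R); last exact: GR.
  rewrite (_ : ga (1%:Z - 0%:Z - 1%:Z) (0%:Z - 0%:Z + 1%:Z) = 1); last exact: g01.
  by rewrite g00 (_ : 'C(0 - 0 + 1, 1) = 1%N) // muln1; field.
exists ga; split => //.
split => //; apply: (ext_moments _ _ Aord) => // n t.
by have [_ _ _ -> _] := X_tree t.
Qed.

End Final.

Unset Implicit Arguments.

Theorem theorem6p5 (R : realType) :
  (exists alpha : int -> int -> R,
    [/\ (forall k l : int, (k < 0) || (l < 0) -> alpha k l = 0),
        alpha 0 0 = - 2^-1, alpha 1 0 = 1, alpha 0 1 = 1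
      & (forall k l : nat, (1 <= k + l)%N ->
          alpha k%:Z l%:Z =
            l.+1%:R * alpha (k%:Z - 1) (l%:Z + 1)
            + 2 * ((4 * k + 3 * l)%:R - 4) * alpha k%:Z (l%:Z - 1)
            + \sum_(0 <= i < k.+1) \sum_(0 <= j < l.+1 | (0 < i + j < k + l)%N)
                alpha i%:Z j%:Z * alpha (k%:Z - i%:Z) (l%:Z - j%:Z))
        /\
        (forall k l : nat,
          (fun n : nat => n%:R `^ (- ((4 * k + 3 * l)%:R / 2))
             * expect (fun t : btree n =>
                 (X pat123 t)%:R ^+ k * (Y t)%:R ^+ l)) @ \oo -->
          k`!%:R * l`!%:R * Num.sqrt pi
            / (2 ^ ((4 * k + 3 * l)%:Z - 2)
               * Gamma (((4 * k + 3 * l)%:R - 1) / 2))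
            * alpha k%:Z l%:Z)])
  /\
  (exists beta : int -> int -> R,
    [/\ (forall k l : int, (k < 0) || (l < 0) -> beta k l = 0),
        beta 0 0 = - 2^-1, beta 1 0 = 1, beta 0 1 = 1
      & (forall k l : nat, (1 <= k + l)%N ->
          beta k%:Z l%:Z =
            2 * ((5 * k + 3 * l)%:R - 6) * ((5 * k + 3 * l)%:R - 4)
              * beta (k%:Z - 1) l%:Z
            + 2 * ((5 * k + 3 * l)%:R - 4) * beta k%:Z (l%:Z - 1)
            + \sum_(0 <= i < k.+1) \sum_(0 <= j < l.+1 | (0 < i + j < k + l)%N)
                beta i%:Z j%:Z * beta (k%:Z - i%:Z) (l%:Z - j%:Z))
        /\
        (forall k l : nat,
          (fun n : nat => n%:R `^ (- ((5 * k + 3 * l)%:R / 2))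
             * expect (fun t : btree n =>
                 (X pat213 t)%:R ^+ k * (Y t)%:R ^+ l)) @ \oo -->
          k`!%:R * l`!%:R * Num.sqrt pi
            / (2 ^ ((5 * k + 3 * l)%:Z - 2)
               * Gamma (((5 * k + 3 * l)%:R - 1) / 2))
            * beta k%:Z l%:Z)])
  /\
  (exists gamma : int -> int -> R,
    [/\ (forall k l : int, (k < 0) || (l < 0) -> gamma k l = 0),
        gamma 0 0 = - 2^-1, gamma 1 0 = 1, gamma 0 1 = 1
      & (forall k l : nat, (1 <= k + l)%N ->
          gamma k%:Z l%:Z =
            2 * ((5 * k + 3 * l)%:R - 4) * gamma k%:Z (l%:Z - 1)
            + \sum_(0 <= i < k.+1) \sum_(0 <= j < l.+1)
                \sum_(0 <= m < k.+1 |
                        [&& (i + m <= k)%N, (i, j, m) != (0, 0, 0)%N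
                          & (i, j, m) != (k, l, 0%N)])
                  2 ^+ (2 * m)
                  * (Gamma (((5 * i + 3 * j)%:R - 1) / 2 + m%:R)
                     / Gamma (((5 * i + 3 * j)%:R - 1) / 2))
                  * 'C(l - j + m, m)%:R
                  * gamma i%:Z j%:Z
                  * gamma (k%:Z - i%:Z - m%:Z) (l%:Z - j%:Z + m%:Z))
        /\
        (forall k l : nat,
          (forall n : nat, (0 < n)%N ->
             n%:R `^ (- ((5 * k + 3 * l)%:R / 2))
               * expect (fun t : btree n =>
                   (X pat231 t)%:R ^+ k * (Y t)%:R ^+ l)
             = n%:R `^ (- ((5 * k + 3 * l)%:R / 2))
               * expect (fun t : btree n =>
                   (X pat312 t)%:R ^+ k * (Y t)%:R ^+ l) :> R) /\
          (fun n : nat => n%:R `^ (- ((5 * k + 3 * l)%:R / 2))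
             * expect (fun t : btree n =>
                 (X pat231 t)%:R ^+ k * (Y t)%:R ^+ l)) @ \oo -->
          k`!%:R * l`!%:R * Num.sqrt pi
            / (2 ^ ((5 * k + 3 * l)%:Z - 2)
               * Gamma (((5 * k + 3 * l)%:R - 1) / 2))
            * gamma k%:Z l%:Z)]).
Proof.
split; first exact: limits_123.
split; first exact: limits_213.
have [gamma [neg g00 g10 g01 [rec lim]]] := @limits_231 R.
exists gamma; split => //; split => // k l; split; last exact: lim.
by move=> n _; rewrite expect_231_312.
Qed.
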